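(* Let $(X,T,\alpha)$ be a weakly mixing AFU map of $X=[0,1]$. Then $\phi_-(n)\to 0$ exponentially, i.e. there exist $B>0$ and $r\in(0,1)$ such that $\phi_-(n)\le B r^n$ for all $n\ge 1$.
   Context: $X=[0,1]$, $m$ is Lebesgue measure, $\mathcal B(X)$ is the Borel $\sigma$-algebra. PM map: a non-singular piecewise monotonic map $(X,T,\alpha)$ consists of a finite or countable collection $\alpha$ of pairwise disjoint nonempty open subintervals of $X$ with $\bigcup_{a\in\alpha}a=X$ modulo $m$-null sets, and a map $T:X\to X$ such that $T|_a$ is absolutely continuous and strictly monotonic for each $a\in\alpha$, and $m\circ T^{-1}\ll m$. For $n\ge 1$, $\alpha_n$ is the collection of nonempty sets of the form $\bigcap_{k=0}^{n-1}T^{-k}a_k$ with $a_0,\dots,a_{n-1}\in\alpha$, and $\sigma(\alpha_n)$ is the $\sigma$-algebra it generates. AFU map: a PM map such that for all $a\in\alpha$, $T|_a$ extends to a $C^2$ diffeomorphism $\overline a\to\overline{Ta}$, and such that (U) $\inf_{x\in a\in\alpha}|T'(x)|>1$, (F) $\{Ta:a\in\alpha\}$ is finite, and (A) $\sup_X |T''|/(T')^2<\infty$. An AFU map that is ergodic with respect to $m$ has a unique absolutely continuous $T$-invariant probability $P\ll m$. An ergodic AFU map is called weakly mixing if $(X,\mathcal B(X),P,T)$ is a weakly mixing probability preserving transformation. Mixing coefficient: $$\phi_-(n)=\sup\Big\{\Big|\tfrac{P(A\cap D)}{P(D)}-P(A)\Big|: k\ge 1,\ A\in\sigma(\alpha_k),\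 D\in T^{-(n+k)}\mathcal B(X),\ P(A)>0,\ P(D)>0\Big\}.$$ *)

(* Defs.v *)
From HB Require Import structures.
From mathcomp Require Import all_boot all_order all_algebra.
From mathcomp Require Import all_classical all_reals all_analysis.

Set Implicit Arguments.
Unset Strict Implicit.
Unset Printing Implicit Defensive.

Import Order.TTheory GRing.Theory Num.Theory.
Import numFieldNormedType.Exports.

Local Open Scope classical_set_scope.
Local Open Scope ring_scope.

(* The space X = [0, 1] is a subset of R and a self-map of X is a function
   T : R -> R with T @` X `<=` X.  All sets and preimages are cut down to X, so
   that the values of T outside of X are irrelevant. *)
Definition X {R : realType} : set R := `[0, 1].

Definition Xpreimage {R : realType} (T : R -> R) (n : nat) (B : set R) : set R :=
  X `&` iter n T @^-1` B.

Section Regularity.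
Context {R : realType}.
Implicit Types (D E : set R) (f : R -> R).

Definition absolutely_continuous_on D f : Prop :=
  forall e : R, 0 < e -> exists2 d : R, 0 < d &
    forall (n : nat) (u v : nat -> R),
      (forall i, (i < n)%N -> u i <= v i /\ `[u i, v i] `<=` D) ->
      trivIset `I_n (fun i => `]u i, v i[%classic) ->
      \sum_(i < n) (v i - u i) < d ->
      \sum_(i < n) `|f (v i) - f (u i)| < e.

Definition strictly_monotonic_on D f : Prop :=
  {in D &, forall x y, x < y -> f x < f y} \/
  {in D &, forall x y, x < y -> f y < f x}.

(* On a closed interval D this is the one-sided derivative at the endpoints. *)
Definition has_derivative_within D f (x l : R) : Prop :=
  (f y - f x) / (y - x) @[y --> within D x^'] --> l.

Definition C2_on D f : Prop :=
  exists f1 f2 : R -> R,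
    [/\ forall x, D x -> has_derivative_within D f x (f1 x),
        forall x, D x -> has_derivative_within D f1 x (f2 x) &
        {within D, continuous f2}].

Definition C2_diffeomorphism D E (g : R -> R) : Prop :=
  [/\ set_bij D E g, C2_on D g &
      exists2 h : R -> R, C2_on E h & forall x, D x -> h (g x) = x].

End Regularity.

Section Maps.
Context {R : realType}.
Implicit Types (T : R -> R) (alpha : set (set R)).
Local Notation m := (@lebesgue_measure R).

Record is_PM_map T alpha : Prop := {
  PM_self : forall x, X x -> X (T x) ;
  PM_measurable : measurable_fun (X : set (measurableTypeR R))
                    (T : measurableTypeR R -> measurableTypeR R) ;
  PM_countable : countable alpha ;
  PM_interval : forall a, alpha a ->
    exists u v : R, [/\ 0 <= u, u < v, v <= 1 & a = `]u, v[%classic] ;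
  PM_disjoint : trivIset alpha id ;
  PM_cover : m (X `\` \bigcup_(a in alpha) a) = 0%E ;
  PM_abs_continuous : forall a, alpha a -> absolutely_continuous_on a T ;
  PM_monotonic : forall a, alpha a -> strictly_monotonic_on a T ;
  PM_nonsingular : forall B : set (measurableTypeR R),
    measurable B -> B `<=` X -> m B = 0%E -> m (Xpreimage T 1 B) = 0%E }.

(* T' and T'' are evaluated only on the open set \bigcup_(a in alpha) a. *)
Record is_AFU_map T alpha : Prop := {
  AFU_PM :> is_PM_map T alpha ;
  AFU_C2 : forall a, alpha a ->
    exists2 g : R -> R, {in a, g =1 T} &
      C2_diffeomorphism (closure a) (closure (T @` a)) g ;
  AFU_U : (1 < ereal_inf [set `|derive1 T x|%:E | x in \bigcup_(a in alpha) a])%E ;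
  AFU_F : finite_set [set T @` a | a in alpha] ;
  AFU_A : (ereal_sup [set (`|derive1n 2 T x| / derive1 T x ^+ 2)%:E
                     | x in \bigcup_(a in alpha) a] < +oo)%E }.

Definition lebesgue_ergodic T : Prop :=
  forall A : set (measurableTypeR R), measurable A -> A `<=` X ->
    Xpreimage T 1 A = A -> m A = 0%E \/ m (X `\` A) = 0%E.

(* P lives on the Borel sets of R; absolute continuity with respect to the
   restriction of m to X forces P X = 1. *)
Definition acip T (P : probability (measurableTypeR R) R) : Prop :=
  P `<< mrestr m (measurable_itv `[0, 1]) /\
  forall B : set (measurableTypeR R), measurable B -> B `<=` X ->
    P (Xpreimage T 1 B) = P B.

Definition weakly_mixing T (P : probability (measurableTypeR R) R) : Prop :=
  forall A B : set (measurableTypeR R),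
    measurable A -> A `<=` X -> measurable B -> B `<=` X ->
    n.+1%:R^-1 * (\sum_(k < n.+1)
      `|fine (P (A `&` Xpreimage T k B)) - fine (P A) * fine (P B)|)
    @[n --> \oo] --> (0 : R).

Definition refined T alpha (n : nat) : set (set R) :=
  [set A | A !=set0 /\ exists2 s : nat -> set R,
     forall k, (k < n)%N -> alpha (s k) &
     A = X `&` \bigcap_(k in `I_n) Xpreimage T k (s k)].

(* The supremum is taken in \bar R, so no boundedness is presupposed. *)
Definition phi_minus T alpha (P : probability (measurableTypeR R) R)
    (n : nat) : \bar R :=
  ereal_sup [set z | exists (k : nat) (A D : set (measurableTypeR R)),
    [/\ (1 <= k)%N, <<s X, refined T alpha k >> A,
        exists2 B : set (measurableTypeR R),
          measurable B /\ B `<=` X & D = Xpreimage T (n + k) B,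
        (0 < P A)%E /\ (0 < P D)%E &
        z = `|fine (P (A `&` D)) / fine (P D) - fine (P A)|%:E]].

End Maps.

(* Main.v *)
(* Some power S = T^N expands by so much, compared with its distortion, that its
   transfer operator L satisfies the Lasota-Yorke inequality
     var (L f) <= 1/2 var f + kappa |f|_1.
   Hence the invariant density h has bounded variation.  The endpoints of the
   components of U = {h bounded below near x} cannot be too close to each other,
   nor can h tend to 0 at such an endpoint, since these configurations are
   contracted by inverse branches, and invariance of P rules them out; so h is
   bounded below on U, and h = 0 almost everywhere off U.  By weak mixing and
   approximation of f / h by step functions, L^n f tends to 0 in L1, uniformly
   over the f of variation at most 1 that have integral 0 and vanish where h does;
   with Lasota-Yorke, some power of L halves the variation on this space.
   For a union A of cylinders of rank q of S, the function
   L^q (1_A h) - P(A) h lies in this space and its variation is bounded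
   independently of A and q, because Lasota-Yorke holds branch by branch.  Since
   the integral of its image under L^n over B is P(A n S^-(n+q) B) - P(A) P(B),
   and a function bounded by a multiple of h has integral O(P(B)) over B,
   exponential contraction gives the claim for S, and then for T. *)

Require Import Defs.
From HB Require Import structures.
From mathcomp Require Import all_boot all_order all_algebra.
From mathcomp Require Import all_classical all_reals all_analysis.
From mathcomp Require Import measurable_realfun ring lra.
Import Order.TTheory GRing.Theory Num.Theory.
Import numFieldNormedType.Exports.
Local Open Scope classical_set_scope.
Local Open Scope ring_scope.

Set Implicit Arguments.
Unset Strict Implicit.
Unset Printing Implicit Defensive.

(** There may be infinitely many branches, and at both ends of each branch image the transfer
    operator can create a jump; summability of these jumps is the first obstacle. Condition (F)
    gives the images a common minimal length, so by bounded distortion the weight of a branch is at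
    most a constant times its width, and the widths add up to at most 1. The threshold
    [2 * (3 + A) <= lam] collects what one branch costs in variation: two jumps, the variation of
    [f] and the distortion. A power of [T] reaches it, because the distortion constants of all
    powers are at most [A * lam / (lam - 1)]. Compactness of balls of bounded variation in L1
    appears in explicit form: sampling on [N] equal cells approximates all functions of a given
    variation at once, so that weak mixing is applied to finitely many sets only. Functions are
    honest functions on [X], not classes modulo null sets; the density satisfies [L h = h] at every
    point of [X], and inequalities can be carried along a single branch. Bernoulli's inequality
    turns the contraction of one power into a rate for all times. *)

Lemma lim_le {R : realType} (u : nat -> R) (l M : R) :
  u n @[n --> \oo] --> l -> (forall n, u n <= M) -> l <= M.
Proof.
move=> ul uM; rewrite -(cvg_lim _ ul)//.
by apply: limr_le; [apply: cvgP ul | apply: nearW].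
Qed.

Lemma lim_ge {R : realType} (u : nat -> R) (l M : R) :
  u n @[n --> \oo] --> l -> (forall n, M <= u n) -> M <= l.
Proof.
move=> ul uM; rewrite -(cvg_lim _ ul)//.
by apply: limr_ge; [apply: cvgP ul | apply: nearW].
Qed.

(** * Integrals of bounded measurable functions on the unit interval *)

Section BoundedMeasurable.
Context {R : realType}.
Local Notation m := (@lebesgue_measure R).
Local Notation X := (@X R).
Implicit Types (f g : R -> R) (A B : set R) (x y k : R).

Lemma inX x : X x <-> 0 <= x <= 1.
Proof. by rewrite /Defs.X /= in_itv. Qed.

Lemma measurable_X : measurable (X : set (measurableTypeR R)).
Proof. exact: measurable_itv. Qed.

Lemma lebesgueX : m X = 1%E.
Proof. by rewrite /Defs.X lebesgue_measure_itv /= lte01 oppr0 adde0. Qed.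

(** Boundedness makes such functions integrable over every measurable subset of [X], so that
    linearity and monotonicity of the integral apply without further conditions. *)
Definition bm f : Prop :=
  measurable_fun (X : set (measurableTypeR R)) f /\
  exists M : R, forall x, X x -> `|f x| <= M.

Lemma sub_lebesgue_lty B : measurable (B : set (measurableTypeR R)) ->
  B `<=` X -> (m B < +oo)%E.
Proof.
move=> mB BX; apply: (@le_lt_trans _ _ (m X)); last by rewrite lebesgueX ltry.
by apply: le_measure => //; rewrite inE //; exact: measurable_X.
Qed.

Lemma bm_integrable f B : bm f -> measurable (B : set (measurableTypeR R)) ->
  B `<=` X -> m.-integrable B (EFin \o f).
Proof.
move=> [mf [M fM]] mB BX; apply: measurable_bounded_integrable => //.
- exact: sub_lebesgue_lty.
- exact: (measurable_funS measurable_X BX mf).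
- exists M; split; first exact: num_real.
  by move=> y My x Bx; apply: le_trans (ltW My); apply: fM; exact: BX.
Qed.

Lemma bmD f g : bm f -> bm g -> bm (fun x => f x + g x).
Proof.
move=> [mf [M fM]] [mg [N gN]]; split; first exact: measurable_funD.
by exists (M + N) => x Xx; rewrite (le_trans (ler_normD _ _))// lerD// ?fM ?gN.
Qed.

Lemma bmM f g : bm f -> bm g -> bm (fun x => f x * g x).
Proof.
move=> [mf [M fM]] [mg [N gN]]; split; first exact: measurable_funM.
by exists (M * N) => x Xx; rewrite normrM ler_pM// ?fM ?gN.
Qed.

Lemma bm_cst k : bm (fun=> k).
Proof. by split; [exact: measurable_cst | exists `|k|]. Qed.

Lemma bmZ k f : bm f -> bm (fun x => k * f x).
Proof. by move=> bf; apply: bmM => //; exact: bm_cst. Qed.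

Lemma bmN f : bm f -> bm (fun x => - f x).
Proof.
move=> [mf [M fM]]; split; first exact: measurable_funN.
by exists M => x Xx; rewrite normrN fM.
Qed.

Lemma bmB f g : bm f -> bm g -> bm (fun x => f x - g x).
Proof. by move=> bf bg; apply: bmD => //; exact: bmN. Qed.

Lemma bm_norm f : bm f -> bm (fun x => `|f x|).
Proof.
move=> [mf [M fM]]; split; first exact: measurableT_comp.
by exists M => x Xx; rewrite normr_id fM.
Qed.

Lemma bm_indic B : measurable (B : set (measurableTypeR R)) -> bm (\1_B).
Proof.
move=> mB; split; first exact: measurable_indic.
by exists 1 => x _; rewrite indicE; case: (_ \in _); rewrite ?normr1 ?normr0.
Qed.

Lemma bm_eq f g : (forall x, X x -> f x = g x) -> bm f -> bm g.
Proof.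
move=> fg [mf [M fM]]; split.
  by apply: eq_measurable_fun mf => x /[1!inE] /fg.
by exists M => x Xx; rewrite -fg// fM.
Qed.

Lemma bm_sum n (f : nat -> R -> R) : (forall i, (i < n)%N -> bm (f i)) ->
  bm (fun x => \sum_(i < n) f i x).
Proof.
elim: n => [|n IH] bf.
  by apply: bm_eq (bm_cst 0) => x _; rewrite big_ord0.
apply: (@bm_eq (fun x => \sum_(i < n) f i x + f n x)).
  by move=> x _; rewrite big_ord_recr.
by apply: bmD; [apply: IH => i /ltnW; exact: bf | exact: bf].
Qed.

Lemma bm_limit (f : nat -> R -> R) g (M : R) :
  (forall n, bm (f n)) -> (forall n x, X x -> `|f n x| <= M) ->
  (forall x, X x -> f n x @[n --> \oo] --> g x) -> bm g.
Proof.
move=> bf fM fg; split.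
  apply: (@measurable_fun_cvg _ _ _ X f) => // n.
  - by case: (bf n).
exists M => x Xx.
by apply: (lim_le (cvg_norm (fg _ Xx))) => n; exact: fM.
Qed.

Lemma RintD f g B : bm f -> bm g -> measurable (B : set (measurableTypeR R)) ->
  B `<=` X ->
  \int[m]_(x in B) (f x + g x) = \int[m]_(x in B) f x + \int[m]_(x in B) g x.
Proof. by move=> bf bg mB BX; apply: RintegralD => //; exact: bm_integrable. Qed.

Lemma RintB f g B : bm f -> bm g -> measurable (B : set (measurableTypeR R)) ->
  B `<=` X ->
  \int[m]_(x in B) (f x - g x) = \int[m]_(x in B) f x - \int[m]_(x in B) g x.
Proof. by move=> bf bg mB BX; apply: RintegralB => //; exact: bm_integrable. Qed.

Lemma RintZ k f B : bm f -> measurable (B : set (measurableTypeR R)) ->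
  B `<=` X -> \int[m]_(x in B) (k * f x) = k * \int[m]_(x in B) f x.
Proof. by move=> bf mB BX; apply: RintegralZl => //; exact: bm_integrable. Qed.

Lemma Rint_le f g B : bm f -> bm g -> measurable (B : set (measurableTypeR R)) ->
  B `<=` X -> (forall x, B x -> f x <= g x) ->
  \int[m]_(x in B) f x <= \int[m]_(x in B) g x.
Proof. by move=> bf bg mB BX fg; apply: le_Rintegral => //; exact: bm_integrable. Qed.

Lemma Rint_abs f B : bm f -> measurable (B : set (measurableTypeR R)) ->
  B `<=` X -> `|\int[m]_(x in B) f x| <= \int[m]_(x in B) `|f x|.
Proof. by move=> bf mB BX; apply: le_normr_Rintegral => //; exact: bm_integrable. Qed.

Lemma Rint_indic f A B :
  \int[m]_(x in B) (\1_A x * f x) = \int[m]_(x in B `&` A) f x.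
Proof.
rewrite Rintegral_mkcondr; apply: eq_Rintegral => x _.
by rewrite patchE indicE; case: ifPn => _; rewrite ?mul1r ?mul0r.
Qed.

Lemma Rint_sum n (f : nat -> R -> R) B : (forall i, (i < n)%N -> bm (f i)) ->
  measurable (B : set (measurableTypeR R)) -> B `<=` X ->
  \int[m]_(x in B) (\sum_(i < n) f i x) = \sum_(i < n) \int[m]_(x in B) f i x.
Proof.
move=> + mB BX; elim: n => [|n IH] bf.
  rewrite big_ord0; under eq_Rintegral do rewrite big_ord0.
  by rewrite Rintegral_cst// mul0r.
rewrite big_ord_recr /= -IH; last by move=> i /ltnW; exact: bf.
rewrite -RintD //; last 2 first.
- by apply: bm_sum => i /ltnW; exact: bf.
- exact: bf.
by apply: eq_Rintegral => x _; rewrite big_ord_recr.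
Qed.

Lemma Rint_subset f A B : bm f -> (forall x, X x -> 0 <= f x) ->
  measurable (A : set (measurableTypeR R)) ->
  measurable (B : set (measurableTypeR R)) -> A `<=` B -> B `<=` X ->
  \int[m]_(x in A) f x <= \int[m]_(x in B) f x.
Proof.
move=> bf f0 mA mB AB BX.
have -> : A = B `&` A by rewrite setIidr.
rewrite -Rint_indic; apply: Rint_le => //.
  by apply: bmM => //; exact: bm_indic.
move=> x Bx; rewrite indicE; case: (_ \in _); rewrite ?mul1r// mul0r f0//.
exact: BX.
Qed.

Lemma Rint_dist f g B : bm f -> bm g -> measurable (B : set (measurableTypeR R)) ->
  B `<=` X -> `|\int[m]_(x in B) f x - \int[m]_(x in B) g x| <=
  \int[m]_(x in X) `|f x - g x|.
Proof.
move=> bf bg mB BX; rewrite -RintB//.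
have bfg := bmB bf bg.
apply: le_trans (Rint_abs bfg mB BX) _.
by apply: Rint_subset => //; [exact: bm_norm | exact: measurable_X].
Qed.

Lemma Rint_split f A : bm f -> measurable (A : set (measurableTypeR R)) ->
  \int[m]_(x in X) f x = \int[m]_(x in X `&` A) f x + \int[m]_(x in X `&` ~` A) f x.
Proof.
move=> bf mA; rewrite -!Rint_indic -RintD//; last 3 first.
- by apply: bmM => //; exact: bm_indic.
- by apply: bmM => //; apply: bm_indic; exact: measurableC.
- exact: measurable_X.
apply: eq_Rintegral => x _; rewrite -mulrDl !indicE in_setC.
by case: (x \in A); rewrite ?addr0 ?add0r mul1r.
Qed.

(** [X] is cut into the part where [f] is nonnegative and the part where it is negative; on each of
    them the integral of the modulus is plus or minus that of [f], hence at most [e]. This converts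
    closeness of integrals over sets into closeness in L1. *)
Lemma L1_le_of_sets f (e : R) : bm f ->
  (forall B, measurable (B : set (measurableTypeR R)) -> B `<=` X ->
    `|\int[m]_(x in B) f x| <= e) ->
  \int[m]_(x in X) `|f x| <= 2 * e.
Proof.
move=> bf fe.
pose A : set (measurableTypeR R) := X `&` [set x | 0 <= f x].
have mA : measurable A.
  have -> : A = X `&` f @^-1` `[0, +oo[ .
    by apply/seteqP; split => x [Xx]; rewrite /= ?in_itv/= ?andbT => h; split => //=; 
       rewrite ?in_itv/= ?andbT.
  by case: bf => + _; apply; [exact: measurable_X | exact: measurable_itv].
have mX := @measurable_X.
rewrite (Rint_split (bm_norm bf) mA) mulr2n mulrDl mul1r.
have -> : X `&` A = A by rewrite setIidr// => x [].
apply: lerD.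
  have -> : \int[m]_(x in A) `|f x| = \int[m]_(x in A) f x.
    by apply: eq_Rintegral => x /[1!inE] -[_ /= h]; rewrite ger0_norm.
  by apply: le_trans (ler_norm _) (fe _ mA _) => x [].
have mB : measurable (X `&` ~` A : set (measurableTypeR R)).
  by apply: measurableI => //; exact: measurableC.
have -> : \int[m]_(x in X `&` ~` A) `|f x| = \int[m]_(x in X `&` ~` A) (-1 * f x).
  apply: eq_Rintegral => x /[1!inE] -[Xx /= h]; rewrite mulN1r ler0_norm//.
  by rewrite leNgt; apply/negP => f0; apply: h; split => //=; exact: ltW.
rewrite RintZ//.
rewrite mulN1r; apply: le_trans (ler_norm _) _; rewrite normrN; apply: fe => //.
Qed.

Lemma Rint_cst k : \int[m]_(x in X) k = k.
Proof.
transitivity (k * fine (m X)); last by rewrite lebesgueX mulr1.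
by apply: Rintegral_cst; exact: measurable_X.
Qed.

End BoundedMeasurable.

(** * Functions of bounded variation *)

Section Variation.
Context {R : realType}.
Local Notation m := (@lebesgue_measure R).
Local Notation X := (@X R).
Implicit Types (f g V : R -> R) (M N A B x y k : R).

(* Bounded variation without partitions: the increments of f are dominated by
   those of V, which may be thought of as the variation function of f. *)
Definition dominates V f : Prop := forall x y, 0 <= x -> x <= y -> y <= 1 ->
  `|f y - f x| <= V y - V x.

Definition var f M : Prop := exists2 V, dominates V f & V 1 - V 0 <= M.

Lemma dominates_le V f x y : dominates V f -> 0 <= x -> x <= y -> y <= 1 ->
  V x <= V y.
Proof. by move=> d x0 xy y1; rewrite -subr_ge0 (le_trans _ (d x y _ _ _)). Qed.

Lemma var_dist f M x y : var f M -> X x -> X y -> `|f x - f y| <= M.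
Proof.
move=> [V d VM] /inX/andP[x0 x1] /inX/andP[y0 y1].
wlog xy : x y x0 x1 y0 y1 / x <= y => [h|].
  have [xy|/ltW yx] := leP x y; first exact: h.
  by rewrite distrC; exact: h.
rewrite distrC; apply: le_trans (d _ _ x0 xy y1) (le_trans _ VM).
by apply: lerB; [apply: dominates_le d _ _ _ | apply: dominates_le d _ _ _].
Qed.

Lemma var_ge0 f M : var f M -> 0 <= M.
Proof.
move=> vf; have X0 : X 0 by apply/inX; rewrite lexx ler01.
by rewrite (le_trans _ (var_dist vf X0 X0)).
Qed.

Lemma var_weak f M N : M <= N -> var f M -> var f N.
Proof. by move=> MN [V d VM]; exists V => //; exact: le_trans MN. Qed.

Lemma var_eq f g M : (forall x, X x -> f x = g x) -> var f M -> var g M.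
Proof.
move=> fg [V d VM]; exists V => // x y x0 xy y1.
rewrite -!fg ?d//; apply/inX; rewrite ?x0 ?y1 ?(le_trans x0 xy)//.
by rewrite (le_trans xy y1).
Qed.

Lemma var_cst k : var (fun=> k) 0.
Proof. by exists (fun=> 0) => [x y _ _ _|]; rewrite !subrr ?normr0. Qed.

Lemma varD f g M N : var f M -> var g N -> var (fun x => f x + g x) (M + N).
Proof.
move=> [V d VM] [W e WN]; exists (fun x => V x + W x); last by lra.
move=> x y x0 xy y1; have := d _ _ x0 xy y1; have := e _ _ x0 xy y1.
have := ler_normD (f y - f x) (g y - g x).
rewrite (_ : f y - f x + (g y - g x) = f y + g y - (f x + g x)); last by ring.
by lra.
Qed.

Lemma varZ k f M : var f M -> var (fun x => k * f x) (`|k| * M).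
Proof.
move=> [V d VM]; exists (fun x => `|k| * V x); last first.
  by rewrite -mulrBr ler_wpM2l.
by move=> x y x0 xy y1; rewrite -!mulrBr normrM ler_wpM2l// d.
Qed.

Lemma varB f g M N : var f M -> var g N -> var (fun x => f x - g x) (M + N).
Proof.
move=> vf /(varZ (-1)); rewrite normrN1 mul1r => vg.
by apply: var_eq (varD vf vg) => x _; rewrite mulN1r.
Qed.

Lemma varM f g M N A B : var f M -> var g N ->
  (forall x, X x -> `|f x| <= A) -> (forall x, X x -> `|g x| <= B) ->
  var (fun x => f x * g x) (A * N + B * M).
Proof.
move=> [V d VM] [W e WN] fA gB.
have X0 : X 0 by apply/inX; rewrite lexx ler01.
have A0 : 0 <= A by rewrite (le_trans _ (fA _ X0)).
have B0 : 0 <= B by rewrite (le_trans _ (gB _ X0)).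
exists (fun x => A * W x + B * V x); last first.
  rewrite (_ : _ - _ = A * (W 1 - W 0) + B * (V 1 - V 0)); last by ring.
  by rewrite lerD// ler_wpM2l.
move=> x y x0 xy y1.
have Xx : X x by apply/inX; rewrite x0 (le_trans xy).
have Xy : X y by apply/inX; rewrite (le_trans x0).
rewrite (_ : f y * _ - _ = f y * (g y - g x) + (f y - f x) * g x); last by ring.
rewrite (le_trans (ler_normD _ _))// !normrM.
rewrite (_ : A * W y + _ - _ = A * (W y - W x) + (V y - V x) * B); last by ring.
by rewrite lerD// ler_pM// ?fA ?gB ?d ?e.
Qed.

(* The dominating function is clamped outside of [0, 1] to become monotone on R. *)
Lemma var_measurable f M : var f M -> measurable_fun (X : set (measurableTypeR R)) f.
Proof.
move=> [V d _].
pose k x : R := Num.max 0 (Num.min x 1).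
have k0 x : 0 <= k x by rewrite /k le_max lexx.
have k1 x : k x <= 1 by rewrite /k ge_max ler01 ge_min lexx orbT.
have kle x y : x <= y -> k x <= k y.
  move=> xy; rewrite /k; case: (leP x 1) => hx; case: (leP y 1) => hy;
    rewrite ?ge_max ?le_max ?lexx ?ler01 ?orbT ?hx ?xy ?orbT//=.
  by rewrite (le_trans (ltW hx) xy) orbT.
have kX x : X x -> k x = x.
  by move=> /inX/andP[x0 x1]; rewrite /k (min_idPl x1) (max_idPr x0).
have mV : measurable_fun (X : set (measurableTypeR R)) (V \o k).
  apply: nondecreasing_measurable; first exact: measurable_X.
  by move=> x y xy /=; apply: (dominates_le d) => //; exact: kle.
have mW : measurable_fun (X : set (measurableTypeR R)) (fun x => f (k x) + V (k x)).
  apply: nondecreasing_measurable; first exact: measurable_X.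
  move=> x y xy /=; have := d _ _ (k0 x) (kle _ _ xy) (k1 y).
  by rewrite ler_norml => /andP[]; lra.
apply: eq_measurable_fun (measurable_funB mW mV) => x /[1!inE] Xx /=.
by rewrite kX// addrK.
Qed.

Lemma var_bm f M : var f M -> bm f.
Proof.
move=> vf; split; first exact: var_measurable vf.
exists (`|f 0| + M) => x Xx.
have X0 : X 0 by apply/inX; rewrite lexx ler01.
have := var_dist vf Xx X0; have := ler_normD (f x - f 0) (f 0).
by rewrite subrK; lra.
Qed.

(** The inequality [|f x| <= M + |f y|] is averaged over [y], as [X] has measure 1. *)
Lemma var_le_norm_int f M x : var f M -> X x ->
  `|f x| <= M + \int[m]_(y in X) `|f y|.
Proof.
move=> vf Xx; rewrite -lerBlDl -[leLHS](Rint_cst).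
have bf := var_bm vf.
apply: Rint_le => //.
- exact: bm_cst.
- exact: bm_norm.
- exact: measurable_X.
move=> y Xy; have := var_dist vf Xx Xy.
have := ler_normD (f x - f y) (f y).
by rewrite subrK; lra.
Qed.

(** Every value of [f] is within [M] of the mean of [f]. *)
Lemma var_mean0 f M x : var f M -> \int[m]_(y in X) f y = 0 -> X x ->
  `|f x| <= M.
Proof.
move=> vf f0 Xx; have bf := var_bm vf.
have mX := @measurable_X R.
rewrite ler_norml; apply/andP; split.
- suff : \int[m]_(y in X) f y <= \int[m]_(y in X) (f x + M).
    by rewrite f0 Rint_cst; lra.
  apply: Rint_le => //; first exact: bm_cst.
  by move=> y Xy; have := var_dist vf Xx Xy; rewrite ler_norml; lra.
- suff : \int[m]_(y in X) (f x - M) <= \int[m]_(y in X) f y.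
    by rewrite f0 Rint_cst; lra.
  apply: Rint_le => //; first exact: bm_cst.
  by move=> y Xy; have := var_dist vf Xx Xy; rewrite ler_norml; lra.
Qed.

(** The sum of the functions [V i], each normalised to vanish at 0, dominates [f]; its partial sums
    increase and stay below [N]. *)
Lemma var_series (F : nat -> R -> R) (M : nat -> R) f N :
  (forall i, var (F i) (M i)) -> (forall n, \sum_(i < n) M i <= N) ->
  (forall x, X x -> \sum_(i < n) F i x @[n --> \oo] --> f x) -> var f N.
Proof.
move=> /(_ _)/cid2-/all_sig2[V dV VM] MN Ff.
pose S n x := \sum_(i < n) (V i x - V i 0).
have SN n x : X x -> S n x <= N.
  move=> /inX/andP[x0 x1]; apply: le_trans (MN n); apply: ler_sum => i _.
  apply: le_trans (VM i); rewrite lerD2r.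
  exact: dominates_le (dV i) x0 x1 _.
have Snd x : X x -> nondecreasing_seq (S^~ x).
  move=> /inX/andP[x0 x1]; apply/nondecreasing_seqP => n.
  rewrite /S big_ord_recr /= lerDl subr_ge0.
  exact: dominates_le (dV n) _ x0 x1.
have Scvg x : X x -> cvg (S n x @[n --> \oo]).
  move=> Xx; apply: nondecreasing_is_cvgn; first exact: Snd.
  by exists N => _ [n _ <-]; exact: SN.
exists (fun x => limn (S^~ x)).
  move=> x y x0 xy y1.
  have Xx : X x by apply/inX; rewrite x0 (le_trans xy).
  have Xy : X y by apply/inX; rewrite (le_trans x0).
  have h : ((S n y - S n x) - `|\sum_(i < n) F i y - \sum_(i < n) F i x|) @[n --> \oo] -->
      ((limn (S^~ y) - limn (S^~ x)) - `|f y - f x|).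
    apply: cvgB; first by apply: cvgB; exact: Scvg.
    by apply: cvg_norm; apply: cvgB; exact: Ff.
  rewrite -subr_ge0; apply: (lim_ge h) => n /=.
  rewrite subr_ge0 /S -!sumrB; apply: le_trans (ler_norm_sum _ _ _) _.
  apply: ler_sum => i _; apply: le_trans (dV i x y x0 xy y1) _; lra.
have X1 : X 1 by apply/inX; rewrite lexx ler01.
have -> : limn (S^~ 0) = 0.
  rewrite (_ : S^~ 0 = cst 0) ?lim_cst//; apply/funext => n; rewrite /S.
  by rewrite big1// => i _; rewrite subrr.
rewrite subr0; apply: lim_le (Scvg _ X1) _ => n; exact: SN.
Qed.

Lemma var_inv f M k : 0 < k -> (forall x, X x -> k <= f x) -> var f M ->
  var (fun x => (f x)^-1) (M / k ^+ 2).
Proof.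
move=> k0 kf [V d VM]; exists (fun x => V x / k ^+ 2); last first.
  by rewrite -mulrBl ler_wpM2r// invr_ge0 exprn_ge0// ltW.
move=> x y x0 xy y1.
have Xx : X x by apply/inX; rewrite x0 (le_trans xy).
have Xy : X y by apply/inX; rewrite (le_trans x0).
have fx := kf _ Xx; have fy := kf _ Xy.
have fx0 : 0 < f x by apply: lt_le_trans fx.
have fy0 : 0 < f y by apply: lt_le_trans fy.
rewrite (_ : _ - _ = (f x - f y) / (f x * f y)); last by field; rewrite !gt_eqF.
rewrite -mulrBl normrM ler_pM// ?d// 1?distrC ?d//.
rewrite ger0_norm; last by rewrite invr_ge0 mulr_ge0// ltW.
rewrite lef_pV2 ?posrE ?exprn_gt0 ?mulr_gt0// expr2.
by rewrite ler_pM// ltW.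
Qed.

Lemma var_max f M k : var f M -> var (fun x => Num.max (f x) k) M.
Proof.
move=> [V d VM]; exists V => // x y x0 xy y1; apply: le_trans (d _ _ x0 xy y1).
have a := ler_norm (f y - f x); have b := ler_norm (f x - f y).
rewrite distrC in b; rewrite ler_norml.
by case: (leP (f x) k) => h1; case: (leP (f y) k) => h2; apply/andP; split; lra.
Qed.

(** The index of [x] in the division of [X] into [N] equal cells, closed on the left. The point 1
    has the index [N] and a cell of its own, which is why sums over the cells have [N.+1] terms. *)
Definition cell (N : nat) (x : R) : nat := Num.truncn (N%:R * x).

Lemma cell_itv (N : nat) x : X x -> (cell N x)%:R <= N%:R * x < (cell N x).+1%:R.
Proof. by move=> /inX/andP[x0 _]; apply: truncn_itv; rewrite mulr_ge0. Qed.

Lemma cell_mono (N : nat) x y : x <= y -> (cell N x <= cell N y)%N.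
Proof. by move=> xy; apply: le_truncn; rewrite ler_wpM2l. Qed.

Lemma cell_le (N : nat) x : X x -> (cell N x <= N)%N.
Proof.
move=> Xx; have /andP[h _] := cell_itv N Xx.
rewrite -(ler_nat R) (le_trans h)// -[leRHS]mulr1 ler_wpM2l//.
by move/inX : Xx => /andP[].
Qed.

(** The cell index times [2 * B] is a dominating function: the value changes only together with the
    index, and then by at most [2 * B]. *)
Lemma var_cell (N : nat) (g : nat -> R) B : (forall n, (n <= N)%N -> `|g n| <= B) ->
  var (fun x => g (cell N x)) (2 * B * N%:R).
Proof.
move=> gB; have B0 : 0 <= B by rewrite (le_trans _ (gB 0 _)).
have X0 : X 0 by apply/inX; rewrite lexx ler01.
have X1 : X 1 by apply/inX; rewrite lexx ler01.
exists (fun x => 2 * B * (cell N x)%:R).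
  move=> x y x0 xy y1; rewrite -mulrBr.
  have Xx : X x by apply/inX; rewrite x0 (le_trans xy).
  have Xy : X y by apply/inX; rewrite (le_trans x0).
  have [->|ne] := eqVneq (cell N x) (cell N y); first by rewrite !subrr normr0 mulr0.
  have lt : (cell N x < cell N y)%N by rewrite ltn_neqAle ne cell_mono.
  apply: (@le_trans _ _ (2 * B)).
    rewrite (le_trans (ler_normB _ _))// mulr2n mulrDl mul1r lerD//.
      by apply: gB; exact: cell_le.
    by apply: gB; exact: cell_le.
  rewrite ler_peMr ?mulr_ge0// -natrB 1?ltnW// ler1n subn_gt0//.
rewrite -mulrBr ler_wpM2l ?mulr_ge0//.
rewrite (le_trans (_ : _ <= (cell N 1)%:R))// ?lerBlDr ?lerDl//.
by rewrite ler_nat cell_le.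
Qed.

Definition cellfun (N j : nat) (x : R) : R := (cell N x == j)%:R.

Lemma cellfun_var (N j : nat) : var (cellfun N j) (2 * N%:R).
Proof.
rewrite -[2 in X in var _ X]mulr1.
apply: (@var_cell N (fun n => (n == j)%:R)) => n _.
by rewrite ger0_norm ?ler0n// lern1 leq_b1.
Qed.

Lemma cellfun_bm (N j : nat) : bm (cellfun N j).
Proof. exact: var_bm (cellfun_var N j). Qed.

Lemma cellfun_ge0 (N j : nat) x : 0 <= cellfun N j x.
Proof. exact: ler0n. Qed.

Lemma cell_sum (N : nat) (g : nat -> R) (x : R) : X x ->
  \sum_(j < N.+1) g j * cellfun N j x = g (cell N x).
Proof.
move=> Xx; have lt : (cell N x < N.+1)%N by rewrite ltnS cell_le.
rewrite (bigD1 (Ordinal lt))//= /cellfun eqxx mulr1 big1 ?addr0// => j.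
by rewrite -val_eqE /= eq_sym => /negPf ->; rewrite mulr0.
Qed.

Lemma cellfun_int (N j : nat) : (j < N)%N -> \int[m]_(x in X) cellfun N j x <= N%:R^-1.
Proof.
move=> jN; have N0 : 0 < N%:R :> R by rewrite ltr0n (leq_ltn_trans _ jN).
pose I : set (measurableTypeR R) := [set` `[(j%:R / N%:R : R), j.+1%:R / N%:R]].
have IX : I `<=` X.
  move=> x; rewrite /I /= in_itv/= => /andP[h1 h2]; apply/inX; apply/andP; split.
    by apply: le_trans h1; rewrite divr_ge0.
  by apply: le_trans h2 _; rewrite ler_pdivrMr// mul1r ler_nat.
apply: (@le_trans _ _ (\int[m]_(x in X) (\1_I x * 1))).
  apply: Rint_le => //.
  - exact: cellfun_bm.
  - by apply: bmM; [apply: bm_indic; exact: measurable_itv | exact: bm_cst].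
  - exact: measurable_X.
  move=> x Xx; rewrite /cellfun mulr1 indicE; have [/eqP e|//] := boolP (_ == _).
  have /andP[h1 h2] := cell_itv N Xx; rewrite e in h1 h2.
  suff -> : x \in I by [].
  by rewrite inE /I /= in_itv/= ler_pdivrMr// ler_pdivlMr// mulrC h1/= ltW.
rewrite Rint_indic setIidr//.
rewrite (_ : Rintegral _ _ _ = 1 * fine (m I)); last first.
  by apply: Rintegral_cst; exact: measurable_itv.
rewrite mul1r lebesgue_measure_itv /= lte_fin ltr_pM2r ?invr_gt0// ltr_nat ltnSn/=.
by rewrite -mulrBl -natrB// subSnn mul1r.
Qed.

(** On cell [j] the distance is at most the increment of [V] over that cell; the cell has measure at
    most [1 / N], and the increments telescope to at most [M]. *)
Lemma var_cell_approx f M (N : nat) : (0 < N)%N -> var f M ->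
  \int[m]_(x in X) `|f x - f ((cell N x)%:R / N%:R)| <= M / N%:R.
Proof.
move=> N0 vf; have [V d VM] := vf.
have N0R : 0 < N%:R :> R by rewrite ltr0n.
pose p j : R := j%:R / N%:R.
have p0 j : 0 <= p j by rewrite divr_ge0.
have p1 j : (j <= N)%N -> p j <= 1 by move=> jN; rewrite ler_pdivrMr// mul1r ler_nat.
have pS j : p j <= p j.+1 by rewrite ler_pM2r ?invr_gt0// ler_nat.
have bf := var_bm vf; have mX := @measurable_X R.
have bfN : bm (fun x => f (p (cell N x))).
  apply: bm_eq (bm_sum (n := N.+1) (f := fun j x => f (p j) * cellfun N j x) _).
    by move=> x Xx; have := cell_sum N (fun j => f (p j)) Xx.
  by move=> i _; apply: bmZ; exact: cellfun_bm.
pose G j x := (V (p j.+1) - V (p j)) * cellfun N j x.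
have bG j : bm (G j) by apply: bmZ; exact: cellfun_bm.
apply: (@le_trans _ _ (\int[m]_(x in X) \sum_(j < N) G j x)).
  apply: Rint_le => //.
  - by apply: bm_norm; apply: bmB.
  - exact: bm_sum.
  move=> x Xx; have /andP[h1 h2] := cell_itv N Xx.
  have G0 j : (j < N)%N -> 0 <= G j x.
    move=> jN; rewrite mulr_ge0 ?cellfun_ge0// subr_ge0.
    exact: (dominates_le d (p0 _) (pS _) (p1 _ jN)).
  have /andP[x0 x1] : 0 <= x <= 1 by apply/inX.
  have := cell_le N Xx; rewrite leq_eqVlt => /predU1P[e|lt].
    (* The last cell contains only the point 1, which is its own sample. *)
    have xe : x = 1.
      by apply/eqP; rewrite eq_le x1 -(ler_pM2l N0R) mulr1 -{1}e.
    rewrite e xe divff ?gt_eqF// subrr normr0; apply: sumr_ge0 => j _.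
    by rewrite -xe G0.
  rewrite (bigD1 (Ordinal lt))//= {1}/G /cellfun eqxx mulr1.
  apply: ler_wpDr; first by apply: sumr_ge0 => j _; exact: G0.
  have px : p (cell N x) <= x by rewrite ler_pdivrMr// mulrC.
  have xp : x <= p (cell N x).+1 by rewrite ler_pdivlMr// mulrC ltW.
  apply: le_trans (d _ _ (p0 _) px x1) _; rewrite lerB//.
  exact: (dominates_le d x0 xp (p1 _ lt)).
rewrite Rint_sum//.
apply: (@le_trans _ _ (\sum_(j < N) (V (p j.+1) - V (p j)) / N%:R)).
  apply: ler_sum => -[j jN] _ /=; rewrite RintZ//; last exact: cellfun_bm.
  rewrite ler_wpM2l ?cellfun_int// subr_ge0.
  exact: (dominates_le d (p0 _) (pS _) (p1 _ jN)).
rewrite -mulr_suml ler_wpM2r ?invr_ge0// (le_trans _ VM)//.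
rewrite -(big_mkord xpredT (fun j => V (p j.+1) - V (p j))) telescope_sumr//.
by rewrite /p divff ?gt_eqF// mul0r.
Qed.

(** Induction on the number of intervals: the first one of the list separates the others into those
    that end to its left and those that start to its right, and the induction hypothesis applies
    between [p] and [u i] and between [v i] and [q]. *)
Lemma sum_increments V (u v : nat -> R) (s : seq nat) (p q : R) :
  uniq s -> 0 <= p -> p <= q -> q <= 1 ->
  (forall x y, 0 <= x -> x <= y -> y <= 1 -> V x <= V y) ->
  (forall i, i \in s -> [/\ p <= u i, u i < v i & v i <= q]) ->
  (forall i j, i \in s -> j \in s -> i != j -> v i <= u j \/ v j <= u i) ->
  \sum_(i <- s) (V (v i) - V (u i)) <= V q - V p.
Proof.
move=> us p0 pq q1 Vm; have [n] := ubnP (size s).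
elim: n s p q us p0 pq q1 => // n IH [|i s] p q us p0 pq q1.
  by move=> _ _ _; rewrite big_nil subr_ge0 Vm.
rewrite ltnS => sn hs hd.
rewrite big_cons (bigID (fun j => v j <= u i)) /= -big_filter -[X in _ + (_ + X)]big_filter.
have [pu uv vq] := hs i (mem_head _ _).
move: us => /= /andP[ins us].
have hL : \sum_(j <- [seq j <- s | v j <= u i]) (V (v j) - V (u j)) <= V (u i) - V p.
  apply: IH => //.
  - exact: filter_uniq.
  - by rewrite (le_trans (ltW uv))// (le_trans vq).
  - by rewrite (leq_trans _ sn)// ltnS size_filter count_size.
  - move=> j; rewrite mem_filter => /andP[h js].
    by have [] := hs j _; rewrite ?in_cons ?js ?orbT.
  - move=> j k; rewrite !mem_filter => /andP[_ js] /andP[_ ks]; apply: hd;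
    by rewrite in_cons ?js ?ks orbT.
have hR : \sum_(j <- [seq j <- s | ~~ (v j <= u i)]) (V (v j) - V (u j)) <= V q - V (v i).
  apply: IH => //.
  - exact: filter_uniq.
  - by rewrite (le_trans p0)// (le_trans pu)// ltW.
  - by rewrite (leq_trans _ sn)// ltnS size_filter count_size.
  - move=> j; rewrite mem_filter => /andP[h js].
    have jm : j \in i :: s by rewrite in_cons js orbT.
    have [h1 h2 h3] := hs j jm; split => //.
    have ij : i != j by apply: contraNneq ins => ->.
    by case: (hd i j (mem_head _ _) jm ij) => // h'; rewrite h' in h.
  - move=> j k; rewrite !mem_filter => /andP[_ js] /andP[_ ks]; apply: hd;
    by rewrite in_cons ?js ?ks orbT.
by lra.
Qed.

(** Degenerate intervals contribute nothing, and two overlapping nondegenerate ones would share the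
    midpoint of their intersection. *)
Lemma sum_increments_disjoint V (u v : nat -> R) n :
  (forall x y, 0 <= x -> x <= y -> y <= 1 -> V x <= V y) ->
  (forall i, [/\ 0 <= u i, u i <= v i & v i <= 1]) ->
  (forall i j (x : R), u i < x < v i -> u j < x < v j -> i = j) ->
  \sum_(i < n) (V (v i) - V (u i)) <= V 1 - V 0.
Proof.
move=> Vm uv uvd.
rewrite -(big_mkord xpredT (fun i => V (v i) - V (u i))).
rewrite (bigID (fun i => u i < v i)) /= [X in _ + X]big1 ?addr0; last first.
  move=> i; rewrite -leNgt => h; have [_ h2 _] := uv i.
  by rewrite (@le_anti _ _ (v i) (u i)) ?subrr// h.
rewrite -big_filter; apply: sum_increments => //.
- by rewrite filter_uniq// iota_uniq.
- by move=> i; rewrite mem_filter => /andP[h _]; have [] := uv i.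
move=> i j; rewrite !mem_filter => /andP[ui _] /andP[uj _] ij.
case: (leP (v i) (u j)) => h1; first by left.
case: (leP (v j) (u i)) => h2; first by right.
case/eqP: ij.
have [mx1 mx2] : u i <= Num.max (u i) (u j) /\ u j <= Num.max (u i) (u j).
  by rewrite !le_max !lexx orbT.
have [mn1 mn2] : Num.min (v i) (v j) <= v i /\ Num.min (v i) (v j) <= v j.
  by rewrite !ge_min !lexx orbT.
have mm : Num.max (u i) (u j) < Num.min (v i) (v j).
  by rewrite gt_max !lt_min ui uj h1 h2.
by apply: (uvd i j ((Num.max (u i) (u j) + Num.min (v i) (v j)) / 2));
  apply/andP; split; lra.
Qed.

(** The dominating function rises by at least [M] at [c] and at [d], which pays for the two jumps of
    [f], and follows [psi] in between. *)
Lemma var_bump f M (psi : R -> R) c d N :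
  (forall x, ~~ (c < x < d) -> f x = 0) ->
  (forall x, c < x < d -> `|f x| <= M) ->
  (forall x, c < x < d -> 0 <= psi x <= N) ->
  (forall x y, c < x -> x <= y -> y < d -> `|f y - f x| <= psi y - psi x) ->
  0 <= M -> 0 <= N -> var f (2 * M + N).
Proof.
move=> f0 fM psiN fpsi M0 N0.
exists (fun y => if y <= c then 0 else if y < d then M + psi y else 2 * M + N); last first.
  have : forall y, 0 <= (if y <= c then 0 else if y < d then M + psi y else 2 * M + N) <= 2 * M + N.
    move=> y; case: (leP y c) => yc; first by apply/andP; split; lra.
    case: (ltP y d) => yd; last by apply/andP; split; lra.
    by have /andP[p1 p2] : 0 <= psi y <= N by [apply: psiN; rewrite yc]; apply/andP; split; lra.
  by move=> h; have /andP[_ h1] := h 1; have /andP[h2 _] := h 0; lra.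
move=> x y _ xy _.
have out z : z <= c \/ d <= z -> f z = 0.
  by move=> h; apply: f0; apply/negP => /andP[z1 z2]; case: h => h; lra.
case: (leP y c) => yc.
  by rewrite (_ : x <= c) ?(le_trans xy)// !out ?subrr ?normr0//; left=> //; rewrite (le_trans xy).
case: (ltP y d) => yd.
  have [h1] : 0 <= psi y <= N /\ `|f y| <= M by split; [apply: psiN|apply: fM]; rewrite yc yd.
  move/andP: h1 => [p0 _] fy.
  case: (leP x c) => xc; first by rewrite (out x) ?subr0; [lra | left].
  by rewrite (le_lt_trans xy yd); have := fpsi x y xc xy yd; lra.
rewrite (out y); last by right.
rewrite sub0r normrN.
case: (leP x c) => xc; first by rewrite out ?normr0; [lra | left].
case: (ltP x d) => xd; last by rewrite out ?normr0 ?subrr//; right.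
have /andP[p0 p1] : 0 <= psi x <= N by apply: psiN; rewrite xc xd.
have : `|f x| <= M by apply: fM; rewrite xc xd.
by lra.
Qed.

End Variation.

(** * Expanding maps and their transfer operators *)

(* The i-th branch maps ]u i, v i[ onto ]c i, d i[ with inverse w i and
   G i = 1 / |S'| \o w i; unused indices have u i = v i.  The bound elamA makes
   the Lasota-Yorke inequality contract the variation by 1/2. *)
Record expanding (R : realType) := Expanding {
  eS : R -> R ;
  eu : nat -> R ; ev : nat -> R ; ec : nat -> R ; ed : nat -> R ;
  ew : nat -> R -> R ; eG : nat -> R -> R ;
  elam : R ; eA : R ; eK : R ;
  eS_X : forall x, X x -> X (eS x) ;
  eS_meas : measurable_fun (X : set (measurableTypeR R))
    (eS : measurableTypeR R -> measurableTypeR R) ;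
  euv : forall i, [/\ 0 <= eu i, eu i <= ev i & ev i <= 1] ;
  edisj : forall i j x, eu i < x < ev i -> eu j < x < ev j -> i = j ;
  ecover : (@lebesgue_measure R) (X `\` [set x | exists i, eu i < x < ev i]) = 0%E ;
  ecd : forall i, [/\ 0 <= ec i, ec i <= ed i & ed i <= 1] ;
  ew_in : forall i y, ec i < y < ed i -> eu i < ew i y < ev i ;
  eSw : forall i y, ec i < y < ed i -> eS (ew i y) = y ;
  eS_in : forall i x, eu i < x < ev i -> ec i < eS x < ed i ;
  ewS : forall i x, eu i < x < ev i -> ew i (eS x) = x ;
  emono : forall i,
    (forall y z, ec i < y -> y < z -> z < ed i -> ew i y < ew i z) \/
    (forall y z, ec i < y -> y < z -> z < ed i -> ew i z < ew i y) ;
  eG0 : forall i y, ~~ (ec i < y < ed i) -> eG i y = 0 ;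
  eG_gt0 : forall i y, ec i < y < ed i -> 0 < eG i y ;
  eG_le : forall i y, ec i < y < ed i -> eG i y <= elam^-1 ;
  eG_dist : forall i y z, ec i < y < ed i -> ec i < z < ed i ->
    `|eG i y - eG i z| <= eA * `|ew i y - ew i z| ;
  ew_contr : forall i y z, ec i < y < ed i -> ec i < z < ed i ->
    `|ew i y - ew i z| <= elam^-1 * `|y - z| ;
  eG_low : forall i, exists2 k, 0 < k & forall y, ec i < y < ed i -> k <= eG i y ;
  eG_sup : forall i y, ec i < y < ed i -> eG i y <= eK * (ev i - eu i) ;
  eends : exists E : seq R, forall i, ec i \in E /\ ed i \in E ;
  eA0 : 0 <= eA ; eK0 : 0 <= eK ; elamA : 2 * (3 + eA) <= elam ;
  eCV_bm : forall i f, bm f -> bm (fun y => eG i y * f (ew i y)) ;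
  eCV : forall i f B, bm f -> measurable (B : set (measurableTypeR R)) -> B `<=` X ->
    (\int[@lebesgue_measure R]_(y in B) (eG i y * f (ew i y)) =
     \int[@lebesgue_measure R]_(x in [set x | eu i < x < ev i /\ B (eS x)]) f x)%R }.

Section Transfer.
Context {R : realType} (s : expanding R).
Local Notation m := (@lebesgue_measure R).
Local Notation X := (@X R).
Local Notation S := (eS s).
Local Notation u := (eu s).
Local Notation v := (ev s).
Local Notation c := (ec s).
Local Notation d := (ed s).
Local Notation w := (ew s).
Local Notation G := (eG s).
Local Notation lam := (elam s).
Local Notation A := (eA s).
Local Notation K := (eK s).
Implicit Types (f g V : R -> R) (x y z M N : R).

Lemma lam_gt0 : 0 < lam.
Proof. by have := elamA s; have := eA0 s; lra. Qed.

Lemma branch_X i x : u i < x < v i -> X x.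
Proof. by have [? ? ?] := euv s i => /andP[? ?]; apply/inX; apply/andP; split; lra. Qed.

Lemma image_X i x : c i < x < d i -> X x.
Proof. by have [? ? ?] := ecd s i => /andP[? ?]; apply/inX; apply/andP; split; lra. Qed.

Lemma G_ge0 i y : 0 <= G i y.
Proof.
have [h|h] := boolP (c i < y < d i); first by rewrite ltW// eG_gt0.
by rewrite eG0.
Qed.

(** In contrast to [lam^-1], this bound is summable over the branches; it makes the series over the
    branches converge. *)
Lemma G_le_width i y : G i y <= K * (v i - u i).
Proof.
have [h|h] := boolP (c i < y < d i); first exact: eG_sup.
by rewrite eG0// mulr_ge0 ?eK0// subr_ge0; have [] := euv s i.
Qed.

Lemma width_sum n : \sum_(i < n) (v i - u i) <= 1.
Proof.
have := @sum_increments_disjoint R id u v n (fun _ _ _ h _ => h) (euv s) (@edisj _ s).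
by rewrite subr0.
Qed.

(** The image of a branch has length at most 1 and its inverse contracts by [lam^-1]; two points
    near the ends of a longer branch would violate this. *)
Lemma width_le i : v i - u i <= lam^-1.
Proof.
rewrite leNgt; apply/negP => h.
have l0 : 0 <= lam^-1 by rewrite invr_ge0 ltW// lam_gt0.
pose e := (v i - u i - lam^-1) / 4.
have hx : u i < u i + e < v i by apply/andP; rewrite /e; split; lra.
have hy : u i < v i - e < v i by apply/andP; rewrite /e; split; lra.
have Sx := eS_in hx; have Sy := eS_in hy.
have := ew_contr Sx Sy; rewrite !ewS//.
have : lam^-1 * `|S (u i + e) - S (v i - e)| <= lam^-1 * 1.
  rewrite ler_wpM2l//; have [? ? ?] := ecd s i.
  by move/andP: Sx => [? ?]; move/andP: Sy => [? ?]; rewrite ler_norml; apply/andP; split; lra.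
have := ler_norm (v i - e - (u i + e)).
by rewrite distrC /e; lra.
Qed.

Definition branch i : set (measurableTypeR R) := [set x | u i < x < v i].

Lemma branchE i : branch i = [set` `]u i, v i[].
Proof. by apply/seteqP; split => x; rewrite /branch /= in_itv. Qed.

Lemma measurable_branch i : measurable (branch i).
Proof. by rewrite branchE; exact: measurable_itv. Qed.

Lemma branch_sub i : branch i `<=` X.
Proof. by move=> x; exact: branch_X. Qed.

Lemma lebesgue_branch i : fine (m (branch i)) = v i - u i.
Proof.
rewrite branchE lebesgue_measure_itv /= lte_fin.
case: (ltP (u i) (v i)) => // h; have [_ h2 _] := euv s i.
by rewrite (@le_anti _ _ (u i) (v i)) ?subrr// h h2.
Qed.

(** The cost of one branch. The function lives on []c i, d i[]: it has two jumps of size at most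
    [sup G] times [sup |f|], and in between its variation is at most [lam^-1] times that of [f] plus
    [A] times [sup |f|] times the width. On the branch, [sup |f|] is at most the infimum of [|f|]
    plus the increment of [V]. The infimum is charged to the integral of [|f|]; the increment of [V]
    receives the total coefficient [(3 + A) / lam <= 1 / 2]. *)
Lemma branch_var i V f : dominates V f ->
  var (fun y => G i y * f (w i y))
      (2^-1 * (V (v i) - V (u i)) + (2 * K + A) * \int[m]_(x in branch i) `|f x|).
Proof.
move=> dV; have bf : bm f by apply: (@var_bm _ _ (V 1 - V 0)); exists V.
have [u0 uv v1] := euv s i.
have int0 : 0 <= \int[m]_(x in branch i) `|f x| by apply: Rintegral_ge0.
have KA0 : 0 <= 2 * K + A by have := eK0 s; have := eA0 s; lra.
have DV0 : 0 <= V (v i) - V (u i) by rewrite subr_ge0; apply: dominates_le dV _ _ _.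
have [ltuv|] := ltP (u i) (v i); last first.
  move=> vu; apply: (@var_weak _ _ 0); first by rewrite addr_ge0 ?mulr_ge0.
  apply: var_eq (var_cst 0) => y _; rewrite eG0 ?mul0r//.
  by apply/negP => /(@ew_in _ s) /andP[]; lra.
have [c0 cd d1] := ecd s i.
pose I := inf [set `|f z| | z in branch i].
have I0 : lbound [set `|f z| | z in branch i] 0 by move=> _ [z _ <-].
have neI : [set `|f z| | z in branch i] !=set0.
  by exists `|f ((u i + v i) / 2)|, ((u i + v i) / 2) => //; rewrite /branch/=; apply/andP; split; lra.
have Ige0 : 0 <= I by apply: lb_le_inf.
have If x : branch i x -> I <= `|f x|.
  by move=> bx; apply: ge_inf; [exists 0 | exists x].
have Iint : (v i - u i) * I <= \int[m]_(x in branch i) `|f x|.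
  rewrite mulrC -lebesgue_branch -[leLHS]Rintegral_cst; last exact: measurable_branch.
  apply: Rint_le => //; [exact: bm_cst|exact: bm_norm|exact: measurable_branch|].
  exact: branch_sub.
pose m0 := I + (V (v i) - V (u i)).
have m00 : 0 <= m0 by rewrite addr_ge0.
have fd x z : branch i x -> branch i z -> x <= z -> `|f z - f x| <= V (v i) - V (u i).
  move=> /= /andP[? ?] /andP[? ?] xz.
  have : V (u i) <= V x by apply: dominates_le dV _ _ _; lra.
  have : V z <= V (v i) by apply: dominates_le dV _ _ _; lra.
  have := dV x z; lra.
have fm0 x : branch i x -> `|f x| <= m0.
  move=> bx; rewrite -lerBlDr; apply: lb_le_inf => // _ [z bz <-].
  have : `|f x - f z| <= V (v i) - V (u i).
    by have [xz|/ltW zx] := leP x z; [rewrite distrC|]; exact: fd.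
  have := ler_normD (f x - f z) (f z); rewrite subrK; lra.
have lam0 := lam_gt0.
have il0 : 0 <= lam^-1 by rewrite invr_ge0 ltW.
(* The bound [lam^-1] is used where [G] multiplies the increment of [V], and [K * (v i - u i)] where
   it multiplies [I], since [(v i - u i) * I] is at most the integral. *)
pose g := Num.min lam^-1 (K * (v i - u i)).
have Gg y : c i < y < d i -> G i y <= g.
  by move=> h; rewrite /g le_min eG_le// G_le_width.
have g0 : 0 <= g by rewrite /g le_min il0 mulr_ge0 ?eK0// subr_ge0.
(* This dominates the product in the coordinate [w i y]: the first term is for the increments of
   [f], the second for those of [G i]. *)
pose Psi x := lam^-1 * V x + A * m0 * x.
have Am0 : 0 <= A * m0 by rewrite mulr_ge0// eA0.
have Psi_le x z : 0 <= x -> x <= z -> z <= 1 -> Psi x <= Psi z.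
  move=> x0 xz z1; rewrite /Psi lerD// ler_wpM2l//.
  exact: dominates_le dV _ _ _.
have key y z : c i < y < d i -> c i < z < d i ->
    `|G i y * f (w i y) - G i z * f (w i z)| <= `|Psi (w i y) - Psi (w i z)|.
  wlog : y z / w i y <= w i z => [H|].
    have [h|/ltW h] := leP (w i y) (w i z); first exact: H.
    by move=> hy hz; rewrite distrC [leRHS]distrC; exact: H.
  move=> wyz hy hz; have /andP[wy1 wy2] := ew_in hy; have /andP[wz1 wz2] := ew_in hz.
  have y0 : 0 <= w i y := le_trans u0 (ltW wy1).
  have z1 : w i z <= 1 := le_trans (ltW wz2) v1.
  rewrite [leRHS]distrC [leRHS]ger0_norm ?subr_ge0; last exact: Psi_le.
  rewrite (_ : G i y * _ - _ = G i y * (f (w i y) - f (w i z)) + (G i y - G i z) * f (w i z)); last by ring.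
  rewrite (le_trans (ler_normD _ _))// !normrM (ger0_norm (G_ge0 _ _)).
  have h1 : G i y * `|f (w i y) - f (w i z)| <= lam^-1 * (V (w i z) - V (w i y)).
    by rewrite ler_pM ?G_ge0 ?eG_le// distrC; apply: dV.
  have h2 : `|G i y - G i z| * `|f (w i z)| <= A * (w i z - w i y) * m0.
    rewrite ler_pM// ?fm0//; last by rewrite /branch/= wz1.
    by rewrite (le_trans (eG_dist hy hz))// distrC ger0_norm// subr_ge0.
  by apply: le_trans (lerD h1 h2) _; rewrite /Psi le_eqVlt; apply/orP; left; apply/eqP; ring.
pose inc := forall y z, c i < y -> y < z -> z < d i -> w i y < w i z.
(* [Psi] along [w i], reflected if [w i] decreases, so as to be nonnegative and nondecreasing in
   [y]. *)
pose psi y := if `[< inc >] then Psi (w i y) - Psi (u i) else Psi (v i) - Psi (w i y).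
have hbig : 2 * (g * m0) + (Psi (v i) - Psi (u i)) <=
   2^-1 * (V (v i) - V (u i)) + (2 * K + A) * \int[m]_(x in branch i) `|f x|.
  apply: (@le_trans _ _ (2^-1 * (V (v i) - V (u i)) + (2 * K + A) * ((v i - u i) * I))); last first.
    by rewrite lerD2l ler_wpM2l.
  have g1 : g <= lam^-1 by rewrite /g ge_min lexx.
  have g2 : g <= K * (v i - u i) by rewrite /g ge_min lexx orbT.
  have e1 : g * I <= K * (v i - u i) * I by rewrite ler_wpM2r.
  have e2 : g * (V (v i) - V (u i)) <= lam^-1 * (V (v i) - V (u i)) by rewrite ler_wpM2r.
  have e3 : A * (v i - u i) * (V (v i) - V (u i)) <= A * lam^-1 * (V (v i) - V (u i)).
    by rewrite ler_wpM2r// ler_wpM2l ?eA0// width_le.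
  (* The two jumps, the variation of [f] and the distortion contribute [2 + 1 + A]; this is where
     [elamA] enters. *)
  have e4 : (3 + A) * lam^-1 <= 2^-1.
    by rewrite ler_pdivrMr//; have := elamA s; lra.
  have e5 : (3 + A) * lam^-1 * (V (v i) - V (u i)) <= 2^-1 * (V (v i) - V (u i)).
    by rewrite ler_wpM2r.
  by rewrite /Psi /m0; move: e1 e2 e3 e5; lra.
apply: var_weak hbig _.
have Psi_in z : u i < z < v i -> Psi (u i) <= Psi z <= Psi (v i).
  move=> /andP[h1 h2]; apply/andP; split; apply: Psi_le => //; rewrite ?ltW//.
    exact: lt_le_trans h2 v1.
  exact: le_lt_trans u0 h1.
have Puv : Psi (u i) <= Psi (v i) by apply: Psi_le => //; exact: ltW.
apply: (@var_bump _ _ (g * m0) psi (c i) (d i)) => //.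
- by move=> x h; rewrite eG0// mul0r.
- move=> x h; rewrite normrM (ger0_norm (G_ge0 _ _)) ler_pM ?G_ge0 ?Gg// fm0//.
  exact: ew_in.
- move=> x /(@ew_in _ s) /Psi_in /andP[w1 w2].
  by rewrite /psi; case: ifP => _; rewrite subr_ge0 ?w1 ?w2 ?lerD2l ?lerD2r ?lerN2//= w2 w1.
- move=> x y cx xy yd.
  have hx : c i < x < d i by rewrite cx (le_lt_trans xy).
  have hy : c i < y < d i by rewrite yd (lt_le_trans cx).
  move: xy; rewrite le_eqVlt => /predU1P[->|xy]; first by rewrite !subrr normr0.
  apply: (le_trans (key y x hy hx)).
  have /andP[wx1 wx2] := ew_in hx; have /andP[wy1 wy2] := ew_in hy.
  have wX z : c i < z < d i -> 0 <= w i z <= 1.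
    by move=> /(@ew_in _ s) /andP[h1 h2]; rewrite (le_trans u0 (ltW h1)) (le_trans (ltW h2) v1).
  have /andP[x0 x1] := wX x hx; have /andP[y0 y1] := wX y hy.
  rewrite /psi; case: ifPn => [/asboolP h|/asboolPn h].
    have := h x y cx xy yd => wxy; have hh := Psi_le _ _ x0 (ltW wxy) y1.
    by rewrite ger0_norm ?subr_ge0// opprB addrA subrK.
  have [//|h'] := emono s i; have := h' x y cx xy yd => wxy.
  have hh := Psi_le _ _ y0 (ltW wxy) x1.
  by rewrite ler0_norm ?subr_le0// !opprB [leRHS]addrC addrA subrK.
- by rewrite mulr_ge0.
- by rewrite subr_ge0.
Qed.

End Transfer.

Section RintegralLimits.
Context {R : realType}.
Local Notation m := (@lebesgue_measure R).
Local Notation X := (@X R).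

Lemma Rint_ae (f g : R -> R) (B N : set (measurableTypeR R)) : bm f -> bm g ->
  measurable B -> B `<=` X -> measurable N -> m N = 0%E ->
  (forall x, B x -> ~ N x -> f x = g x) ->
  \int[m]_(x in B) f x = \int[m]_(x in B) g x.
Proof.
move=> bf bg mB BX mN N0 fg; rewrite /Rintegral; congr fine.
have hE (h : R -> R) : bm h ->
    (\int[m]_(x in B) (h x)%:E = \int[m]_(x in B `\` N) (h x)%:E)%E.
  by move=> bh; apply: negligible_integral => //; exact: bm_integrable.
rewrite !hE//; apply: eq_integral => x /[1!inE] -[Bx Nx].
by rewrite fg.
Qed.

Lemma Rint_dominated (f : nat -> R -> R) (g : R -> R) (B : set (measurableTypeR R)) (M : R) :
  (forall n, bm (f n)) -> bm g -> measurable B -> B `<=` X ->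
  (forall n x, B x -> `|f n x| <= M) ->
  (forall x, B x -> f n x @[n --> \oo] --> g x) ->
  \int[m]_(x in B) f n x @[n --> \oo] --> \int[m]_(x in B) g x.
Proof.
move=> bf bg mB BX fM fg.
have fin (h : R -> R) : bm h -> (\int[m]_(x in B) (h x)%:E \is a fin_num)%E.
  by move=> bh; apply: integrable_fin_num => //; exact: bm_integrable.
apply: (@fine_cvg _ _ _ _ (fun n => \int[m]_(x in B) (f n x)%:E)%E).
rewrite /Rintegral fineK ?fin//.
apply: (@dominated_cvg _ _ _ m B mB (fun n x => (f n x)%:E) (fun x => (g x)%:E)
  (fun=> M%:E)) => //.
- move=> n; apply/measurable_EFinP; case: (bf n) => mf _.
  by apply: measurable_funS mf => //; exact: measurable_X.
- by move=> x Bx; apply: cvg_EFin; [apply: nearW | exact: fg].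
- by apply: (bm_integrable (bm_cst M)).
Qed.

End RintegralLimits.

Section SelfMap.
Context {R : realType} (T : R -> R) (P : probability (measurableTypeR R) R).
Local Notation X := (@X R).
Implicit Types (x y : R) (A B N : set (measurableTypeR R)).
Hypotheses (T_X : forall x, X x -> X (T x))
  (T_meas : measurable_fun (X : set (measurableTypeR R))
    (T : measurableTypeR R -> measurableTypeR R))
  (Pinv : forall B, measurable B -> B `<=` X -> P (Xpreimage T 1 B) = P B).

Lemma iter_self n x : X x -> X (iter n T x).
Proof. by move=> Xx; elim: n => //= n; exact: T_X. Qed.

Lemma Xpreimage_add n k B : Xpreimage T (n + k) B = Xpreimage T n (Xpreimage T k B).
Proof.
have e x : iter (n + k) T x = iter k T (iter n T x) by rewrite addnC iterD.
apply/seteqP; split => x [Xx] h; split => //=; move: h; rewrite /= e; last by case.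
by move=> Bx; split => //; exact: iter_self.
Qed.

Lemma measurable_Xpreimage1 B : measurable B ->
  measurable (Xpreimage T 1 B : set (measurableTypeR R)).
Proof. by move=> mB; apply: T_meas => //; exact: measurable_X. Qed.

Lemma measurable_self_preimage n B : measurable B ->
  measurable (Xpreimage T n B : set (measurableTypeR R)).
Proof.
move=> mB; elim: n => [|n IH]; first by apply: measurableI => //; exact: measurable_X.
by rewrite -add1n Xpreimage_add; exact: measurable_Xpreimage1.
Qed.

Lemma pr_preimage n B : measurable B -> B `<=` X -> P (Xpreimage T n B) = P B.
Proof.
move=> mB BX; elim: n => [|n IH].
  by congr (P _); apply/seteqP; split => x; [case | move=> Bx; split => //; exact: BX].
rewrite -add1n Xpreimage_add Pinv//; last by move=> x [].
exact: measurable_self_preimage.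
Qed.

Lemma Xpreimage_iter (N n : nat) B : Xpreimage (iter N T) n B = Xpreimage T (n * N) B.
Proof. by apply/seteqP; split => x [Xx] h; split => //; move: h; rewrite /= iterM. Qed.

End SelfMap.

Section Operator.
Context {R : realType} (s : expanding R).
Local Notation m := (@lebesgue_measure R).
Local Notation X := (@X R).
Local Notation S := (eS s).
Local Notation u := (eu s).
Local Notation v := (ev s).
Local Notation c := (ec s).
Local Notation d := (ed s).
Local Notation w := (ew s).
Local Notation G := (eG s).
Local Notation A := (eA s).
Local Notation K := (eK s).
Implicit Types (f g V : R -> R) (x y z M N : R) (B : set (measurableTypeR R)).

Definition partial_transfer f n y := \sum_(i < n) G i y * f (w i y).

(** The Perron-Frobenius operator, given at every point by a sum over the inverse branches. For
    bounded [f] the series converges absolutely, its terms being bounded by multiples of the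
    widths. *)
Definition transfer f y := limn (fun n => partial_transfer f n y).

Local Notation L := transfer.

Lemma G_mul_le f M i y : 0 <= M -> (forall x, X x -> `|f x| <= M) ->
  `|G i y * f (w i y)| <= K * M * (v i - u i).
Proof.
move=> M0 fM; have [h|h] := boolP (c i < y < d i); last first.
  rewrite eG0// mul0r normr0 !mulr_ge0 ?eK0// subr_ge0; by have [] := euv s i.
rewrite normrM (ger0_norm (G_ge0 _ _ _)) mulrAC ler_pM ?G_ge0 ?G_le_width//.
by apply: fM; apply: (@branch_X _ s i); exact: ew_in.
Qed.

Lemma bm_bound f : bm f -> exists2 M : R, 0 <= M & forall x, X x -> `|f x| <= M.
Proof.
move=> [_ [M fM]]; exists M => //.
have X0 : X 0 by apply/inX; rewrite lexx ler01.
by rewrite (le_trans _ (fM _ X0)).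
Qed.

Lemma transfer_cvg f y : bm f -> partial_transfer f n y @[n --> \oo] --> L f y.
Proof.
move=> /bm_bound[M M0 fM].
suff : cvgn (series (fun i => G i y * f (w i y))).
  by rewrite /L (_ : series _ = (fun n => partial_transfer f n y))//;
    apply/funext => n; rewrite /series /partial_transfer /= big_mkord.
apply: normed_cvg.
apply: (@series_le_cvg _ _ (fun i => K * M * (v i - u i))) => //.
- by move=> n; exact: normr_ge0.
- move=> n; rewrite !mulr_ge0 ?eK0// subr_ge0; by have [] := euv s n.
- by move=> n; exact: G_mul_le.
apply: nondecreasing_is_cvgn.
  apply: nondecreasing_series => n _ _; rewrite !mulr_ge0 ?eK0// subr_ge0.
  by have [] := euv s n.
exists (K * M) => _ [n _ <-]; rewrite /series/= -mulr_sumr big_mkord.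
by rewrite ler_piMr ?mulr_ge0 ?eK0// width_sum.
Qed.

Lemma transfer_eq f g : (forall x, X x -> f x = g x) -> L f = L g.
Proof.
move=> fg; apply/funext => y; rewrite /L (_ : partial_transfer f ^~ y = partial_transfer g ^~ y)//.
apply/funext => n; apply: eq_bigr => i _.
have [h|h] := boolP (c i < y < d i); last by rewrite eG0// !mul0r.
by rewrite fg//; apply: (@branch_X _ s i); exact: ew_in.
Qed.

Lemma transfer_le f g y : bm f -> bm g -> (forall x, X x -> f x <= g x) ->
  L f y <= L g y.
Proof.
move=> bf bg fg; rewrite -subr_ge0.
apply: (@lim_ge _ (fun n => partial_transfer g n y - partial_transfer f n y)).
  by apply: cvgB; exact: transfer_cvg.
move=> n.
rewrite subr_ge0; apply: ler_sum => i _.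
have [h|h] := boolP (c i < y < d i); last by rewrite eG0// !mul0r.
rewrite ler_wpM2l ?G_ge0// fg//; apply: (@branch_X _ s i); exact: ew_in.
Qed.

Lemma transferD f g y : bm f -> bm g -> L (fun x => f x + g x) y = L f y + L g y.
Proof.
move=> bf bg; apply: cvg_lim => //.
rewrite (_ : (fun n => _) = (fun n => partial_transfer f n y + partial_transfer g n y)).
  by apply: cvgD; exact: transfer_cvg.
apply/funext => n; rewrite /partial_transfer -big_split; apply: eq_bigr => i _ /=.
by rewrite mulrDr.
Qed.

Lemma transferZ k f y : bm f -> L (fun x => k * f x) y = k * L f y.
Proof.
move=> bf; apply: cvg_lim => //.
rewrite (_ : (fun n => _) = (fun n => k * partial_transfer f n y)).
  by apply: cvgM; [exact: cvg_cst | exact: transfer_cvg].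
apply/funext => n; rewrite /partial_transfer mulr_sumr; apply: eq_bigr => i _ /=.
by rewrite mulrCA.
Qed.

Lemma transferB f g y : bm f -> bm g -> L (fun x => f x - g x) y = L f y - L g y.
Proof.
move=> bf bg.
rewrite (_ : (fun x => f x - g x) = (fun x => f x + -1 * g x)); last first.
  by apply/funext => x; rewrite mulN1r.
by rewrite transferD ?transferZ ?mulN1r//; exact: bmZ.
Qed.

Lemma transfer_norm f M y : 0 <= M -> bm f -> (forall x, X x -> `|f x| <= M) ->
  `|L f y| <= K * M.
Proof.
move=> M0 bf fM; apply: (@lim_le _ (fun n => `|partial_transfer f n y|)).
  by apply: cvg_norm; exact: transfer_cvg.
move=> n.
apply: le_trans (ler_norm_sum _ _ _) _.
apply: (@le_trans _ _ (\sum_(i < n) K * M * (v i - u i))).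
  by apply: ler_sum => i _; exact: G_mul_le.
by rewrite -mulr_sumr ler_piMr ?mulr_ge0 ?eK0// width_sum.
Qed.

Lemma transfer_abs f y : bm f -> `|L f y| <= L (fun x => `|f x|) y.
Proof.
move=> bf; have bn := bm_norm bf; rewrite ler_norml; apply/andP; split.
  rewrite -mulN1r -transferZ//; apply: transfer_le => //; first exact: bmZ.
  by move=> x _; rewrite mulN1r lerNl -normrN ler_norm.
by apply: transfer_le => // x _; exact: ler_norm.
Qed.

Lemma transfer_ge0 f y : bm f -> (forall x, X x -> 0 <= f x) -> 0 <= L f y.
Proof.
move=> bf f0; have := transfer_le y (bm_cst 0) bf f0.
suff -> : L (fun=> 0) y = 0 by [].
rewrite (@transfer_eq _ (fun x => 0 * 0)); last by move=> x _; rewrite mul0r.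
by rewrite transferZ ?mul0r//; exact: bm_cst.
Qed.

Lemma partial_transfer_bm f n : bm f -> bm (partial_transfer f n).
Proof.
move=> bf; apply: (@bm_sum _ n (fun i y => G i y * f (w i y))) => i _.
exact: eCV_bm.
Qed.

Lemma partial_transfer_le f M n y : 0 <= M -> bm f ->
  (forall x, X x -> `|f x| <= M) -> `|partial_transfer f n y| <= K * M.
Proof.
move=> M0 bf fM; apply: le_trans (ler_norm_sum _ _ _) _.
apply: (@le_trans _ _ (\sum_(i < n) K * M * (v i - u i))).
  by apply: ler_sum => i _; exact: G_mul_le.
by rewrite -mulr_sumr ler_piMr ?mulr_ge0 ?eK0// width_sum.
Qed.

Lemma transfer_bm f : bm f -> bm (L f).
Proof.
move=> bf; have [M M0 fM] := bm_bound bf.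
apply: (@bm_limit _ (partial_transfer f) _ (K * M)).
- by move=> n; exact: partial_transfer_bm.
- by move=> n x _; exact: partial_transfer_le.
- by move=> x _; exact: transfer_cvg.
Qed.

Lemma measurable_Xpreimage n B : measurable B -> measurable (Xpreimage S n B).
Proof. exact: measurable_self_preimage (@eS_X _ s) (@eS_meas _ s) n B. Qed.

Lemma iter_X n x : X x -> X (iter n S x).
Proof. exact: iter_self (@eS_X _ s) n x. Qed.

Lemma XpreimageS n B : Xpreimage S n.+1 B = Xpreimage S n (Xpreimage S 1 B).
Proof. by rewrite -addn1 (Xpreimage_add (@eS_X _ s)). Qed.

(** By [eCV] on each branch, the integral of the [n]-th partial sum over [B] is that of [f] over the
    part of the preimage in the first [n] branches. Both sides converge by dominated convergence,
    and the points in no branch form a null set. *)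
Lemma transfer_int f B : bm f -> measurable B -> B `<=` X ->
  \int[m]_(x in B) L f x = \int[m]_(x in Xpreimage S 1 B) f x.
Proof.
move=> bf mB BX; have [M M0 fM] := bm_bound bf; have mX := @measurable_X R.
have mP : measurable (Xpreimage S 1 B) by exact: measurable_Xpreimage.
have h1 : \int[m]_(x in B) partial_transfer f n x @[n --> \oo] --> \int[m]_(x in B) L f x.
  apply: (@Rint_dominated _ _ _ _ (K * M)) => //.
  - by move=> n; exact: partial_transfer_bm.
  - exact: transfer_bm.
  - by move=> n x _; exact: partial_transfer_le.
  - by move=> x _; exact: transfer_cvg.
pose E n : set (measurableTypeR R) := [set x | exists2 i, (i < n)%N & branch s i x].
have EE n : E n = \bigcup_(i < n) branch s i.
  by apply/seteqP; split => x [i h1' h2']; exists i.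
have mE n : measurable (E n).
  by rewrite EE; apply: bigcup_measurable => i _; exact: measurable_branch.
have indE n x : \1_(E n) x = \sum_(i < n) \1_(branch s i) x :> R.
  rewrite indicE; have [|] := boolP (x \in E n).
    rewrite inE => -[i i_n bx]; rewrite (bigD1 (Ordinal i_n))//=.
    rewrite indicE mem_set// big1 ?addr0// => j ji; rewrite indicE memNset// => bj.
    by move/eqP: ji; apply; apply: val_inj => /=; exact: edisj bj bx.
  rewrite notin_setE => h; rewrite big1// => i _; rewrite indicE memNset// => bx.
  by apply: h; exists i.
have h2 n : \int[m]_(x in B) partial_transfer f n x =
    \int[m]_(x in Xpreimage S 1 B) (\1_(E n) x * f x).
  rewrite (@Rint_sum _ n (fun i y => G i y * f (w i y)))//; last by move=> i _; exact: eCV_bm.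
  under eq_bigr do rewrite eCV//.
  under [RHS]eq_Rintegral do rewrite indE mulr_suml.
  rewrite (@Rint_sum _ _ (fun i x => \1_(branch s i) x * f x))//; last 2 first.
  - by move=> i _; apply: bmM => //; apply: bm_indic; exact: measurable_branch.
  - by move=> x [].
  apply: eq_bigr => i _; rewrite Rint_indic; congr (Rintegral _ _ _).
  apply/seteqP; split => x /=; last by case=> -[? ?] ?; split.
  by move=> [h1' h2']; split => //; split => //; exact: branch_X h1'.
have h3 : \int[m]_(x in Xpreimage S 1 B) (\1_(E n) x * f x) @[n --> \oo] -->
    \int[m]_(x in Xpreimage S 1 B) (\1_(\bigcup_i branch s i) x * f x).
  apply: (@Rint_dominated _ _ _ _ M) => //.
  - by move=> n; apply: bmM => //; exact: bm_indic.
  - apply: bmM => //; apply: bm_indic; apply: bigcup_measurable => i _.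
    exact: measurable_branch.
  - by move=> x [].
  - move=> n x [Xx _]; rewrite normrM indicE -[leRHS]mul1r ler_pM// ?fM//.
    by case: (_ \in _); rewrite ?normr1 ?normr0.
  - move=> x [Xx _]; apply: cvgM; last exact: cvg_cst.
    have [[i _ bx]|nb] := pselect ((\bigcup_i branch s i) x).
      rewrite indicE mem_set//; last by exists i.
      apply: cvg_near_cst; exists i.+1 => // n /= ni; rewrite indicE mem_set//.
      by exists i.
    rewrite indicE memNset//; apply: cvg_near_cst; apply: nearW => n.
    by rewrite indicE memNset// => -[i _ bx]; apply: nb; exists i.
have h4 := cvg_lim (@Rhausdorff R) h1.
rewrite -h4; under eq_fun do rewrite h2.
rewrite (cvg_lim (@Rhausdorff R) h3).
apply: (@Rint_ae _ _ _ _ (X `\` [set x | exists i, u i < x < v i])) => //.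
- apply: bmM => //; apply: bm_indic; apply: bigcup_measurable => i _.
  exact: measurable_branch.
- by move=> x [].
- apply: measurableD => //.
  rewrite (_ : [set x | _] = \bigcup_i branch s i); last first.
    by apply/seteqP; split => x [i]; [exists i | move=> _; exists i].
  by apply: bigcup_measurable => i _; exact: measurable_branch.
- exact: ecover.
move=> x [Xx _] h; rewrite indicE mem_set ?mul1r//.
by apply: contrapT => nb; apply: h; split => // -[i bx]; apply: nb; exists i.
Qed.

Lemma XpreimageX n : Xpreimage S n X = X.
Proof. by apply/seteqP; split => x; [case | split => //; exact: iter_X]. Qed.

Lemma transfer_int_X f : bm f -> \int[m]_(x in X) L f x = \int[m]_(x in X) f x.
Proof. by move=> bf; rewrite transfer_int ?XpreimageX//; exact: measurable_X. Qed.

Lemma transfer_L1 f : bm f -> \int[m]_(x in X) `|L f x| <= \int[m]_(x in X) `|f x|.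
Proof.
move=> bf; have bn := bm_norm bf; rewrite -(transfer_int_X bn).
apply: Rint_le => //.
- by apply: bm_norm; exact: transfer_bm.
- exact: transfer_bm.
- exact: measurable_X.
- by move=> x _; exact: transfer_abs.
Qed.

(** The coefficient of the integral in [branch_var]. It survives the summation over the branches,
    because these are disjoint. *)
Definition kappa := 2 * K + A.

Lemma kappa_ge0 : 0 <= kappa.
Proof. by rewrite /kappa; have := eK0 s; have := eA0 s; lra. Qed.

Lemma branch_int_sum f n : bm f ->
  \sum_(i < n) \int[m]_(x in branch s i) `|f x| <= \int[m]_(x in X) `|f x|.
Proof.
move=> bf; have bn := bm_norm bf; have mX := @measurable_X R.
under eq_bigr => i _ do
  rewrite -[branch s i](setIidr (@branch_sub _ s i)) -Rint_indic.
have bi (i : nat) : bm (fun x => \1_(branch s i) x * `|f x|).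
  by apply: bmM => //; apply: bm_indic; exact: measurable_branch.
rewrite -(@Rint_sum _ _ (fun i x => \1_(branch s i) x * `|f x|))//.
apply: Rint_le => //; first exact: (@bm_sum _ n (fun i x => \1_(branch s i) x * `|f x|)).
move=> x Xx; rewrite -mulr_suml ler_piMl//.
have [[i [i_n bx]]|nb] := pselect (exists i, (i < n)%N /\ branch s i x).
  rewrite (bigD1 (Ordinal i_n))//= indicE mem_set// big1 ?addr0// => j ji.
  rewrite indicE memNset// => bj.
  by move/eqP: ji; apply; apply: val_inj => /=; exact: edisj bj bx.
rewrite big1// => i _; rewrite indicE memNset// => bx.
by apply: nb; exists i.
Qed.

(** [branch_var] is summed over the branches; the increments of [V] over disjoint intervals add up
    to at most [M]. *)
Lemma lasota_yorke f M : var f M ->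
  var (L f) (2^-1 * M + kappa * \int[m]_(x in X) `|f x|).
Proof.
move=> [V dV VM]; have bf : bm f by apply: (@var_bm _ _ (V 1 - V 0)); exists V.
apply: (var_series (fun i => branch_var s i dV)).
  move=> n; rewrite big_split /= -!mulr_sumr lerD//.
    rewrite ler_wpM2l// (le_trans _ VM)//.
    apply: sum_increments_disjoint; [by move=> x y; exact: (dominates_le dV) | exact: euv|].
    exact: edisj.
  by rewrite ler_wpM2l ?kappa_ge0// branch_int_sum.
by move=> x Xx; exact: transfer_cvg.
Qed.

Local Notation Ln n f := (iter n L f).

Lemma iter_transfer_bm n f : bm f -> bm (Ln n f).
Proof. by move=> bf; elim: n => //= n; exact: transfer_bm. Qed.

Lemma iter_transfer_L1 n f : bm f ->
  \int[m]_(x in X) `|Ln n f x| <= \int[m]_(x in X) `|f x|.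
Proof.
move=> bf; elim: n => //= n; apply: le_trans; apply: transfer_L1.
exact: iter_transfer_bm.
Qed.

Lemma iter_transfer_int n f B : bm f -> measurable B -> B `<=` X ->
  \int[m]_(x in B) Ln n f x = \int[m]_(x in Xpreimage S n B) f x.
Proof.
move=> bf; elim: n B => [|n IH] B mB BX.
  rewrite (_ : Xpreimage S 0 B = B)//; apply/seteqP; split => x; first by case.
  by move=> Bx; split => //; exact: BX.
rewrite iterS transfer_int//; last exact: iter_transfer_bm.
rewrite IH -?XpreimageS//; first exact: measurable_Xpreimage.
by move=> x [].
Qed.

Lemma iter_transfer_eq n f g : (forall x, X x -> f x = g x) ->
  forall x, X x -> Ln n f x = Ln n g x.
Proof. by move=> fg; elim: n => //= n IH x _; rewrite (transfer_eq IH). Qed.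

Lemma iter_transferD n f g x : bm f -> bm g -> X x ->
  Ln n (fun x => f x + g x) x = Ln n f x + Ln n g x.
Proof.
move=> bf bg; elim: n x => //= n IH x Xx.
by rewrite (transfer_eq IH) transferD//; exact: iter_transfer_bm.
Qed.

Lemma iter_transferZ n k f x : bm f -> X x ->
  Ln n (fun x => k * f x) x = k * Ln n f x.
Proof.
move=> bf; elim: n x => //= n IH x Xx.
by rewrite (transfer_eq IH) transferZ//; exact: iter_transfer_bm.
Qed.

Lemma iter_transferB n f g x : bm f -> bm g -> X x ->
  Ln n (fun x => f x - g x) x = Ln n f x - Ln n g x.
Proof.
move=> bf bg; elim: n x => //= n IH x Xx.
by rewrite (transfer_eq IH) transferB//; exact: iter_transfer_bm.
Qed.

Lemma iter_transfer_sum n k (F : nat -> R -> R) x : (forall i, bm (F i)) -> X x ->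
  Ln n (fun x => \sum_(i < k) F i x) x = \sum_(i < k) Ln n (F i) x.
Proof.
move=> bF Xx; elim: k => [|k IH].
  rewrite big_ord0 (@iter_transfer_eq n _ (fun x => 0 * 0))//; last first.
    by move=> y _; rewrite big_ord0 mul0r.
  by rewrite iter_transferZ ?mul0r//; exact: bm_cst.
rewrite big_ord_recr /= -IH -iter_transferD//; last exact: bm_sum.
by apply: iter_transfer_eq => // y _; rewrite big_ord_recr.
Qed.

Lemma iter_transfer_norm n f M x : 0 <= M -> bm f ->
  (forall x, X x -> `|f x| <= M) -> X x -> `|Ln n f x| <= K ^+ n * M.
Proof.
move=> M0 bf fM; elim: n x => [|n IH] x Xx; first by rewrite expr0 mul1r fM.
rewrite iterS exprS -mulrA; apply: transfer_norm => //.
  by rewrite mulr_ge0// exprn_ge0// eK0.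
exact: iter_transfer_bm.
Qed.

(** [L] does not increase the L1 norm, so the integral terms are bounded by a geometric series with
    sum [kappa * (1 + 1/2 + 1/4 + ...)], that is [2 * kappa]. *)
Lemma lasota_yorke_iter n f M : var f M ->
  var (Ln n f) (2^-1 ^+ n * M + 2 * kappa * \int[m]_(x in X) `|f x|).
Proof.
move=> vf; have bf := var_bm vf.
have i0 : 0 <= \int[m]_(x in X) `|f x| by apply: Rintegral_ge0.
have k0 := kappa_ge0.
elim: n => [|n IH].
  by rewrite expr0 mul1r; apply: var_weak vf; rewrite lerDl !mulr_ge0.
apply: var_weak (lasota_yorke IH).
have : kappa * \int[m]_(x in X) `|Ln n f x| <= kappa * \int[m]_(x in X) `|f x|.
  by rewrite ler_wpM2l// iter_transfer_L1.
by rewrite exprS; lra.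
Qed.

End Operator.

(** * Itineraries, and the Lasota-Yorke inequality on unions of cylinders *)

Section Cylinders.
Context {R : realType} (s : expanding R).
Local Notation m := (@lebesgue_measure R).
Local Notation X := (@X R).
Local Notation S := (eS s).
Local Notation u := (eu s).
Local Notation v := (ev s).
Local Notation c := (ec s).
Local Notation d := (ed s).
Local Notation w := (ew s).
Local Notation G := (eG s).
Local Notation K := (eK s).
Local Notation L := (transfer s).
Local Notation kappa := (kappa s).
Implicit Types (f g V : R -> R) (x y z M N : R) (B : set (measurableTypeR R))
  (W : seq nat -> Prop).

(** Points in no branch receive the default code 0, which is also that of branch 0; they form a null
    set, and are excluded later by means of [escape]. *)
Definition code x : nat := xget 0%N [set i | branch s i x].

Lemma code_branch i x : branch s i x -> code x = i.
Proof.
move=> bx; have h : branch s (code x) x.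
  by rewrite /code; case: xgetP => [j -> //|/(_ i) /=].
exact: edisj h bx.
Qed.

Fixpoint itinerary q x : seq nat :=
  if q is q'.+1 then code x :: itinerary q' (S x) else [::].

Lemma measurable_code n : measurable ([set x | X x /\ code x = n] : set (measurableTypeR R)).
Proof.
have mX := @measurable_X R.
have mU : measurable (X `&` ~` (\bigcup_i branch s i) : set (measurableTypeR R)).
  apply: measurableI => //; apply: measurableC; apply: bigcup_measurable => i _.
  exact: measurable_branch.
have -> : [set x | X x /\ code x = n] =
    branch s n `|` (if n == 0%N then X `&` ~` (\bigcup_i branch s i) else set0).
  apply/seteqP; split => x.
    move=> [Xx e]; have [[i bx]|nb] := pselect (exists i, branch s i x).
      by left; rewrite -e (code_branch bx).
    right; rewrite (_ : n = 0%N); last first.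
      by rewrite -e /code; case: xgetP => // j _ bx; case: nb; exists j.
    by split => // -[i _ bx]; apply: nb; exists i.
  case=> [bx|]; first by split; [exact: branch_sub bx | exact: code_branch].
  have [-> [Xx nb]|//] := eqVneq n 0%N; split => //.
  by rewrite /code; case: xgetP => // j _ bx; case: nb; exists j.
apply: measurableU; first exact: measurable_branch.
by case: ifP.
Qed.

Lemma measurable_itinerary q W :
  measurable ([set x | X x /\ W (itinerary q x)] : set (measurableTypeR R)).
Proof.
have mX := @measurable_X R.
elim: q W => [|q IH] W /=.
  have [w|w] := pselect (W [::]).
    by rewrite (_ : [set x | _] = X)//; apply/seteqP; split => x //; case.
  by rewrite (_ : [set x | _] = set0)//; apply/seteqP; split => x //; case.
have -> : [set x | X x /\ W (code x :: itinerary q (S x))] =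
    \bigcup_n ([set x | X x /\ code x = n] `&`
       (X `&` S @^-1` [set y | X y /\ W (n :: itinerary q y)])).
  apply/seteqP; split => x.
    by move=> [Xx h]; exists (code x) => //; split=> //; split => //; split => //; exact: eS_X.
  by move=> [n _ [[Xx e] [_ [_ h]]]]; split => //; rewrite e.
apply: bigcup_measurable => n _; apply: measurableI; first exact: measurable_code.
apply: eS_meas => //; exact: (IH (fun l => W (n :: l))).
Qed.

Definition cyl q W x : R := if `[< W (itinerary q x) >] then 1 else 0.

Lemma cyl_bm q W : bm (cyl q W).
Proof.
apply: bm_eq (bm_indic (measurable_itinerary q W)) => x Xx.
rewrite indicE /cyl; case: asboolP => h; first by rewrite mem_set.
by rewrite memNset// => -[].
Qed.

(** The tail of the series is at most [K * M] times the tail of the sum of the widths, which does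
    not depend on [y]. *)
Lemma partial_transfer_unif f (e : R) : bm f -> 0 < e -> \forall n \near \oo,
  forall y, `|L f y - partial_transfer s f n y| <= e.
Proof.
move=> bf e0; have [M M0 fM] := bm_bound bf.
pose C := K * M + 1.
have C0 : 0 < C by rewrite ltr_pwDr// mulr_ge0// eK0.
pose wd n : R := \sum_(i < n) (v i - u i).
have wnd : nondecreasing_seq wd.
  apply/nondecreasing_seqP => n; rewrite /wd big_ord_recr/= lerDl subr_ge0.
  by have [] := euv s n.
have wc : cvgn wd.
  apply: nondecreasing_is_cvgn => //; exists 1 => _ [n _ <-]; exact: width_sum.
have wl n : wd n <= limn wd by exact: nondecreasing_cvgn_le.
have := wc; move=> /cvgrPdist_le /(_ (e / C)); rewrite divr_gt0// => /(_ isT) h.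
near=> n => y.
have nn : limn wd - wd n <= e / C.
  have : `|limn wd - wd n| <= e / C by near: n.
  by apply: le_trans; exact: ler_norm.
apply: (@lim_le _ (fun k => `|partial_transfer s f (k + n) y - partial_transfer s f n y|)).
  apply: cvg_norm; apply: cvgB; last exact: cvg_cst.
  by rewrite (cvg_shiftn n (fun k => partial_transfer s f k y)); exact: transfer_cvg.
move=> k; rewrite /partial_transfer addnC big_split_ord /= addrAC subrr add0r.
apply: le_trans (ler_norm_sum _ _ _) _.
apply: (@le_trans _ _ (\sum_(i < k) K * M * (v (n + i)%N - u (n + i)%N))).
  by apply: ler_sum => i _; exact: G_mul_le.
rewrite -mulr_sumr.
have -> : \sum_(i < k) (v (n + i)%N - u (n + i)%N) = wd (n + k)%N - wd n.
  by rewrite /wd big_split_ord /= addrAC subrr add0r.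
apply: (@le_trans _ _ (C * (e / C))); last by rewrite mulrC divfK// gt_eqF.
apply: ler_pM => //; rewrite ?mulr_ge0 ?eK0//.
- by rewrite subr_ge0; apply: wnd; rewrite leq_addr.
- by rewrite /C; lra.
- by apply: le_trans nn; rewrite lerB.
Unshelve. all: by end_near. Qed.

(** [L] multiplies the sup norm by at most [K], so uniform convergence of the partial sums is
    preserved by [q] applications. *)
Lemma iter_partial_transfer_cvg q f x : bm f -> X x ->
  iter q L (partial_transfer s f n) x @[n --> \oo] --> iter q L (L f) x.
Proof.
move=> bf Xx; apply/cvgrPdist_le => /= e e0.
have Kq : 0 < K ^+ q + 1 by rewrite ltr_wpDl// exprn_ge0// eK0.
have := partial_transfer_unif bf (divr_gt0 e0 Kq).
apply: filterS => n h; rewrite -iter_transferB//; last 2 first.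
- exact: transfer_bm.
- exact: partial_transfer_bm.
apply: (le_trans (@iter_transfer_norm _ s q _ (e / (K ^+ q + 1)) x _ _ _ Xx)).
- by rewrite divr_ge0// ltW.
- by apply: bmB; [exact: transfer_bm | exact: partial_transfer_bm].
- by move=> y _; exact: h.
- by rewrite mulrCA ler_piMr ?(ltW e0)// ler_pdivrMr// mul1r lerDl.
Qed.

(* The cylinders of rank q.+1 are split according to their first letter, which
   turns cyl q.+1 W * f into the functions G i * f \o w i cut down to cylinders
   of rank q. *)
Lemma cylinder_lasota_yorke q : forall W f M, var f M ->
  var (iter q L (fun x => cyl q W x * f x))
    (2^-1 ^+ q * M + kappa * (2 - 2 * 2^-1 ^+ q) * \int[m]_(x in X) `|f x|).
Proof.
have k0 := kappa_ge0 s.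
elim: q => [|q IH] W f M vf.
  rewrite expr0 mul1r mulr1 subrr mulr0 mul0r addr0 /=.
  have [w|w] := pselect (W [::]).
    by apply: var_eq vf => x _; rewrite /cyl /= asboolT// mul1r.
  apply: var_weak (var_ge0 vf) _.
  by apply: var_eq (var_cst 0) => x _; rewrite /cyl /= asboolF// mul0r.
have [V dV VM] := vf; have bf := var_bm vf.
have bg : bm (fun x => cyl q.+1 W x * f x) by apply: bmM => //; exact: cyl_bm.
pose F i y := G i y * f (w i y).
have bF i : bm (F i) by exact: eCV_bm.
have intF i : \int[m]_(y in X) `|F i y| = \int[m]_(x in branch s i) `|f x|.
  rewrite (@eq_Rintegral _ _ _ m _ (fun y => G i y * `|f (w i y)|)); last first.
    by move=> y _; rewrite /F normrM (ger0_norm (G_ge0 _ _ _)).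
  rewrite (@eCV _ s i (fun x => `|f x|))//; [|exact: bm_norm|exact: measurable_X].
  congr (Rintegral _ _ _); apply/seteqP; split => x; first by case.
  by move=> bx; split => //; apply: (@image_X _ s i); exact: eS_in.
(* The induction hypothesis is applied to the contribution of the first letter [i] and to the words
   that complete [i] to a word of [W]. *)
have vF i := IH (fun l => W (i :: l)) _ _ (branch_var s i dV).
rewrite iterSr.
apply: (var_series (N := 2^-1 ^+ q.+1 * M +
   kappa * (2 - 2 * 2^-1 ^+ q.+1) * \int[m]_(x in X) `|f x|) vF).
  move=> n; under eq_bigr do rewrite intF mulrDr (mulrA _ kappa) (mulrA _ (2^-1)) -addrA -mulrDl.
  rewrite big_split /= -!mulr_sumr.
  have h1 : \sum_(i < n) (V (v i) - V (u i)) <= M.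
    apply: le_trans VM; apply: sum_increments_disjoint.
    - by move=> x y; exact: (dominates_le dV).
    - exact: euv.
    - exact: edisj.
  have h2 := branch_int_sum s n bf.
  have p0 : 0 <= 2^-1 ^+ q :> R by rewrite exprn_ge0.
  have p1 : 2^-1 ^+ q <= 1 :> R by rewrite exprn_ile1//; lra.
  rewrite exprS; apply: lerD.
    by rewrite (mulrC 2^-1) ler_wpM2l// mulr_ge0.
  (* The integral term of [branch_var] arises before the [q] remaining steps and is halved by each
     of them; the other summand is the integral term of the induction hypothesis. *)
  rewrite (_ : kappa * (2 - 2 * (2^-1 * 2^-1 ^+ q)) = 2^-1 ^+ q * kappa + kappa * (2 - 2 * 2^-1 ^+ q)); last by lra.
  by rewrite ler_wpM2l// addr_ge0// mulr_ge0//; lra.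
move=> x Xx.
rewrite (_ : (fun n => _) = (fun n => iter q L (partial_transfer s (fun x => cyl q.+1 W x * f x) n) x)).
  exact: iter_partial_transfer_cvg.
apply/funext => n.
rewrite -(@iter_transfer_sum _ s q n (fun i x => cyl q (fun l => W (i :: l)) x * F i x))//; last first.
  by move=> i; apply: bmM => //; exact: cyl_bm.
apply: iter_transfer_eq => // y _; apply: eq_bigr => i _.
rewrite /F mulrCA; have [h|h] := boolP (c i < y < d i); last by rewrite eG0// !mul0r.
congr (_ * (_ * _)); rewrite /cyl /= (eSw h) (@code_branch i)//.
exact: ew_in.
Qed.

End Cylinders.

(** * The invariant density *)

Section Density.
Context {R : realType} (s : expanding R) (P : probability (measurableTypeR R) R).
Local Notation m := (@lebesgue_measure R).
Local Notation X := (@X R).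
Local Notation S := (eS s).
Local Notation K := (eK s).
Local Notation L := (transfer s).
Local Notation kappa := (kappa s).
Implicit Types (f g V : R -> R) (x y z M N e : R) (B : set (measurableTypeR R)).

Local Notation pr B := (fine (P B)).

Lemma half_small (C e : R) : 0 < e -> exists n0, forall n, (n0 <= n)%N ->
  2^-1 ^+ n * C <= e.
Proof.
move=> e0; have h : (fun n => 2^-1 ^+ n * C) @ \oo --> (0 : R).
  rewrite -[0](mul0r C); apply: cvgM; last exact: cvg_cst.
  by apply: cvg_expr; rewrite ger0_norm//; lra.
have /cvgrPdist_le /(_ e e0) [n0 _ hn] := h.
exists n0 => n nn; have := hn n nn; rewrite sub0r normrN.
by apply: le_trans; exact: ler_norm.
Qed.

Lemma half_le0 (C x : R) : (forall n, x <= 2^-1 ^+ n * C) -> x <= 0.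
Proof.
move=> h; rewrite leNgt; apply/negP => x0.
have /(half_small C)[n0 hn] : 0 < x / 2 by lra.
by have := hn n0 (leqnn _); have := h n0; lra.
Qed.

Lemma pr_fin B : measurable B -> (P B)%E \is a fin_num.
Proof. exact: fin_num_measure. Qed.

Lemma pr_ge0_le1 B : measurable B -> 0 <= pr B <= 1.
Proof.
move=> mB; rewrite fine_ge0//= -[leRHS]/(fine 1%E) fine_le//; first exact: pr_fin.
exact: probability_le1.
Qed.

Hypothesis Pac : P `<< mrestr m (measurable_itv `[0, 1]).
Hypothesis Pinv : forall B, measurable B -> B `<=` X ->
  P (Xpreimage S 1 B) = P B.

Lemma Pinv_iter n B : measurable B -> B `<=` X -> P (Xpreimage S n B) = P B.
Proof. exact: pr_preimage (@eS_X _ s) (@eS_meas _ s) Pinv n B. Qed.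

Lemma P_null B : measurable B -> m B = 0%E -> P B = 0%E.
Proof.
move=> mB B0; apply: (@Pac B) => //= A mA AB.
apply/eqP; rewrite -measure_le0 -B0 /mrestr /=.
apply: le_measure; rewrite ?inE//; last by move=> x [/AB].
by apply: measurableI => //; exact: measurable_itv.
Qed.

(** The Radon-Nikodym density is approximated in L1 by a continuous function, which is cut off at 0
    and sampled on equal cells. The result is a step function, hence of bounded variation. *)
Lemma step_approx e : 0 < e -> exists f M, [/\ var f M,
  forall x, X x -> 0 <= f x &
  forall B, measurable B -> B `<=` X -> `|\int[m]_(x in B) f x - pr B| <= e].
Proof.
move=> e0; have mX := @measurable_X R.
have Pm : P `<< m.
  apply: null_dominates_trans Pac _ => N hN A mA AN.
  apply/eqP; rewrite -measure_le0 -(hN A mA AN) /mrestr /=.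
  apply: le_measure; rewrite ?inE//; first by apply: measurableI => //; exact: measurable_itv.
have [h [h0 hfin inth hP]] := radon_nikodym_sigma_finite Pm.
pose h1 x := fine (h x).
have hE x : h x = (h1 x)%:E by rewrite /h1 fineK.
have inth1 : m.-integrable X (EFin \o h1).
  apply: (@eq_integrable _ _ _ _ _ mX h); first by move=> x _; rewrite /= -hE.
  by apply: integrableS inth => //.
have mX_lt : (m X < +oo)%E by rewrite lebesgueX ltry.
have [g_ [gc gint glim]] := approximation_continuous_integrable mX mX_lt inth1.
have e20 : 0 < e / 2 by rewrite divr_gt0.
have [N1 hN1] : exists N1 : nat, \int[m]_(x in X) `|h1 x - g_ N1 x| <= e / 2.
  have /fine_cvgP[_ /cvgrPdist_le /(_ (e / 2) e20) [N1 _ /(_ N1 (leqnn _)) /=]] := glim.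
  rewrite sub0r normrN => hN1; exists N1; apply: le_trans hN1; exact: ler_norm.
(* As the density is nonnegative, cutting off at 0 does not increase the distance to it. *)
pose g x : R := Num.max (g_ N1 x) 0.
have g0 x : 0 <= g x by rewrite /g le_max lexx orbT.
have cg : continuous g.
  move=> x; apply: (@continuous_max _ _ (g_ N1) (fun=> 0) x); first exact: gc.
  exact: cvg_cst.
have cgw : {within [set` `[0 : R, 1]], continuous g} by exact: continuous_subspaceT.
have [xm _ gxm] := EVT_max (@ler01 R) cgw.
have gM x : X x -> `|g x| <= g xm.
  by move=> Xx; rewrite ger0_norm// gxm// in_itv /=; apply/inX.
have bg : bm g.
  split; last by exists (g xm).
  by apply: measurable_funS (continuous_measurable_fun cg).
pose st (N : nat) (x : R) : R := g ((cell N x)%:R / N%:R).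
have stX (N : nat) x : X x -> X ((cell N x)%:R / N%:R).
  move=> Xx; apply/inX; rewrite divr_ge0//=.
  have [->|N0] := posnP N; first by rewrite invr0 mulr0 ler01.
  by rewrite ler_pdivrMr ?ltr0n// mul1r ler_nat cell_le.
have vst (N : nat) : var (st N) (2 * g xm * N%:R).
  apply: (@var_cell _ N (fun j => g (j%:R / N%:R))) => j jN; apply: gM.
  apply/inX; rewrite divr_ge0//=.
  have [->|N0] := posnP N; first by rewrite invr0 mulr0 ler01.
  by rewrite ler_pdivrMr ?ltr0n// mul1r ler_nat.
have bst (N : nat) : bm (st N) by exact: var_bm (vst N).
have stg x : X x -> st n.+1 x @[n --> \oo] --> g x.
  move=> Xx; apply: (@cvg_comp _ _ _ (fun n => (cell n.+1 x)%:R / n.+1%:R) g _ (nbhs x)); last exact: cg.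
  apply/cvgrPdist_le => /= k k0.
  have [n0 _ hn0] : \forall n \near \oo, n.+1%:R^-1 < k :> R by exact: near_infty_natSinv_lt (PosNum k0).
  exists n0 => // n /= nn; have := hn0 n nn => /= hk.
  apply: le_trans (ltW hk); have /andP[c1 c2] := cell_itv n.+1 Xx.
  have n1 : 0 < n.+1%:R :> R by rewrite ltr0n.
  have d1 : (cell n.+1 x)%:R / n.+1%:R <= x by rewrite ler_pdivrMr// mulrC.
  have d2 : x <= (cell n.+1 x).+1%:R / n.+1%:R by rewrite ler_pdivlMr// mulrC ltW.
  rewrite -natr1 mulrDl mul1r in d2.
  by rewrite ger0_norm ?subr_ge0// lerBlDl.
have lim1 : \int[m]_(x in X) `|st n.+1 x - g x| @[n --> \oo] --> \int[m]_(x in X) (0 : R).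
  apply: (@Rint_dominated _ _ _ _ (g xm + g xm)) => //.
  - by move=> n; apply: bm_norm; exact: bmB.
  - exact: bm_cst.
  - move=> n x Xx; rewrite normr_id (le_trans (ler_normB _ _))// lerD// gM//.
    exact: stX.
  - move=> x Xx; rewrite -[0](@normr0 _ R) -(subrr (g x)); apply: cvg_norm.
    by apply: cvgB; [exact: stg | exact: cvg_cst].
rewrite Rint_cst in lim1.
have /cvgrPdist_le /(_ (e / 2) e20) [N2 _ /(_ N2 (leqnn _)) /=] := lim1.
rewrite sub0r normrN => hN2; have {}hN2 := le_trans (ler_norm _) hN2.
exists (st N2.+1), (2 * g xm * N2.+1%:R); split => //.
  by move=> x _; exact: g0.
move=> B mB BX.
have inthB : m.-integrable B (EFin \o h1) by apply: integrableS inth1.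
have intgB : m.-integrable B (EFin \o g) by exact: bm_integrable.
have -> : pr B = \int[m]_(x in B) h1 x.
  rewrite hP// /Rintegral; congr fine; apply: eq_integral => x _.
  by rewrite hE.
have k1 : `|\int[m]_(x in B) st N2.+1 x - \int[m]_(x in B) g x| <= e / 2.
  by apply: le_trans (Rint_dist (bst _) bg mB BX) hN2.
have k2 : `|\int[m]_(x in B) g x - \int[m]_(x in B) h1 x| <= e / 2.
  have intd : m.-integrable B (EFin \o (fun x => g x - h1 x)) by exact: (integrableB mB intgB inthB).
  have inthg : m.-integrable X (EFin \o (fun x => `|h1 x - g_ N1 x|)).
    apply: integrable_norm; exact: (integrableB mX inth1 (gint N1)).
  rewrite -RintegralB//; apply: le_trans (le_normr_Rintegral mB intd) _.
  apply: le_trans hN1.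
  apply: (@le_trans _ _ (\int[m]_(x in B) `|h1 x - g_ N1 x|)).
    apply: le_Rintegral => //.
    - exact: integrable_norm.
    - by apply: integrableS inthg.
    move=> x _; have hx : 0 <= h1 x by rewrite /h1 fine_ge0.
    have := ler_norm (h1 x - g_ N1 x); have := ler_norm (g_ N1 x - h1 x).
    rewrite (distrC (g_ N1 x)) /g ler_norml; case: (leP (g_ N1 x) 0) => hg a b;
    by apply/andP; split; lra.
  rewrite /Rintegral fine_le//.
  - by apply: integrable_fin_num => //; apply: integrableS inthg.
  - exact: integrable_fin_num.
  by apply: ge0_subset_integral => //; case/integrableP : inthg.
rewrite (_ : _ - _ = (\int[m]_(x in B) st N2.+1 x - \int[m]_(x in B) g x) +
  (\int[m]_(x in B) g x - \int[m]_(x in B) h1 x)); last by ring.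
by rewrite (le_trans (ler_normD _ _))// [leRHS](splitr e) lerD.
Qed.

(** The sup norm is at most the variation plus the L1 norm: the variation is contracted up to
    [2 * kappa] times the L1 norm, which itself does not grow. *)
Lemma iter_transfer_small n f M e x : var f M ->
  \int[m]_(x in X) `|f x| <= e -> X x ->
  `|iter n L f x| <= 2^-1 ^+ n * M + (2 * kappa + 1) * e.
Proof.
move=> vf fe Xx; have k0 := kappa_ge0 s.
apply: le_trans (var_le_norm_int (lasota_yorke_iter s n vf) Xx) _.
have h1 : 2 * kappa * \int[m]_(x in X) `|f x| <= 2 * kappa * e.
  by rewrite ler_wpM2l// mulr_ge0.
have := iter_transfer_L1 s n (var_bm vf).
by lra.
Qed.

Lemma iter_transfer_addn n k f x : iter (n + k) L f x = iter n L (iter k L f) x.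
Proof. by rewrite iterD. Qed.

(* Functions with almost the same integrals over all sets are identified by high
   iterates of the transfer operator, uniformly on X. *)
Theorem invariant_density : exists h M, [/\ var h M, forall x, X x -> 0 <= h x,
  forall x, X x -> L h x = h x &
  forall B, measurable B -> B `<=` X -> pr B = \int[m]_(x in B) h x].
Proof.
have k0 := kappa_ge0 s; have mX := @measurable_X R.
have ej0 j : 0 < 2^-1 ^+ j :> R by rewrite exprn_gt0// invr_gt0.
have ej1 j : 2^-1 ^+ j <= 1 :> R by rewrite exprn_ile1//; lra.
have ejS j : 2^-1 ^+ j.+1 <= 2^-1 ^+ j :> R.
  by rewrite exprS; have := ej0 j; lra.
have /choice[st hst] : forall j, exists p : (R -> R) * R, [/\ var p.1 p.2,
    forall x, X x -> 0 <= p.1 x &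
    forall B, measurable B -> B `<=` X -> `|\int[m]_(x in B) p.1 x - pr B| <= 2^-1 ^+ j].
  by move=> j; have [f [M hf]] := step_approx (ej0 j); exists (f, M).
pose g j := (st j).1; pose V j := (st j).2.
have vg j : var (g j) (V j) by have [] := hst j.
have g0 j x : X x -> 0 <= g j x by have [_ h _] := hst j; exact: h.
have gP j B : measurable B -> B `<=` X -> `|\int[m]_(x in B) g j x - pr B| <= 2^-1 ^+ j.
  by have [_ _ h] := hst j; exact: h.
have bg j : bm (g j) := var_bm (vg j).
have V0 j : 0 <= V j := var_ge0 (vg j).
have prX : pr X <= 1.
  rewrite -[leRHS]/(fine 1%E) fine_le//; first exact: pr_fin.
  exact: probability_le1.
have gint j : \int[m]_(x in X) `|g j x| <= 2.
  rewrite (@eq_Rintegral _ _ _ m _ (g j)); last first.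
    by move=> x /[1!inE] Xx; rewrite ger0_norm// g0.
  have := gP j X mX (@subset_refl _ _); have := ej1 j.
  by have := ler_norm (\int[m]_(x in X) g j x - pr X); lra.
(* By invariance of [P] the error does not grow when [L] is iterated. *)
have LP j k B : measurable B -> B `<=` X ->
    `|\int[m]_(x in B) iter k L (g j) x - pr B| <= 2^-1 ^+ j.
  move=> mB BX; rewrite iter_transfer_int// -(Pinv_iter k mB BX).
  by apply: gP; [exact: measurable_Xpreimage | move=> x []].
have Lvar j k : var (iter k L (g j)) (V j + 4 * kappa).
  apply: var_weak (lasota_yorke_iter s k (vg j)).
  apply: lerD; first by rewrite ler_piMl.
  have : kappa * \int[m]_(x in X) `|g j x| <= kappa * 2 by rewrite ler_wpM2l.
  by lra.
have diff j j' k k' : (j <= j')%N ->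
    \int[m]_(x in X) `|iter k L (g j) x - iter k' L (g j') x| <= 4 * 2^-1 ^+ j.
  move=> jj'; rewrite (_ : 4 * _ = 2 * (2 * 2^-1 ^+ j)); last by ring.
  apply: L1_le_of_sets; first by apply: bmB; exact: iter_transfer_bm.
  move=> B mB BX; rewrite RintB//; try exact: iter_transfer_bm.
  have := LP j k B mB BX; have := LP j' k' B mB BX.
  have : 2^-1 ^+ j' <= 2^-1 ^+ j :> R.
    by apply: ler_wiXn2l => //; lra.
  rewrite !ler_norml => h1 /andP[h2 h3] /andP[h4 h5].
  by apply/andP; split; lra.
(* At stage [j], differences built from [g j], [g j.+1] and their iterates are considered; the
   bracket bounds their variations, and [N j] iterations make these negligible. *)
have /choice[N hN] : forall j, exists n0, forall n, (n0 <= n)%N ->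
    2^-1 ^+ n * (V j + V j + V j.+1 + 8 * kappa) <= 2^-1 ^+ j.
  by move=> j; exact: half_small.
(* Partial sums make [nn] nondecreasing, so that [f j.+1 - f j] is the image, under [nn j]
   iterations of [L], of a difference that is small in L1. *)
pose nn j : nat := (\sum_(i < j.+1) N i)%N.
have nnN j : (N j <= nn j)%N by rewrite /nn big_ord_recr/= leq_addl.
have nnS j : (nn j <= nn j.+1)%N by rewrite /nn [X in (_ <= X)%N]big_ord_recr/= leq_addr.
pose f j := iter (nn j) L (g j).
(* One unit comes from the choice of [N], and [(2 * kappa + 1) * 4] from the L1 distance
   [4 * 2^-1 ^+ j]. *)
pose C := 8 * kappa + 5.
have C0 : 0 < C by rewrite /C; lra.
have small j k g' M x : var g' M -> M <= V j + V j + V j.+1 + 8 * kappa ->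
    \int[m]_(x in X) `|g' x| <= 4 * 2^-1 ^+ j -> k = nn j -> X x ->
    `|iter k L g' x| <= 2^-1 ^+ j * C.
  move=> vg' MV ig -> Xx; apply: le_trans (iter_transfer_small (nn j) vg' ig Xx) _.
  have := hN j _ (nnN j).
  have : 2^-1 ^+ nn j * M <= 2^-1 ^+ nn j * (V j + V j + V j.+1 + 8 * kappa).
    by rewrite ler_wpM2l// ltW.
  by rewrite /C; lra.
have bf j : bm (f j) by exact: iter_transfer_bm.
have fS j x : X x -> `|f j.+1 x - f j x| <= 2^-1 ^+ j * C.
  move=> Xx; rewrite distrC /f -(subnKC (nnS j)) iterD -iter_transferB//; last first.
    exact: iter_transfer_bm.
  apply: (small j _ _ (V j + (V j.+1 + 4 * kappa))) => //.
  - by apply: varB => //; exact: Lvar.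
  - by have := V0 j; have := k0; lra.
  - exact: (diff j j.+1 0%N).
have fL j x : X x -> `|L (f j) x - f j x| <= 2^-1 ^+ j * C.
  move=> Xx; rewrite /f -iterS iterSr -iter_transferB//; last exact: transfer_bm.
  apply: (small j _ _ (V j + 4 * kappa + V j)) => //.
  - by apply: varB => //; exact: (Lvar j 1%N).
  - by have := V0 j.+1; have := k0; lra.
  - exact: (diff j j 1%N 0%N).
have fvar j : var (fun x => f j.+1 x - f j x) (2^-1 ^+ j * C).
  apply: (@var_eq _ (iter (nn j) L (fun x => iter (nn j.+1 - nn j) L (g j.+1) x - g j x))).
    move=> x Xx; rewrite iter_transferB//; last exact: iter_transfer_bm.
    by rewrite -iter_transfer_addn subnKC.
  have vd : var (fun x => iter (nn j.+1 - nn j) L (g j.+1) x - g j x) (V j.+1 + 4 * kappa + V j).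
    by apply: varB => //; exact: Lvar.
  apply: var_weak (lasota_yorke_iter s (nn j) vd).
  have := hN j _ (nnN j).
  have : 2^-1 ^+ nn j * (V j.+1 + 4 * kappa + V j) <= 2^-1 ^+ nn j * (V j + V j + V j.+1 + 8 * kappa).
    by rewrite ler_wpM2l ?(ltW (ej0 _))//; have := V0 j; lra.
  have : \int[m]_(x in X) `|iter (nn j.+1 - nn j) L (g j.+1) x - g j x| <= 4 * 2^-1 ^+ j.
    rewrite (@eq_Rintegral _ _ _ m _ (fun x => `|iter 0 L (g j) x - iter (nn j.+1 - nn j) L (g j.+1) x|)).
      exact: diff.
    by move=> x _; rewrite distrC.
  move=> h3; have : 2 * kappa * (\int[m]_(x in X) `|iter (nn j.+1 - nn j) L (g j.+1) x - g j x|)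
     <= 2 * kappa * (4 * 2^-1 ^+ j) by rewrite ler_wpM2l// mulr_ge0.
  by have := ej0 j; rewrite /C; lra.
have fdist k j x : X x -> `|f (j + k)%N x - f j x| <= 2^-1 ^+ j * (2 * C) - 2^-1 ^+ (j + k) * (2 * C).
  move=> Xx; elim: k => [|k IH]; first by rewrite addn0 !subrr normr0.
  have := fS (j + k)%N x Xx; have := ler_normD (f (j + k).+1 x - f (j + k)%N x) (f (j + k)%N x - f j x).
  by rewrite addnS addrA subrK exprS; move: IH; lra.
have fcauchy x : X x -> cvgn (f ^~ x).
  move=> Xx; apply: cauchy_cvg; apply/cauchy_exP => /= e e0.
  have e20 : 0 < e / 2 by lra.
  have [j hj] := half_small (2 * C) e20.
  exists (f j x); exists j => // n /= jn.
  rewrite /ball /= distrC -(subnKC jn).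
  have := fdist (n - j)%N j x Xx; have := hj j (leqnn _).
  have : 0 <= 2^-1 ^+ (j + (n - j)) * (2 * C) by rewrite mulr_ge0 ?mulr_ge0// ltW.
  by lra.
pose h x := limn (f ^~ x).
have fh j x : X x -> `|h x - f j x| <= 2^-1 ^+ j * (2 * C).
  move=> Xx; apply: (@lim_le _ (fun k => `|f (j + k)%N x - f j x|)).
    apply: cvg_norm; apply: cvgB; last exact: cvg_cst.
    rewrite (_ : (fun k => _) = (fun k => f (k + j)%N x)).
      by rewrite (cvg_shiftn j (f ^~ x)); exact: fcauchy.
    by apply/funext => k; rewrite addnC.
  move=> k; apply: le_trans (fdist k j x Xx) _.
  by rewrite lerBlDr lerDl mulr_ge0 ?mulr_ge0// ltW.
(* Consecutive [f j] are close in variation and not only uniformly, so their limit has bounded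
   variation. *)
have vh : var (fun x => h x - f 0%N x) (2 * C).
  apply: (var_series fvar).
    move=> n; rewrite -mulr_suml ler_wpM2r ?(ltW C0)//.
    have : forall n, \sum_(i < n) 2^-1 ^+ i = 2 - 2 * 2^-1 ^+ n :> R.
      by elim=> [|k IH]; rewrite ?big_ord0 ?expr0 ?big_ord_recr/= ?IH ?exprS; lra.
    by move=> ->; have := ej0 n; lra.
  move=> x Xx.
  rewrite (_ : (fun n => _) = (fun n => f n x - f 0%N x)).
    by apply: cvgB; [exact: fcauchy | exact: cvg_cst].
  apply/funext => n.
  by rewrite -(big_mkord xpredT (fun i => f i.+1 x - f i x)) GRing.Theory.telescope_sumr.
have vh1 : var h (2 * C + (V 0%N + 4 * kappa)).
  apply: (@var_eq _ (fun x => (h x - f 0%N x) + f 0%N x)).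
    by move=> x _; rewrite subrK.
  by apply: varD => //; exact: Lvar.
have bh := var_bm vh1.
exists h, (2 * C + (V 0%N + 4 * kappa)); split => //.
- move=> x Xx; apply: (lim_ge (fcauchy x Xx)) => n.
  rewrite /f; elim: (nn n) x Xx => [|k IH] x Xx; first exact: g0.
  by apply: transfer_ge0 => //; exact: iter_transfer_bm.
- move=> x Xx; apply/eqP; rewrite -subr_eq0 -normr_eq0 eq_le normr_ge0 andbT.
  apply: (@half_le0 (K * (2 * C) + 3 * C)) => j.
  have h1 : `|L h x - L (f j) x| <= K * (2^-1 ^+ j * (2 * C)).
    rewrite -transferB//; apply: transfer_norm; last by move=> y Xy; exact: fh.
      by rewrite mulr_ge0 ?mulr_ge0// ltW.
    exact: bmB.
  have h2 := fL j x Xx; have h3 := fh j x Xx.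
  have h4 : `|L h x - h x| <= `|L h x - L (f j) x| + `|L (f j) x - f j x| + `|h x - f j x|.
    rewrite (distrC (h x)).
    rewrite (_ : L h x - h x = (L h x - L (f j) x) + (L (f j) x - f j x) + (f j x - h x)); last by ring.
    by rewrite (le_trans (ler_normD _ _))// lerD2r ler_normD.
  by lra.
- move=> B mB BX; apply/eqP; rewrite -subr_eq0 -normr_eq0 eq_le normr_ge0 andbT.
  apply: (@half_le0 (2 * C + 1)) => j.
  have h1 := LP j (nn j) B mB BX.
  have h2 : `|\int[m]_(x in B) h x - \int[m]_(x in B) f j x| <= 2^-1 ^+ j * (2 * C).
    apply: le_trans (Rint_dist bh (bf j) mB BX) _.
    rewrite -[leRHS]Rint_cst; apply: Rint_le => //; first by apply: bm_norm; exact: bmB.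
      exact: bm_cst.
    by move=> x Xx; exact: fh.
  move: h1 h2; rewrite !ler_norml => /andP[a1 a2] /andP[a3 a4].
  by apply/andP; split; rewrite /f in a3 a4; lra.
Qed.

End Density.

(** * The density is bounded below where it does not vanish *)

Record is_invariant_density (R : realType) (s : expanding R)
    (P : probability (measurableTypeR R) R) (h : R -> R) (M : R) : Prop := {
  dens_var : var h M ;
  dens_ge0 : forall x, X x -> 0 <= h x ;
  dens_fix : forall x, X x -> transfer s h x = h x ;
  dens_pr : forall B : set (measurableTypeR R), measurable B -> B `<=` X ->
    fine (P B) = \int[@lebesgue_measure R]_(x in B) h x ;
  dens_inv : forall B : set (measurableTypeR R), measurable B -> B `<=` X ->
    P (Xpreimage (eS s) 1 B) = P B }.

Section LowerBound.
Context {R : realType} (s : expanding R) (P : probability (measurableTypeR R) R).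
Local Notation m := (@lebesgue_measure R).
Local Notation X := (@X R).
Local Notation S := (eS s).
Local Notation u := (eu s).
Local Notation v := (ev s).
Local Notation c := (ec s).
Local Notation d := (ed s).
Local Notation w := (ew s).
Local Notation G := (eG s).
Implicit Types (f g V : R -> R) (x y z p q M N e k a b rho : R)
  (B : set (measurableTypeR R)).
Local Notation pr B := (fine (P B)).

Variables (h : R -> R) (Mh : R).
Hypothesis H : is_invariant_density s P h Mh.
Local Notation hvar := (dens_var H).
Local Notation h0 := (dens_ge0 H).
Local Notation hfix := (dens_fix H).
Local Notation hP := (dens_pr H).
Local Notation Pinv := (dens_inv H).

(** At [y], the equation [L h = h] writes [h] as a sum of nonnegative terms. Thus lower bounds of
    [h] travel forward along a branch, and small values of [h] travel backward. *)
Lemma branch_term_le i y : c i < y < d i -> G i y * h (w i y) <= h y.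
Proof.
move=> hy; have Xy := image_X hy; rewrite -(hfix Xy).
have bh := var_bm hvar.
have t0 j : 0 <= G j y * h (w j y).
  have [hj|hj] := boolP (c j < y < d j); last by rewrite eG0// mul0r.
  by rewrite mulr_ge0 ?G_ge0// h0//; apply: (@branch_X _ s j); exact: ew_in.
apply: (@lim_ge _ (fun n => partial_transfer s h (n + i.+1) y)).
  by rewrite (cvg_shiftn i.+1 (fun n => partial_transfer s h n y)); exact: transfer_cvg.
move=> n; have lt : (i < n + i.+1)%N by rewrite addnS ltnS leq_addl.
rewrite /partial_transfer (bigD1 (Ordinal lt))//= lerDl.
by apply: sumr_ge0.
Qed.

Lemma ew_half i y z : c i < y < d i -> c i < z < d i ->
  `|w i y - w i z| <= 2^-1 * `|y - z|.
Proof.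
move=> hy hz; apply: le_trans (ew_contr hy hz) _.
rewrite ler_wpM2r// lef_pV2 ?posrE ?lam_gt0//.
by have := elamA s; have := eA0 s; lra.
Qed.

Definition bounded_below_on a b :=
  exists2 k, 0 < k & forall y, a < y < b -> k <= h y.

Definition pos_set : set R := [set x | exists a b,
  [/\ 0 <= a, b <= 1, a < x < b & bounded_below_on a b]].

Local Notation U := pos_set.

Lemma pos_set_itv x : U x -> exists a b,
  [/\ 0 <= a, b <= 1, a < x < b, bounded_below_on a b & forall y, a < y < b -> U y].
Proof.
move=> [a [b [a0 b1 axb hab]]]; exists a, b; split => // y ayb.
by exists a, b.
Qed.

Lemma pos_set_X x : U x -> X x.
Proof.
move=> [a [b [a0 b1 /andP[ax xb] _]]]; apply/inX.
by rewrite (le_trans a0 (ltW ax)) (le_trans (ltW xb) b1).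
Qed.

Lemma pos_set_unit x : U x -> 0 < x < 1.
Proof.
move=> [a [b [a0 b1 /andP[ax xb] _]]].
by rewrite (le_lt_trans a0 ax) (lt_le_trans xb b1).
Qed.

Lemma open_pos_set : open U.
Proof.
have -> : U = \bigcup_(ab in [set ab : R * R | [/\ 0 <= ab.1, ab.2 <= 1 &
    bounded_below_on ab.1 ab.2]]) `]ab.1, ab.2[%classic.
  apply/seteqP; split => x.
    by move=> [a [b [a0 b1 axb hab]]]; exists (a, b) => //=; rewrite in_itv.
  by move=> [[a b] /= [a0 b1 hab]]; rewrite in_itv/= => axb; exists a, b.
by apply: bigcup_open => i _; exact: interval_open.
Qed.

(** A lower bound of [h] near [x] passes to a neighbourhood of [S x] by [branch_term_le], as [G i]
    is bounded below on the image of the branch. *)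
Lemma pos_set_image i x : u i < x < v i -> U x -> U (S x).
Proof.
move=> hx [a [b [a0 b1 /andP[ax xb] [k k0 hk]]]].
have hS := eS_in hx; have /andP[cS Sd] := hS.
have [c0 cd d1] := ecd s i.
pose e := Num.min (x - a) (b - x).
have e0 : 0 < e by rewrite /e lt_min !subr_gt0 ax xb.
have ea : e <= x - a by rewrite /e ge_min lexx.
have eb : e <= b - x by rewrite /e ge_min lexx orbT.
have [K K0 hK] := eG_low s i.
exists (Num.max (c i) (S x - e)), (Num.min (d i) (S x + e)); split.
- by rewrite le_max c0.
- by rewrite ge_min d1.
- by rewrite gt_max lt_min cS Sd/=; apply/andP; split; lra.
exists (K * k); first exact: mulr_gt0.
move=> y; rewrite gt_max lt_min => /andP[/andP[cy Sy] /andP[yd yS]].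
have hy : c i < y < d i by rewrite cy yd.
apply: le_trans (branch_term_le hy); apply: ler_pM; rewrite ?(ltW K0) ?(ltW k0)//.
  exact: hK.
apply: hk.
have : `|w i y - x| < e.
  rewrite -{1}(ewS hx); apply: le_lt_trans (ew_half hy hS) _.
  have : `|y - S x| < e by rewrite ltr_norml; apply/andP; split; lra.
  by have := normr_ge0 (y - S x); lra.
by rewrite ltr_norml => /andP[h1 h2]; apply/andP; split; lra.
Qed.

Lemma dominates_near V f l r e x y : dominates V f -> 0 <= x - r -> x + r <= 1 -> 0 < r ->
  (forall z, x - r < z -> z < x -> `|l - V z| < e) ->
  (forall z, x < z -> z < x + r -> `|l - V z| < e) ->
  x - r < y < x + r -> `|f x - f y| <= 2 * e.
Proof.
move=> dV x0 x1 r0 hl hr /andP[y1 y2].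
have [yx|xy|->] := ltgtP y x; last first.
- have := hl (x - r / 2); rewrite subrr normr0 => /(_ ltac:(lra) ltac:(lra)).
  by move=> /(le_lt_trans (normr_ge0 _)); lra.
- have := hr y xy y2; have := hl (x - r / 2); rewrite !ltr_norml.
  move=> /(_ ltac:(lra) ltac:(lra)) /andP[? ?] /andP[? ?].
  have := dV x y; move=> /(_ ltac:(lra) ltac:(lra) ltac:(lra)).
  have : V (x - r / 2) <= V x by apply: (dominates_le dV); lra.
  by rewrite distrC; lra.
- have := hl y y1 yx; have := hr (x + r / 2); rewrite !ltr_norml.
  move=> /(_ ltac:(lra) ltac:(lra)) /andP[? ?] /andP[? ?].
  have := dV y x; move=> /(_ ltac:(lra) ltac:(lra) ltac:(lra)).
  have : V x <= V (x + r / 2) by apply: (dominates_le dV); lra.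
  by lra.
Qed.

(** The exceptional points are 0, 1 and the discontinuities of the monotone function [V], which are
    countably many. Where [V] is continuous, so is [h], and there [h x > 0] puts [x] into [U]. *)
Lemma outside_pos_set_null : exists N0 : set (measurableTypeR R),
  [/\ measurable N0, m N0 = 0%E & forall x, X x -> ~ U x -> ~ N0 x -> h x = 0].
Proof.
have [V dV _] := hvar.
have ndV : {in `[0, 1] &, {homo V : x y / x <= y}}.
  move=> x y; rewrite !in_itv/= => /andP[x0 _] /andP[_ y1] xy.
  exact: (dominates_le dV).
pose D := [set x : R | x \in (`]0, 1[ : interval R) /\ discontinuity V x].
have cD : countable D := discontinuity_countable ndV.
pose N0 := D `|` [set 0; 1] : set R.
have c2 : countable ([set 0; 1] : set R).
  by apply: finite_set_countable; exact: finite_set2.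
exists N0; split.
- by apply: measurableU; exact: countable_measurable.
- apply/eqP; rewrite -measure_le0.
  apply: le_trans (measureU2 _ _ _) _; try exact: countable_measurable.
  rewrite -[leRHS]adde0; apply: leeD.
    by rewrite -[leRHS](countable_lebesgue_measure0 cD).
  by rewrite -[leRHS](countable_lebesgue_measure0 c2).
move=> x Xx nUx nN; apply/eqP; rewrite eq_le h0// andbT leNgt; apply/negP => hx0.
apply: nUx; move/inX : Xx => /andP[x0 x1].
have {}x0 : 0 < x.
  by rewrite lt_neqAle x0 andbT eq_sym; apply/eqP => xe; apply: nN; right; left.
have {}x1 : x < 1.
  by rewrite lt_neqAle x1 andbT; apply/eqP => xe; apply: nN; right; right.
have cl : cvg (V y @[y --> x^'-]).
  apply: nondecreasing_at_left_is_cvgr.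
    near=> y => a b; rewrite !in_itv/= => /andP[ya ax] /andP[yb bx] ab.
    have y0 : 0 < y by near: y; exact: nbhs_left_gt.
    by apply: (dominates_le dV) => //; lra.
  near=> y; exists (V x) => _ [z /= + <-]; rewrite in_itv/= => /andP[yz zx].
  have y0 : 0 < y by near: y; exact: nbhs_left_gt.
  by apply: (dominates_le dV) => //; lra.
have cr : cvg (V y @[y --> x^'+]).
  apply: nondecreasing_at_right_is_cvgr.
    near=> y => a b; rewrite !in_itv/= => /andP[ya ax] /andP[yb bx] ab.
    have y0 : y < 1 by near: y; exact: nbhs_right_lt.
    by apply: (dominates_le dV) => //; lra.
  near=> y; exists (V x) => _ [z /= + <-]; rewrite in_itv/= => /andP[yz zx].
  have y0 : y < 1 by near: y; exact: nbhs_right_lt.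
  by apply: (dominates_le dV) => //; lra.
have lr : lim (V y @[y --> x^'-]) = lim (V y @[y --> x^'+]).
  apply/eqP; apply/negPn/negP => ne; apply: nN; left; split => //.
  by rewrite in_itv/= x0 x1.
have e0 : 0 < h x / 8 by lra.
move: cl; rewrite /= => /cvgrPdist_lt /(_ (h x / 8) e0) [r1 /= r10 hr1].
move: cr; rewrite /= => /cvgrPdist_lt /(_ (h x / 8) e0) [r2 /= r20 hr2].
rewrite -lr in hr2; set l := lim _ in hr1 hr2.
pose r := Num.min (Num.min r1 r2) (Num.min x (1 - x)).
have r0 : 0 < r by rewrite /r !lt_min r10 r20 x0 subr_gt0.
have rr1 : r <= r1 by rewrite /r !ge_min lexx.
have rr2 : r <= r2 by rewrite /r !ge_min lexx orbT.
have rx : r <= x by rewrite /r !ge_min lexx !orbT.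
have rx1 : r <= 1 - x by rewrite /r !ge_min lexx !orbT.
have near_l y : x - r < y -> y < x -> `|l - V y| < h x / 8.
  by move=> ry yx; apply: hr1 => //=; rewrite /ball_/= gtr0_norm; lra.
have near_r y : x < y -> y < x + r -> `|l - V y| < h x / 8.
  by move=> ry yx; apply: hr2 => //=; rewrite /ball_/= ltr0_norm; lra.
have xr0 : 0 <= x - r by rewrite subr_ge0.
have xr1 : x + r <= 1 by rewrite addrC -lerBrDr.
exists (x - r), (x + r); split => //; first by rewrite gtrBl ltrDl r0.
exists (h x / 2); first by rewrite divr_gt0.
move=> y hy; have := dominates_near dV xr0 xr1 r0 near_l near_r hy.
by move/(le_trans (ler_norm _)); move: hx0; set a := h x; set b := h y; lra.
Unshelve. all: by end_near. Qed.

Lemma measurable_pos_set : measurable (U : set (measurableTypeR R)).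
Proof. by apply: open_measurable; exact: open_pos_set. Qed.

Lemma outside_pos_set_pr : P (X `&` ~` U) = 0%E.
Proof.
have mX := @measurable_X R.
have mB : measurable (X `&` ~` U : set (measurableTypeR R)).
  by apply: measurableI => //; apply: measurableC; exact: measurable_pos_set.
rewrite -(fineK (pr_fin P mB)) hP//.
have [N0 [mN N00 hN]] := outside_pos_set_null.
have bh := var_bm hvar.
rewrite (@Rint_ae _ _ (fun=> 0) _ N0 bh (bm_cst 0) mB)//.
- by rewrite Rintegral_cst// mul0r.
- by move=> x [Xx Ux] nx; exact: hN.
Qed.

Lemma pos_set_itv_pr a b x B : measurable B -> B `<=` U -> a < x < b ->
  (forall y, a < y < b -> B y) -> P B <> 0%E.
Proof.
move=> mB BU axb abB P0.
have [a1 [b1 [a10 b11 /andP[a1x xb1] [k k0 hk] _]]] := pos_set_itv (BU _ (abB _ axb)).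
move/andP : axb => [ax xb].
pose a2 := Num.max a a1; pose b2 := Num.min b b1.
have a2b2 : a2 < b2 by rewrite /a2 /b2 !gt_max !lt_min ?ax ?xb ?a1x ?xb1 (lt_trans ax xb) (lt_trans ax xb1) (lt_trans a1x xb) (lt_trans a1x xb1).
pose I : set (measurableTypeR R) := [set` `]a2, b2[].
have IB : I `<=` B.
  move=> y; rewrite /I /= in_itv/= gt_max lt_min => /andP[/andP[ay _] /andP[yb _]].
  by apply: abB; rewrite ay yb.
have BX : B `<=` X by move=> y /BU; exact: pos_set_X.
have bh := var_bm hvar.
have mI : measurable I by exact: measurable_itv.
have : k * (b2 - a2) <= pr B.
  rewrite hP//; apply: le_trans (Rint_subset bh h0 mI mB IB BX).
  apply: (@le_trans _ _ (\int[m]_(y in I) k)).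
    rewrite (_ : Rintegral _ _ _ = k * fine (m I)); last exact: Rintegral_cst.
    by rewrite lebesgue_measure_itv /= lte_fin a2b2.
  apply: Rint_le => //; [exact: bm_cst|exact: subset_trans BX|].
  move=> y; rewrite /I /= in_itv/= gt_max lt_min => /andP[/andP[_ ay] /andP[_ yb]].
  by apply: hk; rewrite ay yb.
rewrite P0 /= leNgt => /negP; apply; apply: mulr_gt0 => //.
by rewrite subr_gt0.
Qed.

(* By invariance P (F 0) <= P (F n), which tends to 0, while nonempty open
   subsets of U have positive measure. *)
Lemma shrink_empty (F : nat -> set R) : (forall n, open (F n)) ->
  (forall n, F n `<=` U) -> (forall n, F n.+1 `<=` F n) ->
  (forall x, ~ (forall n, F n x)) ->
  (forall n i x, u i < x < v i -> U x -> F n (S x) -> F n.+1 x) ->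
  forall x, ~ F 0%N x.
Proof.
move=> oF FU Fd F0 FS x Fx.
have mF n : measurable (F n : set (measurableTypeR R)) by exact: open_measurable.
have FX n : F n `<=` X by move=> y /FU; exact: pos_set_X.
have mX := @measurable_X R.
pose N1 : set (measurableTypeR R) := X `\` [set x | exists i, u i < x < v i].
have mN1 : measurable N1.
  apply: measurableD => //.
  rewrite (_ : [set x | _] = \bigcup_i branch s i); last first.
    by apply/seteqP; split => y [i]; [exists i | move=> _; exists i].
  by apply: bigcup_measurable => i _; exact: measurable_branch.
have PN1 : P N1 = 0%E.
  rewrite -(fineK (pr_fin P mN1)) hP//; last by move=> y [].
  rewrite (@Rint_ae _ _ (fun=> 0) _ N1 (var_bm hvar) (bm_cst 0) mN1)//.
  - by rewrite Rintegral_cst// mul0r.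
  - by move=> y [].
  - exact: ecover.
have mU : measurable (X `&` ~` U : set (measurableTypeR R)).
  by apply: measurableI => //; apply: measurableC; exact: measurable_pos_set.
(* Up to the null sets of points in no branch or outside [U], the preimage of [F n] lies in
   [F n.+1]. *)
have PFS n : (P (F n) <= P (F n.+1))%E.
  rewrite -(Pinv (mF n) (FX n)).
  apply: (@le_trans _ _ (P (F n.+1 `|` (N1 `|` (X `&` ~` U))))).
    apply: le_measure; rewrite ?inE.
    - by apply: measurable_Xpreimage; exact: mF.
    - by apply: measurableU => //; exact: measurableU.
    move=> y [Xy Fy].
    have [Uy|] := pselect (U y); last by right; right; split.
    have [[i hi]|ni] := pselect (exists i, u i < y < v i); last by right; left; split.
    by left; exact: FS hi Uy Fy.
  apply: le_trans (measureU2 _ _ _) _ => //; first exact: measurableU.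
  rewrite -[leRHS]adde0; apply: leeD => //.
  apply: le_trans (measureU2 _ _ _) _ => //.
  by rewrite [X in (_ + X)%E]outside_pos_set_pr adde0 -[leRHS]PN1.
have PF n : (P (F 0%N) <= P (F n))%E.
  by elim: n => // n IH; exact: le_trans IH (PFS n).
have PF0 : P (F 0%N) = 0%E.
  apply/eqP; rewrite -measure_le0.
  have e0 : \bigcap_n F n = set0.
    by apply/seteqP; split => // y Fy; apply: (F0 y) => n; exact: Fy.
  have nF : nonincreasing_seq F.
    by apply/nonincreasing_seqP => n; apply/subsetPset; exact: Fd.
  have cF := @nonincreasing_cvg_mu _ _ _ P F.
  rewrite e0 measure0 in cF.
  have P0 : (P (F 0%N) < +oo)%E.
    by rewrite (le_lt_trans (probability_le1 P (mF 0%N)))// ltry.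
  have {}cF := cF P0 mF measurable0 nF.
  rewrite -(cvg_lim _ cF)//; apply: lime_ge; first exact: cvgP cF.
  by apply: nearW => n; exact: PF.
have : open_nbhs x (F 0%N) by split.
move=> /open_nbhs_nbhs [r /= r0 hr].
apply: (@pos_set_itv_pr (x - r) (x + r) x (F 0%N)) => //.
  by apply/andP; split; lra.
by move=> y /andP[y1 y2]; apply: hr; rewrite /ball_/= ltr_norml; apply/andP; split; lra.
Unshelve. all: by end_near. Qed.

End LowerBound.

Lemma uniform_radius (R : realType) (E : seq R) (Q : R -> R -> Prop) :
  (forall e r r', r' <= r -> Q e r -> Q e r') ->
  (forall e, e \in E -> exists2 r, 0 < r & Q e r) ->
  exists2 r, 0 < r & forall e, e \in E -> Q e r.
Proof.
move=> Qd; elim: E => [|e E IH] hE; first by exists 1.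
have [r1 r10 h1] : exists2 r, 0 < r & forall e, e \in E -> Q e r.
  by apply: IH => e' he'; apply: hE; rewrite in_cons he' orbT.
have [r2 r20 h2] := hE e (mem_head _ _).
exists (Num.min r1 r2); first by rewrite lt_min r10 r20.
move=> e'; rewrite in_cons => /predU1P[->|he'].
  by apply: Qd h2; rewrite ge_min lexx orbT.
by apply: Qd (h1 _ he'); rewrite ge_min lexx.
Qed.

(** A cell of length less than [r] contains at most one point of [A], so one representative for each
    cell is enough. *)
Lemma separated_finite (R : realType) (A : set R) (r : R) : 0 < r ->
  (forall p, A p -> 0 <= p <= 1) ->
  (forall p q, A p -> A q -> p < q -> r <= q - p) ->
  exists D : seq R, forall p, A p -> p \in D.
Proof.
move=> r0 A01 Asep.
have [n0 _ hn0] : \forall n \near \oo, n.+1%:R^-1 < r by exact: near_infty_natSinv_lt (PosNum r0).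
have Nr := hn0 n0 (leqnn _); rewrite /= in Nr; set N := n0.+1 in Nr.
have N0 : 0 < N%:R :> R by rewrite ltr0n.
exists [seq xget 0 [set p | A p /\ cell N p = j] | j <- iota 0 N.+1] => p Ap.
apply/mapP; exists (cell N p).
  by rewrite mem_iota add0n ltnS cell_le//; apply/inX; exact: A01.
case: xgetP => [q _ [Aq e]|/(_ p)]; last by case.
have close x y : A x -> A y -> cell N x = cell N y -> x < y -> False.
  move=> Ax Ay exy xy; have := Asep _ _ Ax Ay xy.
  have /andP[x1 _] := cell_itv N (iffRL (inX x) (A01 _ Ax)).
  have /andP[_ y2] := cell_itv N (iffRL (inX y) (A01 _ Ay)).
  move=> h; have : N%:R * (y - x) < 1.
    by rewrite mulrBr; move: x1 y2; rewrite exy -natr1; lra.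
  rewrite mulrC -ltr_pdivlMr// div1r => h'.
  by have := le_lt_trans h (lt_trans h' Nr); rewrite ltxx.
by case: (ltgtP p q) => // pq; exfalso; [apply: (close p q) | apply: (close q p)].
Qed.

Lemma half_lt (R : realType) (r e : R) : 0 < e -> exists k : nat, 2^-1 ^+ k * r < e.
Proof.
move=> e0; have e20 : 0 < e / 2 by lra.
have [k hk] := half_small r e20.
by exists k; apply: le_lt_trans (hk k (leqnn _)) _; lra.
Qed.

(** * Components of the positivity set have a minimal length *)

Section Gaps.
Context {R : realType} (s : expanding R) (P : probability (measurableTypeR R) R).
Variables (h : R -> R) (Mh : R).
Hypothesis H : is_invariant_density s P h Mh.
Local Notation S := (eS s).
Local Notation c := (ec s).
Local Notation d := (ed s).
Local Notation w := (ew s).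
Local Notation U := (pos_set h).
Implicit Types (x y z p q e k a b rho sg : R).

(** The points in components of [U] shorter than [rho], in a form that can be pulled back: two
    enclosing points outside [U] are required, not the ends of the component. *)
Let enclosed rho : set R := U `&`
  \bigcup_(pq in [set pq : R * R | [/\ ~ U pq.1, ~ U pq.2 & pq.2 - pq.1 < rho]])
    `]pq.1, pq.2[%classic.

Let open_enclosed rho : open (enclosed rho).
Proof.
apply: openI; first exact: open_pos_set.
by apply: bigcup_open => i _; exact: interval_open.
Qed.

(** If [S y] is enclosed at a small scale, the enclosing points can be taken in the image of the
    branch of [y], and the inverse branch carries them to points enclosing [y] at no more than half
    the distance. So [shrink_empty] applies to the sets [enclosed]. The radius [r] is dictated by
    the finitely many ends of branch images: if [U] contains some one-sided neighbourhood of such an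
    end, then it contains the one of radius [r]. *)
Lemma gaps : exists2 r, 0 < r & forall x p q, U x -> ~ U p -> ~ U q ->
  p < x < q -> r <= q - p.
Proof.
have [E hE] := eends s.
have [r1 r10 hr1] : exists2 r, 0 < r & forall e, e \in E ->
    (exists2 t, 0 < t & forall y, e < y < e + t -> U y) ->
    forall y, e < y < e + r -> U y.
  apply: uniform_radius.
    move=> e r r' rr' hr ht y /andP[y1 y2]; apply: hr => //.
    by rewrite y1/= (lt_le_trans y2)// lerD2l.
  move=> e _; have [[t t0 ht]|nt] := pselect (exists2 t, 0 < t & forall y, e < y < e + t -> U y).
    by exists t.
  by exists 1 => // ht.
have [r2 r20 hr2] : exists2 r, 0 < r & forall e, e \in E ->
    (exists2 t, 0 < t & forall y, e - t < y < e -> U y) ->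
    forall y, e - r < y < e -> U y.
  apply: uniform_radius.
    move=> e r r' rr' hr ht y /andP[y1 y2]; apply: hr => //.
    by rewrite y2 andbT (le_lt_trans _ y1)// lerD2l lerN2.
  move=> e _; have [[t t0 ht]|nt] := pselect (exists2 t, 0 < t & forall y, e - t < y < e -> U y).
    by exists t.
  by exists 1 => // ht.
pose r := Num.min r1 r2.
have r0 : 0 < r by rewrite lt_min r10 r20.
have rr1 : r <= r1 by rewrite ge_min lexx.
have rr2 : r <= r2 by rewrite ge_min lexx orbT.
exists r => // x p q Ux Up Uq pxq; rewrite leNgt; apply/negP => qp.
pose F n := enclosed (2^-1 ^+ n * r).
apply: (@shrink_empty _ s P h Mh H F _ _ _ _ _ x).
- by move=> n; exact: open_enclosed.
- by move=> n y [].
- move=> n y [Uy [[p1 q1] /= [Up1 Uq1 h1] h2]]; split => //.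
  exists (p1, q1) => //=; split => //; apply: lt_trans h1 _.
  by rewrite exprS -mulrA; have : 0 < 2^-1 ^+ n * r by [rewrite mulr_gt0// exprn_gt0// invr_gt0]; lra.
- move=> y Fy; have [Uy _] := Fy 0%N.
  have [a [b [_ _ /andP[ay yb] _ abU]]] := pos_set_itv Uy.
  have [k hk] : exists k : nat, 2^-1 ^+ k * r < b - a by apply: half_lt; lra.
  have [_ [[p1 q1] /= [Up1 Uq1 h1]]] := Fy k.
  rewrite in_itv/= => /andP[py yq].
  have pa : p1 <= a.
    by rewrite leNgt; apply/negP => ap; apply: Up1; apply: abU; rewrite ap (lt_trans py yb).
  have bq : b <= q1.
    by rewrite leNgt; apply/negP => qb; apply: Uq1; apply: abU; rewrite qb (lt_trans ay yq).
  by lra.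
- move=> n i y hy Uy [USy [[p1 q1] /= [Up1 Uq1 h1]]].
  rewrite in_itv/= => /andP[pS Sq]; split => //.
  have hS := eS_in hy; have /andP[cS Sd] := hS.
  have [cE dE] := hE i.
  have n1 : 2^-1 ^+ n * r <= r.
    by rewrite ler_piMl ?(ltW r0)// exprn_ile1//; lra.
  (* If [p1] is not beyond [c i], a point outside [U] exists between [c i] and [S y]: otherwise [U]
     would contain the right neighbourhood of [c i] of radius [r1], and with it [q1]. *)
  have [p2 [Up2 pp2 cp2 p2S]] : exists p2, [/\ ~ U p2, p1 <= p2, c i < p2 & p2 < S y].
    have [cp|pc] := ltP (c i) p1; first by exists p1.
    have [ht|nt] := pselect (exists2 t, 0 < t & forall y, c i < y < c i + t -> U y).
      exfalso; apply: Uq1; apply: (hr1 _ cE ht); apply/andP; split; first exact: lt_trans Sq.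
      lra.
    have Sc : 0 < S y - c i by lra.
    apply: contrapT => hn; apply: nt; exists (S y - c i) => // z /andP[cz zS].
    apply: contrapT => Uz; apply: hn; exists z; split => //; lra.
  have [q2 [Uq2 qq2 q2d Sq2]] : exists q2, [/\ ~ U q2, q2 <= q1, q2 < d i & S y < q2].
    have [qd|dq] := ltP q1 (d i); first by exists q1.
    have [ht|nt] := pselect (exists2 t, 0 < t & forall y, d i - t < y < d i -> U y).
      exfalso; apply: Up1; apply: (hr2 _ dE ht); apply/andP; split; last exact: lt_trans Sd.
      lra.
    have Sc : 0 < d i - S y by lra.
    apply: contrapT => hn; apply: nt; exists (d i - S y) => // z /andP[cz zS].
    apply: contrapT => Uz; apply: hn; exists z; split => //; lra.
  have p2J : c i < p2 < d i by rewrite cp2 (lt_trans p2S Sd).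
  have q2J : c i < q2 < d i by rewrite q2d andbT (lt_trans cS Sq2).
  have Uw z : c i < z < d i -> ~ U z -> ~ U (w i z).
    by move=> hz Uz Uwz; apply: Uz; rewrite -(eSw hz); apply: (pos_set_image H (ew_in hz)).
  have := ew_half p2J q2J; rewrite (ler0_norm (x := p2 - q2)); last by lra.
  have small : 2^-1 * - (p2 - q2) < 2^-1 ^+ n.+1 * r by rewrite exprS -mulrA; lra.
  rewrite ler_norml => /andP[k1 k2].
  case: (emono s i) => mono.
    have m1 := mono _ _ cp2 p2S Sd; have m2 := mono _ _ cS Sq2 q2d.
    rewrite ewS// in m1 m2.
    exists (w i p2, w i q2) => /=; last by rewrite in_itv/= m1 m2.
    by split; [exact: Uw | exact: Uw | lra].
  have m1 := mono _ _ cp2 p2S Sd; have m2 := mono _ _ cS Sq2 q2d.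
  rewrite ewS// in m1 m2.
  exists (w i q2, w i p2) => /=; last by rewrite in_itv/= m1 m2.
  by split; [exact: Uw | exact: Uw | lra].
- split => //; exists (p, q) => /=; last by rewrite in_itv.
  by split => //; rewrite expr0 mul1r.
Qed.

(* sg is the side of p on which U and h are considered. *)
Definition is_sign sg := sg = 1 \/ sg = -1.

Definition is_end p sg := ~ U p /\
  exists2 t, 0 < t & forall r, 0 < r < t -> U (p + sg * r).

(** Between two ends of the same side there are points of [U], which these ends enclose; by [gaps]
    the two are at distance at least [r]. *)
Lemma ends_finite : exists D : seq R, forall p sg, is_sign sg -> is_end p sg -> p \in D.
Proof.
have [r r0 hr] := gaps.
have e01 p sg : is_sign sg -> is_end p sg -> 0 <= p <= 1.
  move=> hsg [Up [t t0 ht]]; apply/negPn/negP => np.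
  pose k := Num.min (t / 2) (Num.max (- p) (p - 1)).
  have k1 : 0 < k.
    by rewrite lt_min lt_max divr_gt0//=; move: np; rewrite negb_and -!ltNge oppr_gt0 subr_gt0.
  have k2 : k < t by rewrite gt_min; apply/orP; left; lra.
  have k3 : k <= - p \/ k <= p - 1.
    by rewrite /k; case: (leP (- p) (p - 1)) => _; [right|left]; rewrite ge_min lexx orbT.
  have hk : 0 < k < t by rewrite k1.
  have /pos_set_unit/andP[] := ht k hk.
  have hk2 : 0 < k / 2 < t by apply/andP; split; lra.
  have /pos_set_unit/andP[] := ht (k / 2) hk2.
  by case: hsg => ->; case: k3 => k3; lra.
have [D1 h1] : exists D : seq R, forall p, is_end p 1 -> p \in D.
  apply: (separated_finite r0); first by move=> p; apply: e01; left.
  move=> p q [Up [t t0 ht]] [Uq _] pq.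
  pose k := Num.min (t / 2) ((q - p) / 2).
  have k0 : 0 < k by rewrite lt_min; apply/andP; split; lra.
  have k1 : k <= t / 2 by rewrite ge_min lexx.
  have k2 : k <= (q - p) / 2 by rewrite ge_min lexx orbT.
  apply: (hr (p + 1 * k)) => //; last by apply/andP; split; lra.
  by apply: ht; apply/andP; split; lra.
have [D2 h2] : exists D : seq R, forall p, is_end p (-1) -> p \in D.
  apply: (separated_finite r0); first by move=> p; apply: e01; right.
  move=> p q [Up _] [Uq [t t0 ht]] pq.
  pose k := Num.min (t / 2) ((q - p) / 2).
  have k0 : 0 < k by rewrite lt_min; apply/andP; split; lra.
  have k1 : k <= t / 2 by rewrite ge_min lexx.
  have k2 : k <= (q - p) / 2 by rewrite ge_min lexx orbT.
  apply: (hr (q + -1 * k)) => //; last by apply/andP; split; lra.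
  by apply: ht; apply/andP; split; lra.
exists (D1 ++ D2) => p sg [->|->] hp; rewrite mem_cat; first by rewrite h1.
by rewrite h2// orbT.
Qed.

Definition vanishes p sg := forall t k, 0 < t -> 0 < k ->
  exists2 r, 0 < r < t & h (p + sg * r) < k.

Lemma vanishes_outside p sg : is_sign sg -> vanishes p sg -> ~ U p.
Proof.
move=> hsg hz [a [b [_ _ /andP[ap pb] [k k0 hk]]]].
have t0 : 0 < Num.min (p - a) (b - p) by rewrite lt_min !subr_gt0 ap pb.
have [r /andP[r0 rt]] := hz _ k t0 k0.
have {}rt : r < p - a /\ r < b - p by move: rt; rewrite lt_min => /andP.
rewrite ltNge => /negP; apply; apply: hk.
by case: hsg => ->; case: rt => *; apply/andP; split; lra.
Qed.

End Gaps.

(** * The density does not approach 0 at an end of its positivity set *)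

Section Germs.
Context {R : realType} (s : expanding R) (P : probability (measurableTypeR R) R).
Variables (h : R -> R) (Mh : R).
Hypothesis H : is_invariant_density s P h Mh.
Local Notation S := (eS s).
Local Notation u := (eu s).
Local Notation v := (ev s).
Local Notation c := (ec s).
Local Notation d := (ed s).
Local Notation w := (ew s).
Local Notation U := (pos_set h).
Implicit Types (x y z p q e k a b rho sg : R).

(* Points of U close to an end p of U at which h has infimum 0.  Such an end is
   pulled back by every branch to an end of the same kind, at half the distance. *)
Let bad rho : set R := [set x | exists p sg t0,
  [/\ is_sign sg, t0 <= rho, forall r, 0 < r < t0 -> U (p + sg * r),
      vanishes h p sg & exists2 t, 0 < t < t0 & x = p + sg * t]].

Let signK sg x : is_sign sg -> sg * (sg * x) = x.
Proof. by case=> ->; rewrite ?mul1r// !mulN1r opprK. Qed.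

Let sign_norm sg x : is_sign sg -> `|sg * x| = `|x|.
Proof. by case=> ->; rewrite ?mul1r// mulN1r normrN. Qed.

Let sign_between sg a b y z q : is_sign sg -> a < y < b -> a < z < b ->
  sg * y < sg * q -> sg * q < sg * z -> a < q < b.
Proof. by case=> -> /andP[? ?] /andP[? ?] *; apply/andP; split; lra. Qed.

Let sign_close sg p r t t0 q : is_sign sg -> 0 < r -> t < t0 ->
  sg * (p + sg * r) < sg * q -> sg * q < sg * (p + sg * t) -> 0 < sg * (q - p) < t0.
Proof. by case=> -> *; apply/andP; split; lra. Qed.

Let sign_ball sg a b y r e : is_sign sg -> 0 <= r -> r < e -> e <= y - a -> e <= b - y ->
  a < y + sg * r < b.
Proof. by case=> -> *; apply/andP; split; lra. Qed.

Let sign_shift sg p t r x : x = p + sg * t -> p + sg * r = x + sg * (r - t).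
Proof. by move=> ->; ring. Qed.

Let sign_end sg p r t t0 q : is_sign sg -> 0 < r < t0 -> 0 < t < t0 ->
  (q < p + sg * t /\ p + sg * r <= q) \/ (p + sg * t < q /\ q <= p + sg * r) ->
  `|q - p| < t0 /\ q != p.
Proof.
move=> hs /andP[? ?] /andP[? ?] hq; split.
  by case: hs hq => -> [] [? ?]; rewrite ltr_norml; apply/andP; split; lra.
by apply/eqP => e; case: hs hq => -> [] [? ?]; lra.
Qed.

Let open_bad rho : open (bad rho).
Proof.
rewrite openE => x [p [sg [t0 [hs tr hU hv [t /andP[t1 t2] xE]]]]].
exists (Num.min t (t0 - t)) => /=; first by rewrite lt_min t1 subr_gt0.
move=> y; rewrite /= lt_min => /andP[y1 y2].
exists p, sg, t0; split => //; exists (sg * (y - p)); last by rewrite signK//; lra.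
have e : sg * (y - p) = t - sg * (x - y).
  by rewrite xE; case: hs => ->; lra.
rewrite -(sign_norm (x - y) hs) in y1 y2; rewrite e.
by move: y1 y2; rewrite !ltr_norml => /andP[? ?] /andP[? ?]; apply/andP; split; lra.
Qed.

Let bad_pos rho x : bad rho x -> U x.
Proof. by move=> [p [sg [t0 [hs tr hU hv [t tt xE]]]]]; rewrite xE; exact: hU. Qed.

(** In the orientation given by [sg], the end is the supremum of the points outside [U] between [y]
    and [x']; it is itself outside [U] because [U] is open. *)
Let last_outside sg y x' : is_sign sg -> ~ U y -> U x' -> sg * y < sg * x' ->
  exists r, [/\ is_end h r sg, sg * y <= sg * r & sg * r < sg * x'].
Proof.
move=> hs Uy Ux' yx.
pose A : set R := [set z | [/\ ~ U (sg * z), sg * y <= z & z <= sg * x']].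
have Ay : A (sg * y) by split => //; [rewrite signK | exact: ltW].
have hA : has_sup A by split; [exists (sg * y) | exists (sg * x') => z []].
pose r0 := sup A.
have yr : sg * y <= r0 by apply: sup_upper_bound hA _ _.
have rx : r0 <= sg * x' by apply: sup_le_ub; [exists (sg * y) | move=> z []].
have Ur : ~ U (sg * r0).
  move=> [a [b [a0 b1 /andP[ar rb] hab]]].
  pose e := Num.min (sg * r0 - a) (b - sg * r0).
  have e0 : 0 < e by rewrite lt_min !subr_gt0 ar rb.
  have e1 : e <= sg * r0 - a by rewrite ge_min lexx.
  have e2 : e <= b - sg * r0 by rewrite ge_min lexx orbT.
  have [z [Uz yz zx] rz] := sup_adherent e0 hA.
  have zr : z <= r0 by apply: (sup_upper_bound hA); split.
  apply: Uz; exists a, b; split => //.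
  rewrite -/r0 in rz.
  by case: hs ar rb e1 e2 => -> ar rb e1 e2; apply/andP; split; lra.
have rx' : r0 < sg * x'.
  rewrite lt_neqAle rx andbT; apply/eqP => e; apply: Ur.
  by rewrite e signK.
exists (sg * r0); rewrite signK//; split => //; split => //.
exists (sg * x' - r0); first by rewrite subr_gt0.
move=> t /andP[t0 tx]; apply: contrapT => Ut.
have : A (r0 + t).
  split; [|lra|lra].
  by move: Ut; rewrite mulrDr.
by move=> /(sup_upper_bound hA); rewrite -/r0; lra.
Qed.

(** The radius is at most every nonzero distance from an end [p] to an end of a branch image, or to
    [S q] for an end [q]; these distances are finitely many. Hence the interval at [p] lies in the
    image of the branch, and its pullback stays in [U]: a point outside [U] would produce an end [q]
    with [S q] too close to [p]. *)
Let bad_pullback : exists2 rho0, 0 < rho0 & forall rho i x', rho <= rho0 ->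
  u i < x' < v i -> U x' -> bad rho (S x') -> bad (2^-1 * rho) x'.
Proof.
have [D hD] := ends_finite H.
have [E hE] := eends s.
have [r0 r00 hr0] : exists2 r, 0 < r & forall e, e \in [seq e - p | e <- E ++ [seq S p | p <- D], p <- D] ->
    e != 0 -> r <= `|e|.
  apply: uniform_radius.
    by move=> e r r' rr' hr e0; apply: le_trans rr' (hr e0).
  move=> e _; have [->|e0] := eqVneq e 0; first by exists 1.
  by exists `|e|; rewrite ?normr_gt0.
have farE p sg e : is_sign sg -> is_end h p sg -> e \in E -> e != p -> r0 <= `|e - p|.
  move=> hs hp he ep; apply: hr0; last by rewrite subr_eq0.
  apply/allpairsP; exists (e, p); split => //=; last exact: hD hp.
  by rewrite mem_cat he.
have farS p sg q sq : is_sign sg -> is_end h p sg -> is_sign sq -> is_end h q sq ->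
    S q != p -> r0 <= `|S q - p|.
  move=> hs hp hs' hq ep; apply: hr0; last by rewrite subr_eq0.
  apply/allpairsP; exists (S q, p); split => //=; last exact: hD hp.
  rewrite mem_cat; apply/orP; right; apply/mapP; exists q => //; exact: hD hq.
exists r0 => // rho i x' rr hx' Ux' [p [sg [t0 [hs tr hU hv [t tt xE]]]]].
have hS := eS_in hx'; have [cE dE] := hE i.
have /andP[t1 t2] := tt.
have Up : ~ U p := vanishes_outside hs hv.
have hp : is_end h p sg by split => //; exists t0 => //; exact: lt_trans t1 t2.
have inJ r : 0 < r < t0 -> c i < p + sg * r < d i.
  move=> /andP[ra rb].
  have far e : e \in E -> `|e - p| < t0 -> e = p.
    move=> he lt; apply/eqP/negPn/negP => ep; have := farE _ _ _ hs hp he ep.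
    by rewrite leNgt (lt_le_trans lt (le_trans tr rr)).
  move: hS; rewrite xE => /andP[cS Sd].
  have rt0 : 0 < r < t0 by rewrite ra.
  apply/negPn/negP; rewrite negb_and -!leNgt => /orP[|] hh.
    have [l1 l2] := sign_end hs rt0 tt (or_introl (conj cS hh)).
    by rewrite (far _ cE l1) eqxx in l2.
  have [l1 l2] := sign_end hs rt0 tt (or_intror (conj Sd hh)).
  by rewrite (far _ dE l1) eqxx in l2.
(* The side of the pulled-back end is reversed when [w i] decreases. *)
have [sg' [hs' mono]] : exists sg', is_sign sg' /\ forall y z, c i < y < d i ->
    c i < z < d i -> sg * y < sg * z -> sg' * w i y < sg' * w i z.
  case: (emono s i) => mono; case: hs => sE.
  - exists 1; split; [by left | rewrite sE => y z /andP[? ?] /andP[? ?]; rewrite !mul1r => ?].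
    exact: mono.
  - exists (-1); split; [by right | rewrite sE => y z /andP[? ?] /andP[? ?]].
    by rewrite !mulN1r !ltrN2 => ?; apply: mono.
  - exists (-1); split; [by right | rewrite sE => y z /andP[? ?] /andP[? ?]; rewrite !mul1r => ?].
    by rewrite !mulN1r !ltrN2; exact: mono.
  - exists 1; split; [by left | rewrite sE => y z /andP[? ?] /andP[? ?]].
    by rewrite !mulN1r !ltrN2 !mul1r => ?; apply: mono.
have sgt r r' : r < r' -> sg * (p + sg * r) < sg * (p + sg * r').
  by rewrite !mulrDr !signK// ltrD2l.
(* The pulled-back point in the orientation [sg']: it increases with the distance [r] to [p], and
   its increments are at most half of those of [r]. *)
pose f r := sg' * w i (p + sg * r).
have wf r : w i (p + sg * r) = sg' * f r by rewrite /f signK.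
have finc r r' : 0 < r -> r < r' -> r' < t0 -> f r < f r'.
  move=> ra rb rc; apply: mono; last exact: sgt.
    by apply: inJ; rewrite ra (lt_trans rb).
  by apply: inJ; rewrite rc (lt_trans ra).
have fhalf r r' : 0 < r -> r < r' -> r' < t0 -> f r' - f r <= 2^-1 * (r' - r).
  move=> ra rb rc; rewrite /f -mulrBr; apply: le_trans (ler_norm _) _.
  rewrite sign_norm//.
  have hr : c i < p + sg * r < d i by apply: inJ; rewrite ra (lt_trans rb).
  have hr' : c i < p + sg * r' < d i by apply: inJ; rewrite rc (lt_trans ra).
  apply: le_trans (ew_half hr' hr) _.
  rewrite (_ : _ - _ = sg * (r' - r)); last by rewrite opprD addrACA subrr add0r mulrBr.
  by rewrite sign_norm// gtr0_norm// subr_gt0.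
pose B : set R := [set f r | r in [set r | 0 < r < t0]].
have Bl : has_inf B.
  split; first by exists (f t), t.
  exists (f t - 2^-1 * t) => _ [r /= /andP[ra rb] <-].
  have [rt|rt|->] := ltgtP r t.
  - by have := fhalf r t ra rt t2; lra.
  - by have := finc t r t1 rt rb; lra.
  - by lra.
(* The point [p] may be an end of the image, where [w i] is not controlled; the new end is therefore
   the one-sided limit of [w i], which is an infimum by monotonicity. *)
pose l := inf B.
have lf r : 0 < r < t0 -> l < f r.
  move=> /andP[ra rb]; have r20 : 0 < r / 2 by rewrite divr_gt0.
  have r2r : r / 2 < r by rewrite ltr_pdivrMr// mulr_natr mulr2n ltrDl.
  have : f (r / 2) < f r by exact: finc.
  apply: le_lt_trans; apply: ge_inf; first by case: Bl.
  by exists (r / 2) => //=; rewrite r20 (lt_trans r2r).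
have fl r : 0 < r < t0 -> f r - l <= 2^-1 * r.
  move=> /andP[ra rb]; rewrite lerBlDr -lerBlDl.
  apply: lb_le_inf; first by exists (f t), t.
  move=> _ [r' /= /andP[ra' rb'] <-].
  have [rt|rt|->] := ltgtP r' r.
  - by have := fhalf r' r ra' rt rb; lra.
  - by have := finc r r' ra rt rb'; lra.
  - by lra.
pose p' := sg' * l.
have wfl r : w i (p + sg * r) = p' + sg' * (f r - l) by rewrite wf /p' -mulrDr addrC subrK.
(* By [branch_term_le], [h] at a pulled-back point is at most [K^-1] times [h] at the original one,
   with [K] a lower bound of [G i] on the image. *)
have hv' : vanishes h p' sg'.
  move=> tau k tau0 k0.
  have [K K0 hK] := eG_low s i.
  have mt : 0 < Num.min tau t0 by rewrite lt_min tau0 (lt_trans t1).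
  have [r /andP[ra]] := hv _ _ mt (mulr_gt0 K0 k0).
  rewrite lt_min => /andP[rb rc] hr.
  have rr' : 0 < r < t0 by rewrite ra rc.
  exists (f r - l).
    rewrite subr_gt0 lf//; apply: le_lt_trans (fl r rr') _.
    by lra.
  rewrite -wfl -(ltr_pM2l K0); apply: le_lt_trans hr.
  have hJ := inJ r rr'.
  apply: le_trans (branch_term_le H hJ); apply: ler_wpM2r; last exact: hK.
  by apply: (dens_ge0 H); apply: (@branch_X _ s i); exact: ew_in.
have Up' : ~ U p' := vanishes_outside hs' hv'.
pose t' := f t - l.
have xE' : x' = p' + sg' * t' by rewrite -wfl -xE ewS.
have t'0 : 0 < t' by rewrite subr_gt0; exact: lf.
have t't : t' <= 2^-1 * t by exact: fl.
(* A point outside [U] here gives an end [q] between it and [x']; then [S q] lies strictly between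
   [p] and [S x'], closer to [p] than the radius allows. *)
have hU' r : 0 < r < t' -> U (p' + sg' * r).
  move=> /andP[ra rb]; apply: contrapT => Ur.
  have lt : sg' * (p' + sg' * r) < sg' * x'.
    by rewrite xE' !mulrDr !signK// ltrD2l.
  have [q [hq yq qx]] := last_outside hs' Ur Ux' lt.
  have [_ [r1 /= /andP[r1a r1b] <-] r1l] := inf_adherent ra Bl.
  have r1J : c i < p + sg * r1 < d i by apply: inJ; rewrite r1a.
  have q1 : sg' * w i (p + sg * r1) < sg' * q.
    apply: lt_le_trans yq; rewrite mulrDr signK// /p' signK//.
  have qa : u i < q < v i.
    exact: sign_between hs' (ew_in r1J) hx' q1 qx.
  have qJ := eS_in qa.
  have s1 : sg * (p + sg * r1) < sg * S q.
    rewrite ltNge le_eqVlt; apply/negP => /predU1P[e|lt'].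
      have {}e : S q = p + sg * r1 by rewrite -(signK (S q) hs) e signK.
      by move: q1; rewrite -e ewS// ltxx.
    by have := mono _ _ qJ r1J lt'; rewrite ewS// => /(lt_trans q1); rewrite ltxx.
  have s2 : sg * S q < sg * S x'.
    rewrite ltNge le_eqVlt; apply/negP => /predU1P[e|lt'].
      have {}e : S q = S x' by rewrite -(signK (S q) hs) -e signK.
      by move: qx; rewrite -(ewS qa) e ewS// ltxx.
    by have := mono _ _ hS qJ lt'; rewrite !ewS// => /(lt_trans qx); rewrite ltxx.
  have close : 0 < sg * (S q - p) < t0.
    by rewrite xE in s2; exact: sign_close hs r1a t2 s1 s2.
  have /andP[cl1 cl2] := close.
  have ne : S q != p by apply/eqP => e; rewrite e subrr mulr0 ltxx in cl1.
  have := farS _ _ _ _ hs hp hs' hq ne.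
  rewrite -(sign_norm (S q - p) hs) gtr0_norm// leNgt.
  by rewrite (lt_le_trans cl2 (le_trans tr rr)).
have [a [b [_ _ /andP[ax xb] _ abU]]] := pos_set_itv Ux'.
pose e := Num.min (x' - a) (b - x').
have e0 : 0 < e by rewrite lt_min !subr_gt0 ax xb.
have e1 : e <= x' - a by rewrite ge_min lexx.
have e2 : e <= b - x' by rewrite ge_min lexx orbT.
(* The interval is prolonged a little beyond [x'], inside [U], because [bad] requires [x'] to be
   interior to it. *)
exists p', sg', (Num.min (t' + e) (2^-1 * rho)); split => //.
- by rewrite ge_min lexx orbT.
- move=> r /andP[ra]; rewrite lt_min => /andP[rb rc].
  have [rt|rt] := ltP r t'; first by apply: hU'; rewrite ra.
  apply: abU; rewrite (_ : p' + sg' * r = x' + sg' * (r - t')); last first.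
    exact: sign_shift.
  by apply: sign_ball hs' _ _ e1 e2; rewrite ?subr_ge0// ltrBlDl.
- exists t' => //; rewrite t'0 lt_min ltrDl e0/=.
  by apply: le_lt_trans t't _; rewrite ltr_pM2l// (lt_le_trans t2).
Qed.

(** [shrink_empty] applies to the sets of bad points at the scales [2^-1 ^+ n * r0]: a point in all
    of them would have points outside [U] arbitrarily close to it, although [U] is open. *)
Lemma end_not_vanishing p sg : is_sign sg -> is_end h p sg -> ~ vanishes h p sg.
Proof.
move=> hs [Up [t t0 ht]] hv.
have [r0 r00 hr0] := bad_pullback.
pose F (n : nat) := bad (2^-1 ^+ n * r0).
pose t1 := Num.min t r0.
have t10 : 0 < t1 by rewrite lt_min t0 r00.
apply: (@shrink_empty _ s P h Mh H F _ _ _ _ _ (p + sg * (t1 / 2))).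
- by move=> n; exact: open_bad.
- by move=> n x; exact: bad_pos.
- move=> n x [q [sq [tq [hsq trq hUq hvq hxq]]]]; exists q, sq, tq; split => //.
  apply: le_trans trq _; rewrite exprS -mulrA.
  by have : 0 < 2^-1 ^+ n * r0 by [rewrite mulr_gt0// exprn_gt0// invr_gt0]; lra.
- move=> x Fx; have Ux := bad_pos (Fx 0%N).
  have [a [b [_ _ /andP[ay yb] _ abU]]] := pos_set_itv Ux.
  have e0 : 0 < Num.min (x - a) (b - x) by rewrite lt_min !subr_gt0 ay yb.
  have [k hk] := half_lt r0 e0.
  have [q [sq [tq [hsq trq hUq hvq [tx /andP[tx1 tx2] xE]]]]] := Fx k.
  apply: (vanishes_outside hsq hvq); apply: abU.
  have lt : tx < Num.min (x - a) (b - x) by exact: lt_trans tx2 (le_lt_trans trq hk).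
  move: lt; rewrite lt_min => /andP[l1 l2].
  by rewrite xE in ay yb l1 l2; case: hsq ay yb l1 l2 => -> *; apply/andP; split; lra.
- move=> n i x hx Ux; rewrite /F exprS -mulrA; apply: (hr0 _ i) => //.
  by rewrite ler_piMl ?(ltW r00)// exprn_ile1//; lra.
- exists p, sg, t1; rewrite expr0 mul1r; split => //.
  + by rewrite ge_min lexx orbT.
  + move=> r /andP[ra]; rewrite lt_min => /andP[rb rc]; apply: ht; exact/andP.
  + by exists (t1 / 2) => //; apply/andP; split; lra.
Qed.

(** Locally at every point of [[0, 1]], [h] is bounded below on [U]: at points of [U] by definition,
    and on each side of an end by [end_not_vanishing]. Compactness makes the bound uniform. *)
Lemma density_lower_bound : exists2 k, 0 < k & forall x, U x -> k <= h x.
Proof.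
have [r r0 hr] := gaps H.
have side z sg : is_sign sg -> ~ U z -> exists t k, [/\ 0 < t, 0 < k &
    forall q, 0 < q < t -> U (z + sg * q) -> k <= h (z + sg * q)].
  move=> hs Uz.
  have [hz|nz] := pselect (is_end h z sg).
    have nv := end_not_vanishing hs hz.
    apply: contrapT => hn; apply: nv => t k t0 k0.
    apply: contrapT => hn'; apply: hn; exists t, k; split => // q hq _.
    by rewrite leNgt; apply/negP => hlt; apply: hn'; exists q.
  (* Here the complement of U accumulates at z, and by the gap lemma U misses a
     one-sided neighbourhood of z. *)
  have [q [/andP[q0 qr] Uq]] : exists q, 0 < q < r /\ ~ U (z + sg * q).
    apply: contrapT => hn; apply: nz; split => //; exists r => // q hq.
    by apply: contrapT => Uq; apply: hn; exists q.
  exists q, 1; split => // x /andP[x0 xq] Ux; exfalso.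
  case: hs Uq Ux => -> Uq Ux.
    have := hr (z + 1 * x) z (z + 1 * q) Ux Uz Uq.
    by move=> /(_ ltac:(by apply/andP; split; lra)); lra.
  have := hr (z + -1 * x) (z + -1 * q) z Ux Uq Uz.
  by move=> /(_ ltac:(by apply/andP; split; lra)); lra.
have loc z : exists t k, [/\ 0 < t, 0 < k & forall x, U x -> `|x - z| < t -> k <= h x].
  have [Uz|Uz] := pselect (U z).
    have [a [b [_ _ /andP[az zb] [k k0 hk] _]]] := pos_set_itv Uz.
    exists (Num.min (z - a) (b - z)), k; split => //; first by rewrite lt_min !subr_gt0 az zb.
    move=> x Ux; rewrite lt_min ltr_norml ltr_norml => /andP[/andP[? ?] /andP[? ?]].
    by apply: hk; apply/andP; split; lra.
  have [t1 [k1 [t10 k10 h1]]] := side z 1 (or_introl erefl) Uz.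
  have [t2 [k2 [t20 k20 h2]]] := side z (-1) (or_intror erefl) Uz.
  exists (Num.min t1 t2), (Num.min k1 k2); split; [by rewrite lt_min t10 t20|by rewrite lt_min k10 k20|].
  move=> x Ux; rewrite lt_min => /andP[l1 l2]; rewrite ge_min.
  have [xz|xz|xz] := ltgtP x z; last by rewrite xz in Ux.
    rewrite (_ : x = z + -1 * (z - x)) in Ux *; last by lra.
    rewrite ltr0_norm ?subr_lt0// in l2.
    by rewrite h2 ?orbT//; apply/andP; split; lra.
  rewrite (_ : x = z + 1 * (x - z)) in Ux *; last by lra.
  rewrite gtr0_norm ?subr_gt0// in l1.
  by rewrite h1//; apply/andP; split; lra.
have cpt : compact `[0 : R, 1]%classic by exact: segment_compact.
move/compact_near_coveringP : cpt => /(_ R 0^'+ (fun k x => U x -> k <= h x)).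
have cov : forall x : R, `[0, 1]%classic x ->
    \forall x' \near x & k \near (0 : R)^'+, U x' -> k <= h x'.
  move=> z _; have [t [k [t0 k0 hk]]] := loc z.
  exists ([set x | `|x - z| < t], [set k' | k' <= k]) => /=.
    split; first by exists t => //= y; rewrite /ball_/= distrC.
    by near=> k'; rewrite /=; near: k'; exact: nbhs_right_le.
  by move=> [x k'] /= [xz kk] Ux; apply: le_trans kk (hk _ Ux xz).
move=> /(_ _ cov) [r1 /= r10 hr1].
exists (r1 / 2); first by lra.
move=> x Ux; have := hr1 (r1 / 2); rewrite /ball_/= sub0r normrN gtr0_norm; last by lra.
move=> /(_ ltac:(lra) ltac:(lra) x); apply => //=.
by rewrite in_itv/=; have /andP[? ?] := pos_set_unit Ux; apply/andP; split; lra.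
Unshelve. all: by end_near. Qed.

End Germs.

(** * Exponential contraction of the transfer operator *)

Lemma bernoulli {R : realType} (x : R) (n : nat) : 0 <= x <= 1 -> 1 - n%:R * x <= (1 - x) ^+ n.
Proof.
move=> /andP[x0 x1]; elim: n => [|n IH]; first by rewrite mul0r expr0 subr0.
rewrite exprS -natr1.
have : (1 - x) * (1 - n%:R * x) <= (1 - x) * (1 - x) ^+ n by rewrite ler_wpM2l ?subr_ge0.
have : 0 <= n%:R * x * x by rewrite !mulr_ge0.
by set t := n%:R; lra.
Qed.

Section Contraction.
Context {R : realType} (s : expanding R) (P : probability (measurableTypeR R) R).
Variables (h : R -> R) (Mh : R).
Hypothesis H : is_invariant_density s P h Mh.
Local Notation m := (@lebesgue_measure R).
Local Notation X := (@X R).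
Local Notation S := (eS s).
Local Notation c := (ec s).
Local Notation d := (ed s).
Local Notation w := (ew s).
Local Notation L := (transfer s).
Local Notation kappa := (kappa s).
Implicit Types (f g : R -> R) (x y z e k M : R) (A B : set (measurableTypeR R)).
Local Notation pr B := (fine (P B)).

Hypothesis wm : forall A B, measurable A -> A `<=` X -> measurable B -> B `<=` X ->
  n.+1%:R^-1 * (\sum_(k < n.+1) `|pr (A `&` Xpreimage S k B) - pr A * pr B|)
    @[n --> \oo] --> (0 : R).

Hypothesis PX : P X = 1%E.

Let bh : bm h := var_bm (dens_var H).
Let mX := @measurable_X R.

(** The step function sampled from [f] has a constant sign on each cell, so that there the integral
    of its modulus is the modulus of its integral. It is within [M / N] of [f] in L1; passing to it
    and back gives the factor 2. *)
Lemma L1_le_cells f M (N : nat) : (0 < N)%N -> var f M ->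
  \int[m]_(x in X) `|f x| <=
  2 * (M / N%:R) + \sum_(j < N.+1) `|\int[m]_(x in X) (cellfun N j x * f x)|.
Proof.
move=> N0 vf; have bf := var_bm vf.
pose fN x := f ((cell N x)%:R / N%:R).
pose g j := f (j%:R / N%:R).
have bc j : bm (cellfun N j : R -> R) := cellfun_bm N j.
have bfN : bm fN.
  apply: bm_eq (bm_sum (n := N.+1) (f := fun j x => g j * cellfun N j x) _).
    by move=> x Xx; have := cell_sum N g Xx.
  by move=> i _; exact: bmZ.
have bd : bm (fun x => `|f x - fN x|) by apply: bm_norm; exact: bmB.
have happ : \int[m]_(x in X) `|f x - fN x| <= M / N%:R := var_cell_approx N0 vf.
have h1 : \int[m]_(x in X) `|f x| <= \int[m]_(x in X) `|f x - fN x| + \int[m]_(x in X) `|fN x|.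
  rewrite -RintD//; last exact: bm_norm.
  apply: Rint_le => //; [exact: bm_norm|by apply: bmD => //; exact: bm_norm|].
  by move=> x _; have := ler_normD (f x - fN x) (fN x); rewrite subrK.
have h2 : \int[m]_(x in X) `|fN x| = \sum_(j < N.+1) `|\int[m]_(x in X) (cellfun N j x * fN x)|.
  transitivity (\int[m]_(x in X) \sum_(j < N.+1) `|g j| * cellfun N j x).
    apply: eq_Rintegral => x /[1!inE] Xx.
    by have := cell_sum N (fun j => `|g j|) Xx => ->.
  rewrite (@Rint_sum _ _ (fun j x => `|g j| * cellfun N j x))//; last first.
    by move=> i _; exact: bmZ.
  apply: eq_bigr => j _; rewrite RintZ//.
  transitivity `|\int[m]_(x in X) (g j * cellfun N j x)|.
    rewrite RintZ// normrM; congr (_ * _); rewrite ger0_norm//.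
    by apply: Rintegral_ge0 => x _; exact: cellfun_ge0.
  congr (`| _ |); apply: eq_Rintegral => x _; rewrite mulrC /cellfun /fN.
  by have [->|] := eqVneq (cell N x) j; rewrite ?mul1r ?mul0r.
have h3 : \sum_(j < N.+1) `|\int[m]_(x in X) (cellfun N j x * fN x)| <=
    \sum_(j < N.+1) `|\int[m]_(x in X) (cellfun N j x * f x)| + \int[m]_(x in X) `|f x - fN x|.
  have -> : \int[m]_(x in X) `|f x - fN x| =
      \sum_(j < N.+1) \int[m]_(x in X) (cellfun N j x * `|f x - fN x|).
    rewrite -(@Rint_sum _ _ (fun j x => cellfun N j x * `|f x - fN x|))//; last first.
      by move=> i _; exact: bmM.
    apply: eq_Rintegral => x /[1!inE] Xx; rewrite -mulr_suml.
    have := cell_sum N (fun=> 1) Xx; under eq_bigr do rewrite mul1r.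
    by move=> ->; rewrite mul1r.
  rewrite -big_split; apply: ler_sum => j _ /=.
  have bcf : bm (fun x => cellfun N j x * f x) by exact: bmM.
  have bcN : bm (fun x => cellfun N j x * fN x) by exact: bmM.
  have E : \int[m]_(x in X) `|cellfun N j x * fN x - cellfun N j x * f x| =
      \int[m]_(x in X) (cellfun N j x * `|f x - fN x|).
    by apply: eq_Rintegral => x _; rewrite -mulrBr normrM ger0_norm ?cellfun_ge0// distrC.
  have := Rint_abs (bmB bcN bcf) mX (@subset_refl _ _).
  rewrite E (RintB bcN bcf mX (@subset_refl _ _)).
  have := ler_normD (\int[m]_(x in X) (cellfun N j x * fN x) - \int[m]_(x in X) (cellfun N j x * f x))
    (\int[m]_(x in X) (cellfun N j x * f x)).
  by rewrite subrK; lra.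
by rewrite h2 in h1; lra.
Qed.

Definition cellset (N j : nat) : set (measurableTypeR R) := [set x | X x /\ cell N x = j].

Lemma measurable_cellset N j : measurable (cellset N j).
Proof.
have [mc _] := @cellfun_bm R N j.
have -> : cellset N j = X `&` cellfun N j @^-1` [set 1].
  apply/seteqP; split => x [Xx hx]; split => //.
    by rewrite /= /cellfun hx eqxx.
  move: hx; rewrite /= /cellfun; case: eqP => // _ /eqP.
  by rewrite eq_sym oner_eq0.
by apply: mc => //; exact: measurable_set1.
Qed.

Lemma cellset_int N j f : \int[m]_(x in X) (cellfun N j x * f x) =
  \int[m]_(x in cellset N j) f x.
Proof.
rewrite [RHS](_ : _ = \int[m]_(x in X `&` cellset N j) f x); last first.
  by rewrite setIidr// => x [].
rewrite -Rint_indic; apply: eq_Rintegral => x /[1!inE] Xx; congr (_ * _).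
rewrite /cellfun indicE; case: eqP => e; first by rewrite mem_set.
by rewrite memNset// => -[].
Qed.

Lemma density_int_le1 : \int[m]_(x in X) h x <= 1.
Proof.
rewrite -(dens_pr H mX (@subset_refl _ _)) -[leRHS]/(fine 1%E) fine_le//.
  exact: pr_fin.
exact: probability_le1.
Qed.

Lemma density_norm_int : \int[m]_(x in X) `|h x| <= 1.
Proof.
rewrite (@eq_Rintegral _ _ _ m _ h); first exact: density_int_le1.
by move=> x /[1!inE] Xx; rewrite ger0_norm// (dens_ge0 H).
Qed.

Lemma iter_density n x : X x -> iter n L h x = h x.
Proof.
elim: n x => //= n IH x Xx; rewrite (transfer_eq s IH); exact: (dens_fix H).
Qed.

Definition centered A x := \1_A x * h x - pr A * h x.

Lemma centered_bm A : measurable A -> bm (centered A).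
Proof. by move=> mA; apply: bmB; [apply: bmM => //; exact: bm_indic | exact: bmZ]. Qed.

Lemma centered_corr A B n : measurable A -> A `<=` X -> measurable B -> B `<=` X ->
  \int[m]_(x in B) iter n L (centered A) x =
  pr (A `&` Xpreimage S n B) - pr A * pr B.
Proof.
move=> mA AX mB BX; have mP : measurable (Xpreimage S n B) by exact: measurable_Xpreimage.
have SX : Xpreimage S n B `<=` X by move=> x [].
rewrite iter_transfer_int//; last exact: centered_bm.
rewrite RintB//; last 2 first.
- by apply: bmM => //; exact: bm_indic.
- exact: bmZ.
rewrite Rint_indic RintZ// setIC -!(dens_pr H)//; last 2 first.
- exact: measurableI.
- by move=> x [] /AX.
by rewrite (Pinv_iter (dens_inv H)).
Qed.

Lemma cvg_sum0 (N : nat) (a : nat -> nat -> R) :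
  (forall j, a j n @[n --> \oo] --> (0 : R)) ->
  \sum_(j < N) a j n @[n --> \oo] --> (0 : R).
Proof.
move=> ha; elim: N => [|N IH].
  by under eq_fun do rewrite big_ord0; exact: cvg_cst.
under eq_fun do rewrite big_ord_recr /=.
have : \sum_(i < N) a i n + a N n @[n --> \oo] --> (0 + 0 : R).
  by apply: cvgD; [exact: IH | exact: ha].
by rewrite addr0.
Qed.

(* The L1 norms of the iterates decrease, so it is enough to make one of them
   small, and averages of correlations tend to 0 by weak mixing. *)
Lemma centered_decay A M e : measurable A -> A `<=` X -> var (centered A) M -> 0 < e ->
  exists n0, forall n, (n0 <= n)%N -> \int[m]_(x in X) `|iter n L (centered A) x| <= e.
Proof.
move=> mA AX vA e0; have bA := centered_bm mA.
pose M' := M + 2 * kappa * \int[m]_(x in X) `|centered A x|.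
have vLA n : var (iter n L (centered A)) M'.
  apply: var_weak (lasota_yorke_iter s n vA); rewrite lerD2r.
  by rewrite ler_piMl ?(var_ge0 vA)// exprn_ile1//; lra.
have M'0 : 0 <= M' := var_ge0 (vLA 0%N).
(* Cells so fine that the sampling error in [L1_le_cells] is at most [e / 2] for all iterates at
   once. *)
have [N N0 hN] : exists2 N : nat, (0 < N)%N & 2 * (M' / N%:R) <= e / 2.
  have q0 : 0 < e / (4 * (M' + 1)) by rewrite divr_gt0//; lra.
  have [n0 _ hn0] : \forall n \near \oo, n.+1%:R^-1 < e / (4 * (M' + 1)).
    exact: near_infty_natSinv_lt (PosNum q0).
  exists n0.+1 => //; have := hn0 n0 (leqnn _) => /= hk.
  have n1 : 0 < n0.+1%:R^-1 :> R by rewrite invr_gt0 ltr0n.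
  move: hk; rewrite ltr_pdivlMr; last by lra.
  set i := _^-1 => hk.
  have i0 : 0 < i by [].
  have : 0 <= i * M' by rewrite mulr_ge0// ltW.
  by nra.
pose a j n := `|\int[m]_(x in X) (cellfun N j x * iter n L (centered A) x)|.
have aE j n : a j n = `|pr (A `&` Xpreimage S n (cellset N j)) - pr A * pr (cellset N j)|.
  rewrite /a cellset_int centered_corr//; first exact: measurable_cellset.
  by move=> x [].
have [k hk] : exists k : nat, \sum_(j < N.+1) a j k <= e / 2.
  have : \sum_(j < N.+1) (n.+1%:R^-1 * \sum_(k < n.+1) a j k) @[n --> \oo] --> (0 : R).
    apply: (@cvg_sum0 N.+1 (fun j n => n.+1%:R^-1 * \sum_(k < n.+1) a j k)) => j.
    under eq_fun do under eq_bigr do rewrite aE.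
    apply: wm => //; first exact: measurable_cellset.
    by move=> x [].
  move=> /cvgrPdist_lt /(_ (e / 2)); rewrite divr_gt0// => /(_ isT) [n _ /(_ n (leqnn _)) /=].
  rewrite sub0r normrN => /(le_lt_trans (ler_norm _)) hn.
  (* If the sum over the cells exceeded [e / 2] for every [k], so would its averages. *)
  apply: contrapT => nk; move: hn; apply/negP; rewrite -leNgt.
  rewrite -mulr_sumr exchange_big /= ler_pdivlMl ?ltr0n//.
  apply: (@le_trans _ _ (\sum_(k < n.+1) (e / 2))).
    by rewrite sumr_const card_ord mulr_natl.
  by apply: ler_sum => k _; rewrite leNgt; apply/negP => /ltW hk; apply: nk; exists k.
exists k => n kn.
apply: (@le_trans _ _ (\int[m]_(x in X) `|iter k L (centered A) x|)).
  rewrite -(subnK kn) iterD; apply: iter_transfer_L1; exact: iter_transfer_bm.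
apply: le_trans (L1_le_cells N0 (vLA k)) _.
by rewrite [leRHS]splitr lerD.
Qed.

Lemma density_dichotomy : exists k (N0 : set (measurableTypeR R)),
  [/\ 0 < k, measurable N0, m N0 = 0%E &
  forall x, X x -> ~ N0 x -> h x = 0 \/ k <= h x].
Proof.
have [k k0 hk] := density_lower_bound H.
have [N0 [mN N00 hN]] := outside_pos_set_null H.
exists k, N0; split => // x Xx nx.
by have [Ux|Ux] := pselect (pos_set h x); [right; exact: hk | left; exact: hN].
Qed.

(** The functions for which the quotient [f / h] makes sense. The condition is imposed at every
    point of [X], so that it can be checked on single terms of the series defining [L f]. *)
Definition subordinate f := forall x, X x -> h x = 0 -> f x = 0.

(** Where [L h = h] vanishes, all terms of the series vanish; as [G i] is positive on the image, [h]
    and hence [f] vanish at the inverse images. *)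
Lemma subordinate_transfer f : subordinate f -> subordinate (L f).
Proof.
move=> sf x Xx hx0; rewrite /transfer.
rewrite (_ : (fun n => _) = cst 0) ?lim_cst//; apply/funext => n.
rewrite /partial_transfer big1// => i _.
have [hi|hi] := boolP (c i < x < d i); last by rewrite eG0// mul0r.
have := branch_term_le H hi; rewrite hx0 => hle.
have Xw : X (w i x) by apply: (@branch_X _ s i); exact: ew_in.
rewrite sf ?mulr0//; apply/eqP; rewrite eq_le (dens_ge0 H)// andbT.
by rewrite -(pmulr_rle0 _ (eG_gt0 hi)).
Qed.

Lemma subordinate_iter n f : subordinate f -> subordinate (iter n L f).
Proof. by move=> sf; elim: n => //= n; exact: subordinate_transfer. Qed.

(** The point is that [n] does not depend on [f]. The quotient [phi] of [f] by the maximum of [h]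
    and [k] has variation at most [C1] and is replaced by its samples on [N] cells. This changes
    [f = phi * h] little in L1, and leaves a combination with bounded coefficients of finitely many
    functions, [h] restricted to a cell. Their centered parts decay by [centered_decay]; the rest is
    a multiple of [h] whose coefficient is close to the integral of [f], which is 0. *)
Lemma uniform_decay e : 0 < e -> exists n : nat, forall f M, var f M -> subordinate f ->
  \int[m]_(x in X) f x = 0 -> \int[m]_(x in X) `|iter n L f x| <= e * M.
Proof.
move=> e0; have [k [N0 [k0 mN0 N00 hN0]]] := density_dichotomy.
have [Hm Hm0 hHm] := bm_bound bh.
(* The inverse of the maximum of [h] and [k] has variation at most [Mh / k ^+ 2] and is at most
   [k^-1], while the normalised [f] has variation and modulus at most 1. *)
pose C1 := Mh / k ^+ 2 + k^-1.
have Mh0 : 0 <= Mh := var_ge0 (dens_var H).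
have ik0 : 0 < k^-1 by rewrite invr_gt0.
have C10 : 0 < C1 by rewrite /C1 ltr_wpDl// divr_ge0// exprn_ge0// ltW.
pose Q := Hm * C1 + 1.
have Q0 : 0 < Q by rewrite /Q ltr_wpDl// mulr_ge0// ltW.
(* The sampling error [Hm * C1 / N] occurs twice, in replacing [f] by [f'] and in the integral of
   [f']. *)
have [N N_gt0 hN] : exists2 N : nat, (0 < N)%N & 2 * (Hm * C1) / N%:R <= e / 2.
  have q0 : 0 < e / (4 * Q) by rewrite divr_gt0//; lra.
  have [n0 _ hn0] : \forall n \near \oo, n.+1%:R^-1 < e / (4 * Q).
    exact: near_infty_natSinv_lt (PosNum q0).
  exists n0.+1 => //; have := hn0 n0 (leqnn _) => /= hk.
  have n1 : 0 < n0.+1%:R^-1 :> R by rewrite invr_gt0 ltr0n.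
  move: hk; rewrite ltr_pdivlMr; last by lra.
  set i := _^-1 => hk.
  have i0 : 0 < i by [].
  have : 0 <= i * (Hm * C1) by rewrite mulr_ge0 ?(ltW i0)// mulr_ge0// ltW.
  by move: hk; rewrite /Q; lra.
have mC j := measurable_cellset N j.
have CX j : cellset N j `<=` X by move=> x [].
have indC j x : X x -> \1_(cellset N j) x = cellfun N j x :> R.
  move=> Xx; rewrite /cellfun indicE; case: eqP => e'; first by rewrite mem_set.
  by rewrite memNset// => -[].
have vC j : var (centered (cellset N j)) (1 * Mh + Hm * (2 * N%:R) + `|pr (cellset N j)| * Mh).
  apply: varB; last exact: varZ (dens_var H).
  apply: (@var_eq _ (fun x => cellfun N j x * h x)); first by move=> x Xx; rewrite indC.
  apply: varM => //; [exact: cellfun_var | exact: (dens_var H) |].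
  by move=> x _; rewrite ger0_norm ?cellfun_ge0// /cellfun lern1 leq_b1.
(* There are [N.+1] cells, with coefficients at most [k^-1]; together they may contribute
   [e / 2]. *)
pose e1 := e * k / (2 * N.+1%:R).
have e10 : 0 < e1 by rewrite /e1 divr_gt0 ?mulr_gt0// ltr0n.
have /choice[n_ hn_] : forall j, exists n0, forall n, (n0 <= n)%N ->
    \int[m]_(x in X) `|iter n L (centered (cellset N j)) x| <= e1.
  by move=> j; apply: centered_decay (vC j) e10.
pose n := (\sum_(j < N.+1) n_ j)%N.
have nj (j : 'I_N.+1) : (n_ j <= n)%N by rewrite /n (bigD1 j)//= leq_addr.
exists n.
(* By homogeneity it is enough to treat [M = 1]; for [M = 0], a function with mean 0 vanishes on
   [X]. *)
suff main f : var f 1 -> subordinate f -> \int[m]_(x in X) f x = 0 ->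
    \int[m]_(x in X) `|iter n L f x| <= e.
  move=> f M vf sf f0; have bf := var_bm vf.
  have M0 := var_ge0 vf; move: M0; rewrite le_eqVlt => /predU1P[M0|M0].
    rewrite -M0 mulr0; apply: le_trans (iter_transfer_L1 s n bf) _.
    rewrite -[leRHS]Rint_cst; apply: Rint_le => //; [exact: bm_norm|exact: bm_cst|].
    by move=> x Xx; rewrite -M0 in vf; exact: (var_mean0 vf).
  have vg : var (fun x => M^-1 * f x) 1.
    by apply: var_weak (varZ M^-1 vf); rewrite gtr0_norm ?invr_gt0// mulVf// gt_eqF.
  have := main _ vg; rewrite RintZ// f0 mulr0 => /(_ _ erefl) h'.
  have {}h' : \int[m]_(x in X) `|iter n L (fun x => M^-1 * f x) x| <= e.
    by apply: h' => x Xx hx; rewrite sf// mulr0.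
  rewrite (@eq_Rintegral _ _ _ m _ (fun x => M^-1 * `|iter n L f x|)) in h'; last first.
    by move=> x /[1!inE] Xx; rewrite iter_transferZ// normrM gtr0_norm// invr_gt0.
  rewrite RintZ// in h'; last by apply: bm_norm; exact: iter_transfer_bm.
  by move: h'; rewrite mulrC ler_pdivrMr.
move=> vf sf f0; have bf := var_bm vf.
have f1 x : X x -> `|f x| <= 1 by exact: (var_mean0 vf).
pose hk x := Num.max (h x) k.
have hkk x : k <= hk x by rewrite /hk le_max lexx orbT.
have hk0 x : 0 < hk x := lt_le_trans k0 (hkk x).
have vi : var (fun x => (hk x)^-1) (Mh / k ^+ 2).
  by apply: var_inv => //; exact: var_max (dens_var H).
have ib x : `|(hk x)^-1| <= k^-1.
  by rewrite ger0_norm ?invr_ge0 ?(ltW (hk0 x))// lef_pV2 ?posrE.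
pose phi x := f x * (hk x)^-1.
have vphi : var phi C1.
  by apply: var_weak (varM vf vi f1 (fun x _ => ib x)); rewrite /C1 mul1r mulr1.
have phib x : X x -> `|phi x| <= k^-1.
  by move=> Xx; rewrite /phi normrM -[leRHS]mul1r ler_pM// f1.
have bphi := var_bm vphi.
pose p_ j := phi (j%:R / N%:R).
pose f' x := \sum_(j < N.+1) p_ j * (\1_(cellset N j) x * h x).
have bj j : bm (fun x => \1_(cellset N j) x * h x) by apply: bmM => //; exact: bm_indic.
have bf' : bm f'.
  by apply: (@bm_sum _ N.+1 (fun j x => p_ j * (\1_(cellset N j) x * h x))) => j _; exact: bmZ.
have f'E x : X x -> f' x = phi ((cell N x)%:R / N%:R) * h x.
  move=> Xx; have := cell_sum N p_ Xx; rewrite /p_ => <-.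
  by rewrite mulr_suml; apply: eq_bigr => j _; rewrite indC// mulrA.
have pX j : (j <= N)%N -> X (j%:R / N%:R).
  by move=> jN; apply/inX; rewrite divr_ge0//= ler_pdivrMr ?ltr0n// mul1r ler_nat.
have dist : \int[m]_(x in X) `|f x - f' x| <= Hm * C1 / N%:R.
  have -> : \int[m]_(x in X) `|f x - f' x| = \int[m]_(x in X) `|phi x * h x - f' x|.
    apply: (@Rint_ae _ _ _ _ N0) => //.
    - by apply: bm_norm; exact: bmB.
    - by apply: bm_norm; apply: bmB => //; exact: bmM.
    move=> x Xx nx; congr (`| _ - _ |); rewrite /phi.
    have [hx|hx] := hN0 x Xx nx; first by rewrite hx mulr0 sf.
    by rewrite /hk (max_idPl hx) mulfVK// gt_eqF// (lt_le_trans k0).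
  have bphiN : bm (fun x => phi ((cell N x)%:R / N%:R)).
    apply: bm_eq (bm_sum (n := N.+1) (f := fun j x => p_ j * cellfun N j x) _).
      by move=> x Xx; have := cell_sum N p_ Xx.
    by move=> i _; apply: bmZ; exact: cellfun_bm.
  apply: (@le_trans _ _ (\int[m]_(x in X) (Hm * `|phi x - phi ((cell N x)%:R / N%:R)|))).
    apply: Rint_le => //.
    - by apply: bm_norm; apply: bmB => //; exact: bmM.
    - by apply: bmZ; apply: bm_norm; exact: bmB.
    by move=> x Xx; rewrite f'E// -mulrBl normrM mulrC ler_wpM2r// hHm.
  rewrite RintZ//; last by apply: bm_norm; exact: bmB.
  by rewrite -mulrA ler_wpM2l// var_cell_approx.
have intf' : `|\sum_(j < N.+1) p_ j * pr (cellset N j)| <= Hm * C1 / N%:R.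
  have -> : \sum_(j < N.+1) p_ j * pr (cellset N j) = \int[m]_(x in X) f' x.
    rewrite (@Rint_sum _ _ (fun j x => p_ j * (\1_(cellset N j) x * h x)))//; last first.
      by move=> j _; exact: bmZ.
    apply: eq_bigr => j _; rewrite RintZ// Rint_indic setIidr// (dens_pr H)//.
  rewrite -[X in `|X|]subr0 -f0; apply: le_trans (Rint_dist bf' bf mX (@subset_refl _ _)) _.
  apply: le_trans dist; rewrite le_eqVlt; apply/orP; left; apply/eqP.
  by apply: eq_Rintegral => x _; rewrite distrC.
have Lf' x : X x -> iter n L f' x =
    \sum_(j < N.+1) p_ j * iter n L (centered (cellset N j)) x +
    (\sum_(j < N.+1) p_ j * pr (cellset N j)) * h x.
  move=> Xx; rewrite (@iter_transfer_sum _ s n N.+1 (fun j x => p_ j * (\1_(cellset N j) x * h x)))//; last first.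
    by move=> j; exact: bmZ.
  rewrite mulr_suml -big_split; apply: eq_bigr => j _ /=.
  rewrite iter_transferZ// -mulrA -mulrDr; congr (_ * _).
  rewrite -(iter_density n Xx) -iter_transferZ// -iter_transferD//.
  - by apply: iter_transfer_eq => // y _; rewrite /centered subrK.
  - exact: centered_bm.
  - exact: bmZ.
have bLc j : bm (iter n L (centered (cellset N j))).
  by apply: iter_transfer_bm; exact: centered_bm.
have intLf' : \int[m]_(x in X) `|iter n L f' x| <= e / 2 + Hm * C1 / N%:R.
  pose a := \sum_(j < N.+1) p_ j * pr (cellset N j).
  pose b x := \sum_(j < N.+1) k^-1 * `|iter n L (centered (cellset N j)) x|.
  have bb : bm b.
    apply: (@bm_sum _ N.+1 (fun j x => k^-1 * `|iter n L (centered (cellset N j)) x|)) => j _.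
    by apply: bmZ; exact: bm_norm.
  apply: (@le_trans _ _ (\int[m]_(x in X) (b x + `|a| * `|h x|))).
    apply: Rint_le => //.
    - by apply: bm_norm; exact: iter_transfer_bm.
    - by apply: bmD => //; apply: bmZ; exact: bm_norm.
    move=> x Xx; rewrite Lf'// (le_trans (ler_normD _ _))// lerD//; last by rewrite normrM.
    apply: le_trans (ler_norm_sum _ _ _) _; apply: ler_sum => j _.
    by rewrite normrM ler_wpM2r//; apply: phib; apply: pX; rewrite -ltnS.
  rewrite RintD//; last by apply: bmZ; exact: bm_norm.
  apply: lerD.
    rewrite (@Rint_sum _ _ (fun j x => k^-1 * `|iter n L (centered (cellset N j)) x|))//; last first.
      by move=> j _; apply: bmZ; exact: bm_norm.
    apply: (@le_trans _ _ (\sum_(j < N.+1) k^-1 * e1)).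
      apply: ler_sum => j _; rewrite RintZ//; last exact: bm_norm.
      by rewrite ler_wpM2l ?(ltW ik0)// hn_.
    rewrite sumr_const card_ord -[leLHS]mulr_natr /e1 le_eqVlt; apply/orP; left; apply/eqP.
    have : N.+1%:R != 0 :> R by rewrite pnatr_eq0.
    by set z : R := N.+1%:R => z0; field; apply/andP; split; rewrite // gt_eqF.
  rewrite RintZ//; last exact: bm_norm.
  apply: le_trans intf'; rewrite -[leRHS]mulr1 ler_wpM2l//.
  exact: density_norm_int.
apply: (@le_trans _ _ (\int[m]_(x in X) `|f x - f' x| + \int[m]_(x in X) `|iter n L f' x|)).
  apply: le_trans (_ : _ <= \int[m]_(x in X) `|iter n L (fun x => f x - f' x) x| +
     \int[m]_(x in X) `|iter n L f' x|) _; last first.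
    by rewrite lerD2r; apply: iter_transfer_L1; exact: bmB.
  have bL1 : bm (iter n L (fun x => f x - f' x)) by apply: iter_transfer_bm; exact: bmB.
  have bL2 : bm (iter n L f') by exact: iter_transfer_bm.
  rewrite -RintD//; [|exact: bm_norm|exact: bm_norm].
  apply: Rint_le => //.
  - by apply: bm_norm; exact: iter_transfer_bm.
  - by apply: bmD; exact: bm_norm.
  move=> x Xx; rewrite iter_transferB//.
  by have := ler_normD (iter n L f x - iter n L f' x) (iter n L f' x); rewrite subrK.
have := lerD dist intLf'; move: hN.
rewrite -(mulrA 2); set i := Hm * C1 / N%:R; lra.
Qed.

Lemma iter_mean0 n f : bm f -> \int[m]_(x in X) f x = 0 ->
  \int[m]_(x in X) iter n L f x = 0.
Proof. by move=> bf f0; rewrite iter_transfer_int// XpreimageX. Qed.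

Lemma mean0_L1 f M : var f M -> \int[m]_(x in X) f x = 0 ->
  \int[m]_(x in X) `|f x| <= M.
Proof.
move=> vf f0; rewrite -[leRHS]Rint_cst; apply: Rint_le => //.
- by apply: bm_norm; exact: var_bm vf.
- exact: bm_cst.
by move=> x; exact: var_mean0.
Qed.

(** After [n1] steps the L1 norm is at most [M / (8 * (kappa + 1))]; after [m1.+1] further steps the
    Lasota-Yorke inequality leaves at most [M / 4] from the variation and [M / 4] from the L1
    norm. *)
Lemma contraction : exists2 n : nat, (0 < n)%N & forall f M, var f M -> subordinate f ->
  \int[m]_(x in X) f x = 0 -> var (iter n L f) (2^-1 * M).
Proof.
have k0 := kappa_ge0 s.
have e0 : 0 < (8 * (kappa + 1))^-1 by rewrite invr_gt0; lra.
have [n1 hn1] := uniform_decay e0.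
have q0 : 0 < 4^-1 :> R by lra.
have [m1 hm1] := half_small (1 + 2 * kappa) q0.
exists (m1 + n1).+1 => // f M vf sf f0.
have M0 := var_ge0 vf; have bf := var_bm vf.
rewrite -addSn iterD.
have v1 : var (iter n1 L f) (M + 2 * kappa * M).
  apply: var_weak (lasota_yorke_iter s n1 vf); apply: lerD.
    by rewrite ler_piMl// exprn_ile1//; lra.
  by rewrite ler_wpM2l ?mulr_ge0// mean0_L1.
apply: var_weak (lasota_yorke_iter s m1.+1 v1).
have := hn1 f M vf sf f0; set I := \int[m]_(x in X) _ => hI.
have hI2 : 2 * kappa * I <= 4^-1 * M.
  apply: (@le_trans _ _ (2 * kappa * ((8 * (kappa + 1))^-1 * M))).
    by rewrite ler_wpM2l// mulr_ge0.
  rewrite mulrA ler_wpM2r// ler_pdivrMr; lra.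
have := hm1 m1.+1 (leqnSn _) => hm.
have : 2^-1 ^+ m1.+1 * (1 + 2 * kappa) * M <= 4^-1 * M by rewrite ler_wpM2r.
by lra.
Qed.

Lemma iter_contraction : exists2 n : nat, (0 < n)%N & forall (q : nat) f M, var f M -> subordinate f ->
  \int[m]_(x in X) f x = 0 -> var (iter (n * q) L f) (2^-1 ^+ q * M).
Proof.
have [n n0 hn] := contraction; exists n => // q f M vf sf f0.
elim: q => [|q IH]; first by rewrite muln0 expr0 mul1r.
rewrite mulnS iterD exprS -mulrA; apply: hn => //.
- exact: subordinate_iter.
- by apply: iter_mean0 => //; exact: var_bm vf.
Qed.

(** For [r = 1 - 1 / (2 * n0)] Bernoulli's inequality gives [r ^+ n0 >= 1 / 2], so halving every
    [n0] steps is decay at rate [r]. The [t < n0] remaining steps cost a factor 2, and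
    [1 + 2 * kappa] by the Lasota-Yorke inequality. *)
Lemma exponential_decay : exists (C r : R), [/\ 0 < C, 0 < r, r < 1 &
  forall f M (n : nat) x, var f M -> subordinate f -> \int[m]_(x in X) f x = 0 -> X x ->
  `|iter n L f x| <= C * r ^+ n * M].
Proof.
have k0 := kappa_ge0 s.
have [n0 n00 hn0] := iter_contraction.
have n01 : 1 <= n0%:R :> R by rewrite ler1n.
pose r : R := 1 - (2 * n0%:R)^-1.
have i0 : 0 < (2 * n0%:R)^-1 :> R by rewrite invr_gt0 mulr_gt0// ltr0n.
have i1 : (2 * n0%:R)^-1 <= 2^-1 :> R by rewrite lef_pV2 ?posrE ?mulr_gt0 ?ltr0n//; lra.
have r0 : 0 < r by rewrite /r; lra.
have r1 : r < 1 by rewrite /r; lra.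
have bern n : 1 - n%:R * (2 * n0%:R)^-1 <= r ^+ n.
  by apply: bernoulli; rewrite (ltW i0)/=; lra.
have rn0 : 2^-1 <= r ^+ n0.
  apply: le_trans (bern n0); rewrite invfM mulrCA divff ?gt_eqF ?ltr0n//; lra.
exists (2 * (1 + 2 * kappa)), r; split => //; first by lra.
move=> f M n x vf sf f0 Xx.
have M0 := var_ge0 vf; have bf := var_bm vf.
pose q := (n %/ n0)%N; pose t := (n %% n0)%N.
have nE : n = (t + n0 * q)%N by rewrite addnC mulnC -divn_eq.
have vq := hn0 q f M vf sf f0.
have mq : \int[m]_(x in X) iter (n0 * q) L f x = 0 by exact: iter_mean0.
have vn : var (iter n L f) ((1 + 2 * kappa) * (2^-1 ^+ q * M)).
  rewrite nE iterD; apply: var_weak (lasota_yorke_iter s t vq).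
  rewrite [leRHS]mulrDl mul1r; apply: lerD.
    by rewrite ler_piMl ?exprn_ile1//; [rewrite mulr_ge0// exprn_ge0|]; lra.
  by rewrite ler_wpM2l ?mulr_ge0// mean0_L1.
apply: le_trans (var_mean0 vn _ Xx) _; first exact: iter_mean0.
have h1 : 2^-1 ^+ q <= r ^+ (n0 * q) 
  by rewrite exprM lerXn2r// nnegrE ?invr_ge0// exprn_ge0// (ltW r0).
have h2 : r ^+ (n0 * q) <= 2 * r ^+ n.
  rewrite nE exprD mulrA ler_peMl ?exprn_ge0// ?(ltW r0)//.
  have : r ^+ n0 <= r ^+ t by rewrite ler_wiXn2l ?(ltW r0) ?(ltW r1)// ltnW// ltn_mod.
  by lra.
rewrite (_ : 2 * (1 + 2 * kappa) * _ * M = (1 + 2 * kappa) * (2 * r ^+ n * M)); last by ring.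
by rewrite ler_wpM2l ?ler_wpM2r ?(le_trans h1)//; lra.
Qed.

(** Almost everywhere on [X], either [h] and [f] both vanish or [M <= M / k * h]. *)
Lemma density_bound_ae k (N0 : set (measurableTypeR R)) f M B :
  0 < k -> measurable N0 -> m N0 = 0%E ->
  (forall x, X x -> ~ N0 x -> h x = 0 \/ k <= h x) ->
  bm f -> subordinate f -> 0 <= M -> (forall x, X x -> `|f x| <= M) ->
  measurable B -> B `<=` X -> `|\int[m]_(x in B) f x| <= M / k * pr B.
Proof.
move=> k0 mN N00 hN bf sf M0 fM mB BX.
apply: le_trans (Rint_abs bf mB BX) _; rewrite (dens_pr H)// -RintZ//.
have b1 : bm (fun x => M * \1_N0 x) by apply: bmZ; exact: bm_indic.
have b2 : bm (fun x => M / k * h x) by exact: bmZ.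
apply: (@le_trans _ _ (\int[m]_(x in B) (M * \1_N0 x + M / k * h x))).
  apply: Rint_le => //; [exact: bm_norm|exact: bmD|].
  move=> x /BX Xx; have hx := dens_ge0 H Xx.
  have [nx|nx] := pselect (N0 x).
    by rewrite indicE mem_set// mulr1 ler_wpDr ?fM// mulr_ge0// divr_ge0// ltW.
  rewrite indicE memNset// mulr0 add0r.
  have [hx0|hxk] := hN x Xx nx; first by rewrite hx0 sf// normr0 mulr0.
  by apply: le_trans (fM _ Xx) _; rewrite -mulrA ler_peMr// mulrC ler_pdivlMr// mul1r.
rewrite le_eqVlt; apply/orP; left; apply/eqP.
apply: (@Rint_ae _ _ _ _ N0) => //; first exact: bmD.
by move=> x _ nx; rewrite indicE memNset// mulr0 add0r.
Qed.

Theorem cylinder_mixing : exists (C r : R), [/\ 0 < C, 0 < r, r < 1 &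
  forall (q n : nat) (W : seq nat -> Prop) B, measurable B -> B `<=` X ->
  `|pr ([set x | X x /\ W (itinerary s q x)] `&` Xpreimage S (n + q) B) -
    pr [set x | X x /\ W (itinerary s q x)] * pr B| <= C * r ^+ n * pr B].
Proof.
have k0 := kappa_ge0 s; have Mh0 : 0 <= Mh := var_ge0 (dens_var H).
have [C [r [C0 r0 r1 hC]]] := exponential_decay.
have [k [N0 [kpos mN0 N00 hN0]]] := density_dichotomy.
(* [Mh + 2 * kappa] comes from [cylinder_lasota_yorke], the integral of [h] being at most 1, and the
   second [Mh] from the multiple of [h] that is subtracted; the 1 makes the constant positive. *)
pose M2 := Mh + 2 * kappa + Mh + 1.
have M20 : 0 < M2 by rewrite /M2; lra.
exists (C * M2 / k), r; split => //; first by rewrite divr_gt0// mulr_gt0.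
move=> q n W B mB BX.
set A : set (measurableTypeR R) := [set x | _].
have mA : measurable A := measurable_itinerary s q W.
have AX : A `<=` X by move=> x [].
have p01 := pr_ge0_le1 P mA.
have indA x : X x -> \1_A x = cyl s q W x :> R.
  move=> Xx; rewrite indicE /cyl; case: asboolP => e; first by rewrite mem_set.
  by rewrite memNset// => -[].
pose D := iter q L (centered A).
have bD : bm D by apply: iter_transfer_bm; exact: centered_bm.
have bc : bm (fun x => cyl s q W x * h x) by apply: bmM => //; exact: cyl_bm.
have vD : var D M2.
  apply: (@var_eq _ (fun x => iter q L (fun x => cyl s q W x * h x) x - pr A * h x)).
    move=> x Xx; rewrite -(iter_density q Xx) -iter_transferZ// -iter_transferB//; last exact: bmZ.
    by apply: iter_transfer_eq => // y Xy; rewrite /centered indA.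
  apply: var_weak (varB (@cylinder_lasota_yorke _ s q W _ _ (dens_var H)) (varZ (pr A) (dens_var H))).
  have p0 : 0 <= 2^-1 ^+ q :> R by rewrite exprn_ge0.
  have p1 : 2^-1 ^+ q <= 1 :> R by rewrite exprn_ile1//; lra.
  have h1 : 2^-1 ^+ q * Mh <= Mh by rewrite ler_piMl.
  have h2 : `|pr A| * Mh <= Mh by case/andP: p01 => a1 a2; rewrite ger0_norm// ler_piMl.
  have h3 : kappa * (2 - 2 * 2^-1 ^+ q) * \int[m]_(x in X) `|h x| <= kappa * 2 * 1.
    rewrite ler_pM//; last exact: density_norm_int.
    - by rewrite mulr_ge0//; lra.
    - exact: Rintegral_ge0.
    - by rewrite ler_wpM2l//; lra.
  by rewrite /M2; lra.
have sD : subordinate D.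
  by apply: subordinate_iter => x Xx hx; rewrite /centered hx !mulr0 subrr.
have D0 : \int[m]_(x in X) D x = 0.
  rewrite /D iter_mean0//; first exact: centered_bm.
  have := centered_corr 0 mA AX mX (@subset_refl _ _); rewrite /= => ->.
  rewrite XpreimageX setIidl//.
  by rewrite PX /= mulr1 subrr.
have -> : pr (A `&` Xpreimage S (n + q) B) - pr A * pr B = \int[m]_(x in B) iter n L D x.
  by rewrite -centered_corr// /D -iterD.
have := @density_bound_ae k N0 (iter n L D) (C * r ^+ n * M2) B kpos mN0 N00 hN0.
have -> : C * M2 / k * r ^+ n = C * r ^+ n * M2 / k by ring.
apply => //.
- exact: iter_transfer_bm.
- exact: subordinate_iter.
- by rewrite mulr_ge0 ?(ltW M20)// mulr_ge0 ?(ltW C0)// exprn_ge0// ltW.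
- by move=> x Xx; exact: hC.
Qed.

End Contraction.

(** * Iterates of an AFU map *)

Lemma is_derive_within {R : realType} (D : set R) (f : R -> R) (x l : R) :
  nbhs x D -> has_derivative_within D f x l -> is_derive x 1 f l.
Proof.
move=> nD hl.
have cv : h^-1 *: ((f \o shift x) (h *: (1 : R)) - f x) @[h --> (0 : R)^'] --> l.
  apply/cvgrPdist_lt => e e0; move/cvgrPdist_lt : hl => /(_ e e0) hl.
  have : nbhs x (fun y => y != x -> D y -> `|l - (f y - f x) / (y - x)| < e) by [].
  move=> /(filterI nD) /nbhs_ballP[d /= d0 hd]; exists d => //= h.
  rewrite /ball /= sub0r normrN => hh h0.
  have [] := hd (h + x); first by rewrite /ball/= opprD addrCA subrr addr0 normrN.
  move=> Dh; rewrite addrK => /(_ _ Dh); rewrite /GRing.scale/= mulr1 mulrC; apply.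
  by rewrite -subr_eq0 addrK.
split; first by apply/cvg_ex; exists l.
exact: cvg_lim cv.
Qed.

(** * Images of open intervals under monotone functions *)

Section Intervals.
Context {R : realType}.
Implicit Types (a b c J : set R) (f q : R -> R) (x y z : R).
Local Notation X := (@X R).

Lemma mean_value_on a f q x y : is_interval a -> (forall z, a z -> is_derive z 1 f (q z)) ->
  a x -> a y -> x < y -> exists2 z, x < z < y & f y - f x = q z * (y - x).
Proof.
move=> ia da ax ay xy.
have da' z : z \in `[x, y] -> is_derive z 1 f (q z).
  by rewrite in_itv/= => hz; apply: da; apply: ia hz.
have dd z : z \in `]x, y[ -> is_derive z 1 f (q z) by move=> /subset_itv_oo_cc /da'.
have cf : {within `[x, y], continuous f}.
  by apply: derivable_within_continuous => t /da' [].
by have [z] := MVT xy dd cf; rewrite in_itv/= => hz ->; exists z.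
Qed.

Lemma intermediate_value_on a f q x y z : is_interval a ->
  (forall t, a t -> is_derive t 1 f (q t)) ->
  a x -> a y -> f x <= z <= f y -> exists2 t, a t & f t = z.
Proof.
move=> ia da.
have key x' y' : x' <= y' -> a x' -> a y' -> Num.min (f x') (f y') <= z <= Num.max (f x') (f y') ->
    exists2 t, a t & f t = z.
  move=> xy ax ay /(IVT xy)[].
    apply: derivable_within_continuous => t; rewrite in_itv/= => ht.
    by have [] := da t (ia _ _ ax ay _ ht).
  by move=> t; rewrite in_itv/= => ht <-; exists t => //; apply: ia ht.
move=> ax ay /andP[h1 h2].
have [xy|/ltW yx] := leP x y.
  by apply: key xy ax ay _; rewrite ge_min le_max h1 h2 orbT.
by apply: key yx ay ax _; rewrite ge_min le_max h1 h2 orbT.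
Qed.

Definition open_interval a : Prop :=
  exists u v : R, [/\ 0 <= u, u < v, v <= 1 & a = `]u, v[%classic].

Lemma open_interval_ind a : open_interval a ->
  [/\ open a, is_interval a, a !=set0 & a `<=` X].
Proof.
move=> [u [v [u0 uv v1 ->]]]; split.
- exact: interval_open.
- exact: interval_is_interval.
- by exists ((u + v) / 2); rewrite /= in_itv/=; apply/andP; split; lra.
- by move=> x; rewrite /= in_itv/= => /andP[? ?]; apply/inX; apply/andP; split; lra.
Qed.

Lemma open_intervalI a : open a -> is_interval a -> a !=set0 -> a `<=` X ->
  open_interval a /\ a = `]inf a, sup a[%classic.
Proof.
move=> oa ia a0 aX.
have l0 : lbound a 0 by move=> x /aX /inX /andP[].
have u1 : ubound a 1 by move=> x /aX /inX /andP[].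
have aE : a = `]inf a, sup a[%classic.
  have /interior_id {1}<- := oa.
  rewrite (interval_bounded_interior ia (ex_intro _ 0 l0) (ex_intro _ 1 u1)).
  by apply/seteqP; split => x; rewrite /= in_itv.
split => //; exists (inf a), (sup a); split => //.
- exact: lb_le_inf.
- case: a0 => x ax; have : `]inf a, sup a[%classic x by rewrite -aE.
  by rewrite /= in_itv/= => /andP[]; exact: lt_trans.
- exact: ge_sup.
Qed.

(** By the mean value theorem, points of [a] on the two sides of [x] have images on the two sides of
    [f x], so the image is open; it is an interval by the intermediate value theorem. *)
Lemma open_interval_image a f q : open_interval a ->
  (forall x, a x -> is_derive x 1 f (q x)) -> (forall x, X x -> X (f x)) ->
  (forall x, a x -> 0 < q x) \/ (forall x, a x -> q x < 0) ->
  open_interval (f @` a).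
Proof.
move=> oia da fX sq.
have [oa ia [x0 ax0] aX] := open_interval_ind oia.
apply: (proj1 (open_intervalI _ _ _ _)).
- rewrite openE => _ [x ax <-].
  have /nbhs_ballP[d /= d0 hd] := open_nbhs_nbhs (conj oa ax).
  have b1 : a (x - d / 2).
    by apply: hd; rewrite /ball/= opprB addrCA subrr addr0 gtr0_norm; lra.
  have b2 : a (x + d / 2).
    by apply: hd; rewrite /ball/= opprD addrA subrr sub0r normrN gtr0_norm; lra.
  have d1 : x - d / 2 < x by lra.
  have d2 : x < x + d / 2 by lra.
  have [z1 hz1 e1] := mean_value_on ia da b1 ax d1.
  have [z2 hz2 e2] := mean_value_on ia da ax b2 d2.
  have a1 : a z1 by apply: ia b1 ax _ _; case/andP: hz1 => *; apply/andP; split; exact: ltW.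
  have a2 : a z2 by apply: ia ax b2 _ _; case/andP: hz2 => *; apply/andP; split; exact: ltW.
  have s1 : 0 < x - (x - d / 2) by lra.
  have s2 : 0 < x + d / 2 - x by lra.
  case: sq => sq.
    have p1 : 0 < q z1 * (x - (x - d / 2)) by rewrite mulr_gt0// sq.
    have p2 : 0 < q z2 * (x + d / 2 - x) by rewrite mulr_gt0// sq.
    have /filterS : `]f (x - d / 2), f (x + d / 2)[%classic `<=` f @` a.
      move=> z; rewrite /= in_itv/= => /andP[h1 h2].
      have [|t at_ <-] := intermediate_value_on (z := z) ia da b1 b2; last by exists t.
      by rewrite !ltW.
    by apply; apply: open_nbhs_nbhs; split; [exact: interval_open | rewrite /= in_itv/=; apply/andP; split; lra].
  have p1 : q z1 * (x - (x - d / 2)) < 0 by rewrite nmulr_rlt0// sq.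
  have p2 : q z2 * (x + d / 2 - x) < 0 by rewrite nmulr_rlt0// sq.
  have /filterS : `]f (x + d / 2), f (x - d / 2)[%classic `<=` f @` a.
    move=> z; rewrite /= in_itv/= => /andP[h1 h2].
    have [|t at_ <-] := intermediate_value_on (z := z) ia da b2 b1; last by exists t.
    by rewrite !ltW.
  by apply; apply: open_nbhs_nbhs; split; [exact: interval_open | rewrite /= in_itv/=; apply/andP; split; lra].
- move=> _ _ [x ax <-] [y ay <-] z hz.
  by have [t at_ <-] := intermediate_value_on ia da ax ay hz; exists t.
- by exists (f x0), x0.
- by move=> _ [x /aX Xx <-]; exact: fX.
Qed.

End Intervals.

(* q is 1 / T' and q1 is its derivative; the bound on q1 = - T'' / (T') ^ 2 is
   the form of condition (A) that is inherited by iterates. *)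
Record expanding_map (R : realType) (T : R -> R) (al : set (set R)) (lam A : R)
    (q q1 : R -> R) : Prop := {
  em_lam0 : 0 < lam ;
  em_A0 : 0 <= A ;
  em_X : forall x, X x -> X (T x) ;
  em_meas : measurable_fun (X : set (measurableTypeR R))
    (T : measurableTypeR R -> measurableTypeR R) ;
  em_count : countable al ;
  em_itv : forall a, al a -> open_interval a ;
  em_disj : forall a b x, al a -> al b -> a x -> b x -> a = b ;
  em_cover : (@lebesgue_measure R) (X `\` \bigcup_(a in al) a) = 0%E ;
  em_null : forall B : set (measurableTypeR R), measurable B -> B `<=` X ->
    (@lebesgue_measure R) B = 0%E -> (@lebesgue_measure R) (Xpreimage T 1 B) = 0%E ;
  em_sign : forall a, al a -> (forall x, a x -> 0 < q x) \/ (forall x, a x -> q x < 0) ;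
  em_der : forall a x, al a -> a x -> is_derive x 1 T (q x)^-1 ;
  em_der2 : forall a x, al a -> a x -> is_derive x 1 q (q1 x) ;
  em_lam : forall a x, al a -> a x -> `|q x| <= lam^-1 ;
  em_dist : forall a x, al a -> a x -> `|q1 x| <= A ;
  em_images : finite_set [set T @` a | a in al] }.

Definition joined {R : realType} (T : R -> R) (al be : set (set R)) : set (set R) :=
  [set c | c !=set0 /\ exists2 a, al a & exists2 b, be b & c = a `&` T @^-1` b].

Section Composition.
Context {R : realType}.
Local Notation m := (@lebesgue_measure R).
Local Notation X := (@X R).
Implicit Types (a b c : set R) (x y z : R).

Lemma measurable_bigcup_open (al : set (set R)) : (forall a, al a -> open_interval a) ->
  measurable (\bigcup_(a in al) a : set (measurableTypeR R)).
Proof.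
move=> h; apply: open_measurable; apply: bigcup_open => a ala.
by have [] := open_interval_ind (h a ala).
Qed.

Context (T S : R -> R) (al be : set (set R)) (lam A lam' A' : R) (q q1 p p1 : R -> R).
Hypotheses (hT : expanding_map T al lam A q q1) (hS : expanding_map S be lam' A' p p1).

Lemma inverse_derivative_neq0 a x : al a -> a x -> q x != 0.
Proof.
by move=> ala ax; have [/(_ _ ax)|/(_ _ ax)] := em_sign hT ala => h; [rewrite gt_eqF|rewrite lt_eqF].
Qed.

Lemma branch_continuous a x : al a -> a x -> {for x, continuous T}.
Proof.
move=> ala ax; apply: differentiable_continuous; apply/derivable1_diffP.
by have [] := em_der hT ala ax.
Qed.

Lemma joined_itv c : joined T al be c -> open_interval c.
Proof.
move=> [c0 [a ala [b beb cE]]].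
have [oa ia _ aX] := open_interval_ind (em_itv hT ala).
have [ob ib _ bX] := open_interval_ind (em_itv hS beb).
apply: (proj1 (open_intervalI _ _ c0 _)); rewrite ?cE.
- rewrite openE => x [ax bTx]; apply: filterI.
    exact: open_nbhs_nbhs.
  by apply: (branch_continuous ala ax); exact: open_nbhs_nbhs.
- move=> x y [ax bx] [ay by_] z hz; have az : a z by apply: ia hz.
  split => //=; move: hz => /andP[xz zy].
  have mono t t' : a t -> a t' -> t <= t' -> ((forall x, a x -> 0 < q x) -> T t <= T t') /\
      ((forall x, a x -> q x < 0) -> T t' <= T t).
    move=> at_ at'; rewrite le_eqVlt => /predU1P[->//|tt'].
    have [s hs e] := mean_value_on ia (fun z => em_der hT ala) at_ at' tt'.
    have as_ : a s by apply: ia at_ at' _ _; case/andP: hs => *; apply/andP; split; exact: ltW.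
    have tt0 : 0 <= t' - t by lra.
    split => h; rewrite -subr_ge0 -?(oppr_le0 (T t - T t')) ?opprB e.
      by rewrite mulr_ge0// invr_ge0 ltW// h.
    by rewrite mulr_le0_ge0// invr_le0 ltW// h.
  have [m1 m2] := mono _ _ ax az xz; have [m3 m4] := mono _ _ az ay zy.
  have [h|h] := em_sign hT ala.
    by apply: (ib _ _ bx by_); rewrite m1// m3.
  by apply: (ib _ _ by_ bx); rewrite m2// m4.
- by move=> x [/aX].
Qed.

Lemma joined_disj c c' x : joined T al be c -> joined T al be c' -> c x -> c' x -> c = c'.
Proof.
move=> [_ [a ala [b beb ->]]] [_ [a' ala' [b' beb' ->]]] [ax bx] [ax' bx'].
by rewrite (em_disj hT ala ala' ax ax') (em_disj hS beb beb' bx bx').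
Qed.

Lemma joined_countable : countable (joined T al be).
Proof.
have c2 := countableX (em_count hT) (em_count hS).
apply: sub_countable c2.
apply: card_le_trans (card_image_le (fun ab => ab.1 `&` T @^-1` ab.2) _).
apply: subset_card_le => c [_ [a ala [b beb ->]]]; by exists (a, b).
Qed.

Lemma joined_cover : m (X `\` \bigcup_(c in joined T al be) c) = 0%E.
Proof.
pose N1 : set (measurableTypeR R) := X `\` \bigcup_(a in al) a.
pose N2 : set (measurableTypeR R) := X `\` \bigcup_(b in be) b.
have mN1 : measurable N1.
  by apply: measurableD; [exact: measurable_X | exact: measurable_bigcup_open (em_itv hT)].
have mN2 : measurable N2.
  by apply: measurableD; [exact: measurable_X | exact: measurable_bigcup_open (em_itv hS)].
have mN3 := measurable_Xpreimage1 (em_meas hT) mN2.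
apply: (@subset_measure0 _ _ _ m _ (N1 `|` Xpreimage T 1 N2)).
- apply: measurableD; first exact: measurable_X.
  exact: measurable_bigcup_open joined_itv.
- exact: measurableU.
- move=> x [Xx nx]; have [[a ala ax]|na] := pselect ((\bigcup_(a in al) a) x); last by left.
  right; split => //; split; first exact: (em_X hT).
  move=> [b beb bx]; apply: nx; exists (a `&` T @^-1` b) => //.
  by split; [exists x | exists a => //; exists b].
transitivity (m N1); last exact: (em_cover hT).
apply: (@measureU0 _ _ _ m) => //.
by apply: (em_null hT) => //; [move=> x [] | exact: (em_cover hS)].
Qed.

(** A piece [b] that meets the image [J] of a branch of [T] is either contained in [J], and then it
    yields one of the images of [S], or it contains [inf J] or [sup J], which leaves at most two
    pieces for each of the finitely many [J]. *)
Lemma joined_images : finite_set [set (S \o T) @` c | c in joined T al be].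
Proof.
pose piece x : set R := xget set0 [set b | be b /\ b x].
pose F J : set (set R) := [set S @` (J `&` piece (inf J)); S @` (J `&` piece (sup J))].
apply: (@sub_finite_set _ _ ([set S @` b | b in be] `|`
    \bigcup_(J in [set T @` a | a in al]) F J)); last first.
  rewrite finite_setU; split; first exact: (em_images hS).
  apply: bigcup_finite; first exact: (em_images hT).
  by move=> J _; exact: finite_set2.
move=> _ [c [[x0 hx0] [a ala [b beb cE]]] <-].
rewrite {}cE in hx0 *; case: hx0 => ax0 bx0.
have ST : (S \o T) @` (a `&` T @^-1` b) = S @` (T @` a `&` b).
  apply/seteqP; split => z.
    by move=> [x [ax bx] <-]; exists (T x) => //; split => //; exists x.
  by move=> [_ [[x ax <-] bx] <-]; exists x.
rewrite ST; set J := T @` a.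
have oJ : open_interval J.
  apply: open_interval_image (em_itv hT ala) (fun x => em_der hT ala) (em_X hT) _.
  by have [h|h] := em_sign hT ala; [left|right] => x /h; rewrite ?invr_gt0 ?invr_lt0.
have [oJ' iJ J0 JX] := open_interval_ind oJ.
have [_ JE] := open_intervalI oJ' iJ J0 JX.
have [bJ|nbJ] := pselect (b `<=` J).
  by left; exists b => //; rewrite setIidr.
right; exists J; first by exists a.
have pE x : b x -> piece x = b.
  move=> bx; rewrite /piece; case: xgetP => [b' _ [beb' b'x]|/(_ b)[]//].
  exact: (@em_disj _ _ _ _ _ _ _ hS b' b x).
have [_ ib _ _] := open_interval_ind (em_itv hS beb).
have /existsNP[y /not_implyP[by_ nJy]] := nbJ.
have : `]inf J, sup J[%classic (T x0) by rewrite -JE; exists x0.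
have : ~ `]inf J, sup J[%classic y by rewrite -JE.
rewrite /= !in_itv/= => /negP; rewrite negb_and -!leNgt => h /andP[h1 h2]; case/orP: h => h.
  by left; rewrite pE//; apply: (ib _ _ by_ bx0); rewrite h ltW.
by right; rewrite pE//; apply: (ib _ _ bx0 by_); rewrite h ltW.
Qed.

(** With [q = 1 / T'] and [p = 1 / S'], the reciprocal of the derivative of [S \o T] is
    [p (T x) * q x]. In its derivative the factor [T' * q = 1] cancels, and what remains is bounded
    by [A' + A / lam']. *)
Theorem expanding_map_comp : expanding_map (S \o T) (joined T al be) (lam * lam')
  (A' + A / lam') (fun x => p (T x) * q x) (fun x => p1 (T x) + p (T x) * q1 x).
Proof.
have l0 := em_lam0 hT; have l'0 := em_lam0 hS.
split.
- exact: mulr_gt0.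
- by rewrite addr_ge0 ?(em_A0 hS)// divr_ge0 ?(em_A0 hT)// ltW.
- by move=> x Xx; apply: (em_X hS); exact: (em_X hT).
- apply: (@measurable_comp _ _ _ _ _ _ (X : set (measurableTypeR R))) => //.
  + exact: measurable_X.
  + by move=> _ [x Xx <-]; exact: (em_X hT).
  + exact: (em_meas hS).
  + exact: (em_meas hT).
- exact: joined_countable.
- exact: joined_itv.
- exact: joined_disj.
- exact: joined_cover.
- move=> B mB BX B0.
  have -> : Xpreimage (S \o T) 1 B = Xpreimage T 1 (Xpreimage S 1 B).
    by apply/seteqP; split => x [Xx] /=; [split => //; split => //; exact: (em_X hT) | move=> []].
  apply: (em_null hT); [exact: (measurable_Xpreimage1 (em_meas hS) mB) | by move=> x [] |].
  exact: (em_null hS).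
- move=> _ [_ [a ala [b beb ->]]].
  have [h1|h1] := em_sign hT ala; have [h2|h2] := em_sign hS beb.
  + by left => x [ax bx]; rewrite mulr_gt0 ?h1 ?h2.
  + by right => x [ax bx]; rewrite nmulr_rlt0 ?h1 ?h2.
  + by right => x [ax bx]; rewrite pmulr_rlt0 ?h1 ?h2.
  + by left => x [ax bx]; rewrite nmulr_rgt0 ?h1 ?h2.
- move=> _ x [_ [a ala [b beb ->]]] [ax bx].
  have := is_derive1_comp (em_der hS beb bx) (em_der hT ala ax).
  by rewrite invfM.
- move=> _ x [_ [a ala [b beb ->]]] [ax bx].
  have dp := is_derive1_comp (em_der2 hS beb bx) (em_der hT ala ax).
  apply: is_derive_eq (is_deriveM dp (em_der2 hT ala ax)) _.
  rewrite /GRing.scale/= addrC; congr (_ + _).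
  by rewrite mulrCA mulfV ?mulr1// (inverse_derivative_neq0 ala ax).
- move=> _ x [_ [a ala [b beb ->]]] [ax bx].
  by rewrite invfM normrM mulrC ler_pM// ?(em_lam hT ala ax)// (em_lam hS beb bx).
- move=> _ x [_ [a ala [b beb ->]]] [ax bx].
  rewrite (le_trans (ler_normD _ _))// lerD ?(em_dist hS beb bx)//.
  by rewrite normrM mulrC ler_pM// ?(em_dist hT ala ax)// (em_lam hS beb bx).
- exact: joined_images.
Qed.

End Composition.

Fixpoint pieces {R : realType} (T : R -> R) (al : set (set R)) n :=
  if n is n'.+1 then joined T al (pieces T al n') else al.

(** The distortion constants are the partial sums of [A * (1 + lam^-1 + lam^-2 + ...)]: they stay
    bounded, whereas the expansion [lam ^+ n.+1] does not. *)
Lemma expanding_map_iter {R : realType} (T : R -> R) (al : set (set R)) (lam A : R)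
    (q q1 : R -> R) n : 1 < lam -> expanding_map T al lam A q q1 ->
  exists p p1, expanding_map (iter n.+1 T) (pieces T al n) (lam ^+ n.+1)
    (A * lam / (lam - 1) * (1 - lam^-1 ^+ n.+1)) p p1.
Proof.
move=> lam1 hT; have l1 : lam - 1 != 0 by rewrite subr_eq0 gt_eqF.
have l0 : lam != 0 by rewrite gt_eqF//; lra.
elim: n => [|n [p [p1 IH]]].
  exists q, q1; rewrite !expr1.
  have -> : A * lam / (lam - 1) * (1 - lam^-1) = A by field; rewrite l0 l1.
  exact: hT.
have := expanding_map_comp hT IH; rewrite -exprS.
have -> : iter n.+1 T \o T = iter n.+2 T by apply/funext => x; rewrite /= -iterSr.
rewrite -[A / _](_ : A * lam^-1 ^+ n.+1 = _) ?exprVn//.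
have -> : A * lam / (lam - 1) * (1 - (lam ^+ n.+1)^-1) + A * (lam ^+ n.+1)^-1 =
   A * lam / (lam - 1) * (1 - (lam ^+ n.+2)^-1).
  rewrite [lam ^+ n.+2]exprS; have : lam ^+ n.+1 != 0 by rewrite expf_neq0.
  by set z := lam ^+ n.+1 => z0; field; rewrite z0 l1 l0.
by eexists; eexists; eassumption.
Qed.

Lemma is_derive_increasing_ge0 {R : realType} (a : set R) (f : R -> R) (x l : R) :
  nbhs x a -> is_derive x 1 f l -> (forall y z, a y -> a z -> y < z -> f y < f z) -> 0 <= l.
Proof.
move=> na [df <-] mono; apply: limr_ge => //.
have ax := nbhs_singleton na.
have /nbhs_ballP[d /= d0 hd] := na; exists d => //= h.
rewrite /ball/= sub0r normrN => hh h0.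
have ah : a (h + x) by apply: hd; rewrite /ball/= opprD addrCA subrr addr0 normrN.
rewrite /GRing.scale/= mulr1; have [hl|hg|he] := ltgtP h 0; last by rewrite he eqxx in h0.
- rewrite mulr_le0// ?invr_le0 ?subr_le0 ltW//; apply: mono => //; lra.
- rewrite mulr_ge0// ?invr_ge0 ?subr_ge0 ltW//; apply: mono => //; lra.
Qed.

(** * AFU maps as expanding maps *)

Section Base.
Context {R : realType} (T : R -> R) (alpha : set (set R)).
Hypothesis hT : is_AFU_map T alpha.
Implicit Types (a : set R) (x y : R).

Lemma AFU_interval a : alpha a -> open_interval a.
Proof. exact: (PM_interval hT). Qed.

(** The derivatives of the extension [g] are taken within the closure of [a]; at points of the open
    interval [a] they are ordinary derivatives of [T]. *)
Lemma AFU_derivatives a x : alpha a -> a x ->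
  is_derive x 1 T (derive1 T x) /\ is_derive x 1 (derive1 T) (derive1n 2 T x).
Proof.
move=> ala; have [g gT [_ [f1 [f2 [d1 d2 _]]] _]] := AFU_C2 hT ala.
have [oa _ _ _] := open_interval_ind (AFU_interval ala).
have nx y : a y -> nbhs y a by move=> ay; exact: open_nbhs_nbhs.
have ncl y : a y -> nbhs y (closure a) by move=> /nx; apply: filterS; exact: subset_closure.
have T1 y : a y -> is_derive y 1 T (f1 y).
  move=> ay; apply: near_eq_is_derive (is_derive_within (ncl y ay) (d1 y (subset_closure ay))).
  by apply: filterS (nx y ay) => z az; apply: gT; rewrite inE.
have f1E y : a y -> derive1 T y = f1 y.
  by move=> /T1 h; rewrite derive1E; exact: derive_val.
have T2 y : a y -> is_derive y 1 (derive1 T) (f2 y).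
  move=> ay; apply: near_eq_is_derive (is_derive_within (ncl y ay) (d2 y (subset_closure ay))).
  by apply: filterS (nx y ay) => z az; rewrite f1E.
move=> ax; split; first by rewrite f1E//; exact: T1.
have -> : derive1n 2 T x = f2 x; last exact: T2.
by have h := T2 x ax; rewrite /= derive1E; exact: derive_val.
Qed.

Lemma AFU_lam : exists2 lam : R, 1 < lam & forall a x, alpha a -> a x -> lam <= `|derive1 T x|.
Proof.
have := AFU_U hT; set E := (X in ereal_inf X).
have lb a x : alpha a -> a x -> (ereal_inf E <= `|derive1 T x|%:E)%E.
  by move=> ala ax; apply: ereal_inf_lbound; exists x => //; exists a.
case: (ereal_inf E) lb => [r| |] lb //.
- by rewrite lte_fin => r1; exists r => // a x ala ax; have := lb a x ala ax; rewrite lee_fin.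
(* An infinite infimum means that there are no branches, and then any [lam] will do. *)
- by move=> _; exists 2; [lra | move=> a x ala ax; have := lb a x ala ax; rewrite leye_eq].
Qed.

Lemma AFU_dist : exists2 A : R, 0 <= A & forall a x, alpha a -> a x ->
  `|derive1n 2 T x| / derive1 T x ^+ 2 <= A.
Proof.
have := AFU_A hT; set E := (X in ereal_sup X).
have ub a x : alpha a -> a x -> ((`|derive1n 2 T x| / derive1 T x ^+ 2)%:E <= ereal_sup E)%E.
  by move=> ala ax; apply: ereal_sup_ubound; exists x => //; exists a.
case: (ereal_sup E) ub => [r| |] ub //.
- move=> _; exists `|r| => // a x ala ax.
  by apply: le_trans (ler_norm r); have := ub a x ala ax; rewrite lee_fin.
- by move=> _; exists 0 => // a x ala ax; have := ub a x ala ax; rewrite leeNy_eq.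
Qed.

(** Monotonicity gives the weak inequality, and expansion excludes the value 0. *)
Lemma AFU_sign a : alpha a ->
  (forall x, a x -> 0 < derive1 T x) \/ (forall x, a x -> derive1 T x < 0).
Proof.
move=> ala; have [lam lam1 hlam] := AFU_lam.
have [oa _ _ _] := open_interval_ind (AFU_interval ala).
have nx y : a y -> nbhs y a by move=> ay; exact: open_nbhs_nbhs.
have n0 x : a x -> derive1 T x != 0.
  by move=> ax; have := hlam a x ala ax; rewrite -normr_gt0; lra.
have [mono|mono] := PM_monotonic hT ala; [left|right] => x ax; rewrite lt_neqAle.
- rewrite eq_sym n0//=.
  apply: is_derive_increasing_ge0 (nx x ax) (proj1 (AFU_derivatives ala ax)) _.
  by move=> y z ay az; apply: mono; rewrite inE.
- rewrite n0//= -oppr_ge0.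
  apply: is_derive_increasing_ge0 (nx x ax) (is_deriveN (proj1 (AFU_derivatives ala ax))) _.
  by move=> y z ay az yz; rewrite ltrN2; apply: mono; rewrite ?inE.
Qed.

Lemma AFU_expanding_map : exists lam A : R, 1 < lam /\
  expanding_map T alpha lam A (fun x => (derive1 T x)^-1)
    (fun x => - derive1 T x ^- 2 * derive1n 2 T x).
Proof.
have [lam lam1 hlam] := AFU_lam; have [A A0 hA] := AFU_dist.
exists lam, A; split => //; split => //.
- lra.
- exact: (PM_self hT).
- exact: (PM_measurable hT).
- exact: (PM_countable hT).
- exact: AFU_interval.
- by move=> a b x ala alb ax bx; apply: (PM_disjoint hT ala alb); exists x.
- exact: (PM_cover hT).
- exact: (PM_nonsingular hT).
- move=> a ala; have [h|h] := AFU_sign ala; [left|right] => x /h.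
    by rewrite invr_gt0.
  by rewrite invr_lt0.
- by move=> a x ala ax; rewrite invrK; have [] := AFU_derivatives ala ax.
- move=> a x ala ax; have [_ d2] := AFU_derivatives ala ax.
  apply: (@is_deriveV _ (derive1 T)) => //.
  by rewrite -normr_gt0; have := hlam a x ala ax; lra.
- move=> a x ala ax; have := hlam a x ala ax => h.
  by rewrite normfV lef_pV2 ?posrE//; lra.
- move=> a x ala ax; apply: le_trans (hA a x ala ax).
  by rewrite normrM normrN normfV normrX mulrC real_normK// num_real.
- exact: (AFU_F hT).
Qed.

End Base.

(** * Change of variables on a branch *)

Section Induction.
Context {R : realType}.
Local Notation X := (@X R).
Implicit Types (f g : R -> R) (x y z : R) (E : set (measurableTypeR R)).

Variable Q : (R -> R) -> Prop.
Hypotheses (Q_eq : forall f g, (forall x, X x -> f x = g x) -> Q f -> Q g)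
  (QD : forall f g, bm f -> bm g -> Q f -> Q g -> Q (fun x => f x + g x))
  (QZ : forall k f, bm f -> Q f -> Q (fun x => k * f x))
  (Q_limit : forall (f : nat -> R -> R) g M, (forall n, bm (f n)) -> bm g ->
    (forall n x, X x -> `|f n x| <= M) ->
    (forall x, X x -> f n x @[n --> \oo] --> g x) -> (forall n, Q (f n)) -> Q g)
  (Q1 : Q (fun=> 1)) (Q_ray : forall p, Q (\1_(`]p, +oo[%classic))).

Let indic_bound E x : `|\1_E x| <= 1 :> R.
Proof. by rewrite indicE; case: (_ \in _); rewrite ?normr1 ?normr0. Qed.

(** Dynkin's argument: rays are stable under intersection and generate the Borel sets; [QD] and [QZ]
    give complements, and [Q_limit] gives countable disjoint unions. *)
Let Q_indic E : measurable E -> Q (\1_E).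
Proof.
rewrite RGenOInfty.measurableE.
apply: (@dynkin_induction _ (measurableTypeR R) (@RGenOInfty.G R) (fun E => Q (\1_E))).
- by rewrite RGenOInfty.measurableE.
- move=> _ _ [p ->] [q ->]; exists (Num.max p q).
  by apply/seteqP; split => x; rewrite /= !in_itv/= !andbT gt_max => /andP.
- by apply: Q_eq Q1 => x _; rewrite indicE mem_set.
- by move=> _ [p ->]; exact: Q_ray.
- move=> {}E mE QE; apply: (@Q_eq (fun x => 1 + -1 * \1_E x)).
    by move=> x _; rewrite !indicE in_setC; case: (x \in E); rewrite ?mulr1 ?subrr ?mulr0 ?addr0.
  by apply: QD => //; [exact: bm_cst | apply: bmZ; exact: bm_indic | apply: QZ => //; exact: bm_indic].
- move=> F mF tF QF.
  pose U n : set (measurableTypeR R) := [set x | exists2 i, (i < n)%N & F i x].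
  have US n : U n.+1 = U n `|` F n.
    apply/seteqP; split => x.
      move=> [i]; rewrite ltnS leq_eqVlt => /predU1P[->|i_n] Fx; first by right.
      by left; exists i.
    move=> [[i i_n Fx]|Fx]; [by exists i => //; rewrite ltnW | by exists n].
  have mU n : measurable (U n).
    elim: n => [|n IH]; last by rewrite US; exact: measurableU.
    by rewrite (_ : U 0%N = set0)//; apply/seteqP; split => x // -[].
  have QU n : Q (\1_(U n)).
    elim: n => [|n IH].
      apply: (@Q_eq (fun x => 0 * 1)); last by apply: QZ => //; exact: bm_cst.
      by move=> x _; rewrite mul0r indicE memNset// => -[].
    apply: (@Q_eq (fun x => \1_(U n) x + \1_(F n) x)); last by apply: QD => //; exact: bm_indic.
    move=> x _; rewrite !indicE US in_setU.
    have [|] := boolP (x \in U n); rewrite ?add0r// inE => -[i i_n Fix].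
    rewrite memNset ?addr0// => Fnx; have ne : F i `&` F n !=set0 by exists x.
    by have e := tF i n I I ne; rewrite e ltnn in i_n.
  apply: (@Q_limit (fun n => \1_(U n)) _ 1) => //.
  + by move=> n; exact: bm_indic.
  + by apply: bm_indic; exact: bigcup_measurable.
  + move=> x _; have [[i _ Fx]|nF] := pselect ((\bigcup_k F k) x).
      rewrite indicE mem_set//; last by exists i.
      apply: cvg_near_cst; exists i.+1 => // n /= ni; rewrite indicE mem_set//.
      by exists i.
    rewrite indicE memNset//; apply: cvg_near_cst; apply: nearW => n.
    by rewrite indicE memNset// => -[i _ Fx]; apply: nF; exists i.
Qed.

(** After an affine change that brings the values into [[0, 1]], each value is rounded down to the
    left end of its cell; the rounded functions are combinations of indicators and converge to
    [f]. *)
Lemma bm_induction f : bm f -> Q f.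
Proof.
move=> bf; have [M0 M00 fM0] := bm_bound bf.
pose M := M0 + 1; have Mgt : 0 < M by rewrite /M; lra.
have fM x : X x -> `|f x| <= M by move=> /fM0; rewrite /M; lra.
pose g x := (2 * M)^-1 * (f x + M).
have bg : bm g by apply: bmZ; apply: bmD => //; exact: bm_cst.
have gX x : X x -> X (g x).
  move=> /fM; rewrite ler_norml => /andP[h1 h2]; apply/inX.
  rewrite /g mulr_ge0 ?invr_ge0//; [|lra|lra].
  by rewrite ler_pdivrMl; lra.
pose E N j : set (measurableTypeR R) := [set x | X x /\ cell N (g x) = j].
have mE N j : measurable (E N j).
  have [mc _] := @cellfun_bm R N j; have [mg _] := bg.
  have -> : E N j = X `&` (cellfun N j \o g) @^-1` [set 1].
    apply/seteqP; split => x [Xx hx]; split => //.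
      by rewrite /= /cellfun hx eqxx.
    move: hx; rewrite /= /cellfun; case: eqP => // _ /eqP.
    by rewrite eq_sym oner_eq0.
  apply: (@measurable_comp _ _ _ _ _ _ (X : set (measurableTypeR R)) (cellfun N j)) => //.
  + exact: measurable_X.
  + by move=> _ [x Xx <-]; exact: gX.
  + exact: measurable_X.
pose fN n x := 2 * M * \sum_(j < n.+2) ((j : nat)%:R / n.+1%:R) * \1_(E n.+1 j) x + - M * 1.
have fNE n x : X x -> fN n x = 2 * M * ((cell n.+1 (g x))%:R / n.+1%:R) - M.
  move=> Xx; rewrite /fN mulr1; congr (_ * _ - _).
  rewrite -(cell_sum n.+1 (fun j => j%:R / n.+1%:R) (gX _ Xx)); apply: eq_bigr => j _.
  congr (_ * _); rewrite indicE /cellfun; case: eqP => e; first by rewrite mem_set.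
  by rewrite memNset// => -[].
have bsum n k : bm (fun x => \sum_(j < k) ((j : nat)%:R / n.+1%:R) * \1_(E n.+1 j) x).
  apply: (@bm_sum _ k (fun j x => (j%:R / n.+1%:R) * \1_(E n.+1 j) x)) => j _.
  by apply: bmZ; exact: bm_indic.
have Qsum n k : Q (fun x => \sum_(j < k) ((j : nat)%:R / n.+1%:R) * \1_(E n.+1 j) x).
  elim: k => [|k IH].
    apply: (@Q_eq (fun x => 0 * 1)); last by apply: QZ => //; exact: bm_cst.
    by move=> x _; rewrite mul0r big_ord0.
  apply: Q_eq (QD (bsum n k) _ IH (QZ (k%:R / n.+1%:R) (bm_indic (mE n.+1 k)) (Q_indic (mE n.+1 k)))).
    by move=> x _; rewrite big_ord_recr.
  by apply: bmZ; exact: bm_indic.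
apply: (@Q_limit fN _ (3 * M)) => //.
- by move=> n; apply: bmD; apply: bmZ => //; exact: bm_cst.
- move=> n x Xx; rewrite fNE//; set z := _ / _.
  have /inX/andP[g0 g1] := gX _ Xx; have /andP[c1 c2] := cell_itv n.+1 (gX _ Xx).
  have z0 : 0 <= z by rewrite divr_ge0.
  have z1 : z <= 1.
    rewrite ler_pdivrMr ?ltr0n// mul1r; apply: le_trans c1 _.
    by rewrite ler_piMr.
  have h1 : 2 * M * z <= 2 * M * 1 by rewrite ler_wpM2l//; lra.
  have h0 : 0 <= 2 * M * z by rewrite !mulr_ge0//; lra.
  by rewrite ler_norml; apply/andP; split; lra.
- move=> x Xx; have fE : f x = 2 * M * g x - M by rewrite /g; field; lra.
  under eq_fun do rewrite fNE//; rewrite fE.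
  apply: cvgB; last exact: cvg_cst.
  apply: cvgMr; apply/cvgrPdist_le => e e0.
  near=> n; have /andP[c1 c2] := cell_itv n.+1 (gX _ Xx).
  have n0 : 0 < n.+1%:R :> R by rewrite ltr0n.
  have h1 : (cell n.+1 (g x))%:R / n.+1%:R <= g x by rewrite ler_pdivrMr// mulrC.
  have h2 : g x <= (cell n.+1 (g x))%:R / n.+1%:R + n.+1%:R^-1.
    by rewrite -[X in _ + X]div1r -mulrDl ler_pdivlMr// natr1 mulrC ltW.
  have h3 : n.+1%:R^-1 < e by near: n; exact: near_infty_natSinv_lt (PosNum e0).
  rewrite ger0_norm ?subr_ge0//; move: h2 h3; set i := n.+1%:R^-1; lra.
- move=> n; apply: QD; [by apply: bmZ | by apply: bmZ; exact: bm_cst | exact: QZ |].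
  by apply: QZ => //; exact: bm_cst.
Unshelve. all: by end_near. Qed.

End Induction.

Section Distortion.
Context {R : realType} (a : set R) (f q q1 : R -> R) (A : R).
Hypotheses (ia : is_interval a) (A0 : 0 <= A)
  (df : forall x, a x -> is_derive x 1 f (q x)^-1)
  (dq : forall x, a x -> is_derive x 1 q (q1 x))
  (q0 : forall x, a x -> 0 < q x) (hq1 : forall x, a x -> `|q1 x| <= A).

(* q * exp (A f) increases and q * exp (- A f) decreases. *)
Lemma distortion_pos x y : a x -> a y -> `|f x - f y| <= 1 -> q x <= expR A * q y.
Proof.
move=> ax ay fxy.
have dg k z : a z -> is_derive z 1 (fun t => q t * expR (k * f t)) ((q1 z + k) * expR (k * f z)).
  move=> az; have dk : is_derive z 1 (fun t => k * f t) (k * (q z)^-1) := is_deriveZ k (df az).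
  have de := @is_derive1_comp _ expR (fun t => k * f t) z _ _ (is_derive_expR _) dk.
  apply: is_derive_eq (is_deriveM (dq az) de) _.
  have qz : q z != 0 by rewrite gt_eqF// q0.
  rewrite /GRing.scale /= -/expR; field; exact: qz.
suff [k kA h] : exists2 k, `|k| <= A & q x * expR (k * f x) <= q y * expR (k * f y).
  rewrite mulrC; have e0 := expR_gt0 (k * f x).
  rewrite -(ler_pM2r e0); apply: le_trans h _; rewrite -mulrA -expRD ler_wpM2l ?(ltW (q0 ay))//.
  rewrite ler_expR -lerBlDr -mulrBr; apply: le_trans (ler_norm _) _.
  by rewrite normrM distrC -[leRHS]mulr1 ler_pM.
have [xy|yx|->] := ltgtP x y; last by exists 0; rewrite ?normr0.
- exists A; first by rewrite ger0_norm.
  have [z hz e] := mean_value_on ia (dg A) ax ay xy.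
  have az : a z by apply: ia ax ay _ _; case/andP: hz => *; apply/andP; split; exact: ltW.
  rewrite -subr_ge0 e mulr_ge0 ?mulr_ge0 ?expR_ge0 ?subr_ge0 ?(ltW xy)//.
  by have := hq1 az; rewrite ler_norml => /andP[]; lra.
- exists (- A); first by rewrite normrN ger0_norm.
  have [z hz e] := mean_value_on ia (dg (- A)) ay ax yx.
  have az : a z by apply: ia ay ax _ _; case/andP: hz => *; apply/andP; split; exact: ltW.
  rewrite -subr_le0 e mulr_le0_ge0 ?subr_ge0 ?(ltW yx)// mulr_le0_ge0 ?expR_ge0//.
  by have := hq1 az; rewrite ler_norml => /andP[]; lra.
Qed.

End Distortion.

Section Branch.
Context {R : realType} (T : R -> R) (al : set (set R)) (lam A : R) (q q1 : R -> R).
Hypothesis hT : expanding_map T al lam A q q1.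
Variables (a : set R) (ala : al a).
Local Notation X := (@X R).
Implicit Types (f g : R -> R) (x y z s t : R).

Definition inverse_branch y : R := xget 0 [set x | a x /\ T x = y].

(** The modulus of the derivative of the inverse branch. The value 0 off the image makes the default
    value of [inverse_branch] there harmless. *)
Definition branch_weight y : R := if `[< (T @` a) y >] then `|q (inverse_branch y)| else 0.

Local Notation J := (T @` a).
Local Notation w := inverse_branch.
Local Notation G := branch_weight.

Let ia : is_interval a. Proof. by have [] := open_interval_ind (em_itv hT ala). Qed.
Let oa : open a. Proof. by have [] := open_interval_ind (em_itv hT ala). Qed.
Let aX : a `<=` X. Proof. by have [] := open_interval_ind (em_itv hT ala). Qed.
Let dT x : a x -> is_derive x 1 T (q x)^-1. Proof. exact: (em_der hT ala). Qed.
Let dq x : a x -> is_derive x 1 q (q1 x). Proof. exact: (em_der2 hT ala). Qed.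
Let q0 x : a x -> q x != 0. Proof. exact: (inverse_derivative_neq0 hT ala). Qed.

Lemma branch_image_itv : open_interval J.
Proof.
apply: open_interval_image (em_itv hT ala) dT (em_X hT) _.
by have [h|h] := em_sign hT ala; [left|right] => x /h; rewrite ?invr_gt0 ?invr_lt0.
Qed.

Let oJ : open J. Proof. by have [] := open_interval_ind branch_image_itv. Qed.
Let iJ : is_interval J. Proof. by have [] := open_interval_ind branch_image_itv. Qed.
Let JX : J `<=` X. Proof. by have [] := open_interval_ind branch_image_itv. Qed.

Lemma branch_mean_value x y : a x -> a y -> x < y ->
  exists2 z, a z & y - x = q z * (T y - T x).
Proof.
move=> ax ay xy; have [z hz e] := mean_value_on ia dT ax ay xy.
have az : a z by apply: ia ax ay _ _; case/andP: hz => *; apply/andP; split; exact: ltW.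
by exists z => //; rewrite e mulrA mulfV ?mul1r// q0.
Qed.

Lemma branch_expanding x y : a x -> a y -> `|x - y| <= lam^-1 * `|T x - T y|.
Proof.
wlog xy : x y / x < y => [h ax ay|ax ay].
  have [xy|yx|->] := ltgtP x y; [exact: h | | by rewrite !subrr normr0 mulr0].
  by rewrite distrC [in leRHS]distrC; exact: h.
have [z az e] := branch_mean_value ax ay xy.
by rewrite distrC [in leRHS]distrC e normrM ler_wpM2r// (em_lam hT ala az).
Qed.

Lemma branch_inj x y : a x -> a y -> T x = T y -> x = y.
Proof.
move=> ax ay e; apply/eqP; rewrite -subr_eq0 -normr_le0.
by apply: le_trans (branch_expanding ax ay) _; rewrite e subrr normr0 mulr0.
Qed.

Lemma inverse_branchP y : J y -> a (w y) /\ T (w y) = y.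
Proof. by move=> [x ax <-]; rewrite /w; case: xgetP => [z _ //|/(_ x)[]]. Qed.

Lemma inverse_branchK x : a x -> w (T x) = x.
Proof. by move=> ax; have [|h1 h2] := @inverse_branchP (T x); [exists x | exact: branch_inj]. Qed.

Lemma inverse_branch_contr y z : J y -> J z -> `|w y - w z| <= lam^-1 * `|y - z|.
Proof.
move=> /inverse_branchP[ay {2}<-] /inverse_branchP[az {2}<-]; exact: branch_expanding.
Qed.

Lemma branch_sign : exists2 sg : R, `|sg| = 1 & forall x, a x -> `|q x| = sg * q x.
Proof.
have [h|h] := em_sign hT ala; [exists 1; rewrite ?normr1// | exists (-1); rewrite ?normrN1//].
  by move=> x /h qx; rewrite mul1r gtr0_norm.
by move=> x /h qx; rewrite mulN1r ltr0_norm.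
Qed.

Lemma branch_increasing x y : (forall z, a z -> 0 < q z) -> a x -> a y -> x < y -> T x < T y.
Proof.
move=> qp ax ay xy; have [z /qp qz e] := branch_mean_value ax ay xy.
by rewrite -subr_gt0 -(pmulr_rgt0 _ qz) -e subr_gt0.
Qed.

Lemma branch_decreasing x y : (forall z, a z -> q z < 0) -> a x -> a y -> x < y -> T y < T x.
Proof.
move=> qn ax ay xy; have [z /qn qz e] := branch_mean_value ax ay xy.
by rewrite -subr_lt0 -(nmulr_rgt0 _ qz) -e subr_gt0.
Qed.

Lemma inverse_branch_mono :
  (forall y z, J y -> J z -> y < z -> w y < w z) \/
  (forall y z, J y -> J z -> y < z -> w z < w y).
Proof.
have [h|h] := em_sign hT ala; [left|right] => y z /inverse_branchP[ay {1}<-] /inverse_branchP[az {1}<-];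
  move=> lt; rewrite ltNge le_eqVlt; apply/negP => /predU1P[e|l]; move: lt; rewrite ltNge => /negP; apply.
- by rewrite e.
- by rewrite ltW// branch_increasing.
- by rewrite e.
- by rewrite ltW// branch_decreasing.
Qed.

Lemma branch_weightE y : J y -> G y = `|q (w y)|.
Proof. by move=> Jy; rewrite /G asboolT. Qed.

Lemma branch_weight0 y : ~ J y -> G y = 0.
Proof. by move=> Jy; rewrite /G asboolF. Qed.

Lemma branch_weight_ge0 y : 0 <= G y.
Proof. by rewrite /G; case: ifP. Qed.

Lemma branch_weight_le y : G y <= lam^-1.
Proof.
rewrite /G; case: asboolP => [/inverse_branchP[aw _]|_]; first exact: (em_lam hT ala aw).
by rewrite invr_ge0 ltW// (em_lam0 hT).
Qed.

Lemma branch_weight_dist y z : J y -> J z -> `|G y - G z| <= A * `|w y - w z|.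
Proof.
move=> Jy Jz; rewrite !branch_weightE//.
have [ay _] := inverse_branchP Jy; have [az _] := inverse_branchP Jz.
apply: le_trans (ler_dist_dist _ _) _.
move: (w y) (w z) ay az => x x'.
wlog xy : x x' / x < x' => [h ax ay|ax ay].
  have [xy|yx|->] := ltgtP x x'; [exact: h | | by rewrite !subrr normr0 mulr0].
  by rewrite distrC [in leRHS]distrC; exact: h.
have [t ht e] := mean_value_on ia dq ax ay xy.
have at_ : a t by apply: ia ax ay _ _; case/andP: ht => *; apply/andP; split; exact: ltW.
by rewrite distrC [in leRHS]distrC e normrM ler_wpM2r// (em_dist hT ala at_).
Qed.

(** [distortion_pos] is applied to [T] or to [- T] according to the sign; its condition on
    [f x - f y] holds because images lie in [X]. *)
Lemma branch_distortion x y : a x -> a y -> `|q x| <= expR A * `|q y|.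
Proof.
move=> ax ay.
have TX z z' : a z -> a z' -> `|T z - T z'| <= 1.
  move=> /aX /(em_X hT) /inX /andP[? ?] /aX /(em_X hT) /inX /andP[? ?].
  by rewrite ler_norml; apply/andP; split; lra.
have [h|h] := em_sign hT ala.
  rewrite !gtr0_norm ?h//.
  by apply: (distortion_pos ia (em_A0 hT) dT dq) => //; [move=> z; exact: (em_dist hT ala) | exact: TX].
rewrite !ltr0_norm ?h//.
apply: (@distortion_pos _ a (fun x => - T x) (fun x => - q x) (fun x => - q1 x)) => //.
- exact: (em_A0 hT).
- by move=> z az; rewrite invrN; apply: is_deriveN; exact: dT.
- by move=> z az; apply: is_deriveN; exact: dq.
- by move=> z /h; rewrite oppr_gt0.
- by move=> z az; rewrite normrN; exact: (em_dist hT ala).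
- by rewrite opprK addrC; exact: TX.
Qed.

Lemma is_derive_inverse_branch y : J y -> is_derive y 1 w (q (w y)).
Proof.
move=> /inverse_branchP[aw Tw].
rewrite -{1}Tw -[q _]invrK; apply: is_derive_inverse.
- by apply: filterS (open_nbhs_nbhs (conj oa aw)) => x; exact: inverse_branchK.
- apply: filterS (open_nbhs_nbhs (conj oa aw)) => x ax; exact: (branch_continuous hT ala ax).
- exact: dT.
- by rewrite invr_eq0 q0.
Qed.

End Branch.

Section ChangeOfVariables.
Context {R : realType} (T : R -> R) (al : set (set R)) (lam A : R) (q q1 : R -> R).
Hypothesis hT : expanding_map T al lam A q q1.
Variables (a : set R) (ala : al a).
Local Notation m := (@lebesgue_measure R).
Local Notation X := (@X R).
Implicit Types (f g : R -> R) (x y z s t : R) (B E : set (measurableTypeR R)).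
Local Notation J := (T @` a).
Local Notation w := (inverse_branch T a).
Local Notation G := (branch_weight T q a).

Let ia : is_interval a. Proof. by have [] := open_interval_ind (em_itv hT ala). Qed.
Let oa : open a. Proof. by have [] := open_interval_ind (em_itv hT ala). Qed.
Let aX : a `<=` X. Proof. by have [] := open_interval_ind (em_itv hT ala). Qed.
Let oJ : open J. Proof. by have [] := open_interval_ind (branch_image_itv hT ala). Qed.
Let iJ : is_interval J. Proof. by have [] := open_interval_ind (branch_image_itv hT ala). Qed.
Let JX : J `<=` X. Proof. by have [] := open_interval_ind (branch_image_itv hT ala). Qed.
Let mX := @measurable_X R.
Let il0 : 0 <= lam^-1. Proof. by rewrite invr_ge0 ltW// (em_lam0 hT). Qed.

Lemma inverse_branch_continuous y : J y -> {for y, continuous w}.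
Proof.
move=> Jy; apply: differentiable_continuous; apply/derivable1_diffP.
by have [] := is_derive_inverse_branch hT ala Jy.
Qed.

Lemma branch_transfer_bm f : bm f -> bm (fun y => G y * f (w y)).
Proof.
move=> bf; have [M M0 fM] := bm_bound bf; have [mf _] := bf.
have mJ : measurable (J : set (measurableTypeR R)) by exact: open_measurable.
have mw : measurable_fun (J : set (measurableTypeR R)) (w : measurableTypeR R -> measurableTypeR R).
  by apply: open_continuous_measurable_fun => // y /[1!inE]; exact: inverse_branch_continuous.
have wa y : J y -> a (w y) by move=> /inverse_branchP[].
split; last first.
  exists (lam^-1 * M) => y Xy; rewrite normrM (ger0_norm (branch_weight_ge0 _ _ _ _)).
  have [Jy|Jy] := pselect (J y); last by rewrite branch_weight0// mul0r mulr_ge0.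
  rewrite ler_pM ?branch_weight_ge0 ?(branch_weight_le hT ala)//.
  by apply: fM; apply: aX; exact: wa.
rewrite (_ : X = J `|` (X `\` J)); last first.
  apply/seteqP; split => x; last by case=> [/JX|[]].
  by move=> Xx; have [Jx|Jx] := pselect (J x); [left | right].
apply/measurable_funU => //; first exact: measurableD.
split.
  apply: (@eq_measurable_fun _ _ _ _ _ (fun y => `|q (w y)| * f (w y))).
    by move=> y /[1!inE] Jy; rewrite branch_weightE.
  apply: measurable_funM.
    apply: (@measurableT_comp _ _ _ _ _ _ (fun x : R => `|x|)) => //.
    apply: (@measurable_comp _ _ _ _ _ _ (a : set (measurableTypeR R)) q) => //.
    - exact: open_measurable.
    - by move=> _ [y Jy <-]; exact: wa.
    - apply: open_continuous_measurable_fun => // x /[1!inE] ax.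
      apply: differentiable_continuous; apply/derivable1_diffP.
      by have [] := em_der2 hT ala ax.
  apply: (@measurable_comp _ _ _ _ _ _ (X : set (measurableTypeR R)) f) => //.
  by move=> _ [y Jy <-]; apply: aX; exact: wa.
apply: (@eq_measurable_fun _ _ _ _ _ (fun=> 0 : R)); last exact: measurable_cst.
by move=> y /[1!inE] -[_ Jy]; rewrite branch_weight0// mul0r.
Qed.

(** The fundamental theorem of calculus, as [G] is, up to the constant sign [sg], the derivative of
    [w]. *)
Lemma branch_weight_int_segment s t : J s -> J t -> s < t ->
  \int[m]_(y in `[s, t]) G y = `|w s - w t|.
Proof.
move=> Js Jt st; have [sg sg1 sgq] := branch_sign hT ala.
have Jst y : s <= y <= t -> J y by exact: iJ.
pose F y := sg * w y; pose g y := sg * q (w y).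
have dF y : s <= y <= t -> is_derive y 1 F (g y).
  by move=> /Jst Jy; exact: is_deriveZ (is_derive_inverse_branch hT ala Jy).
have dg y : s <= y <= t -> derivable g y 1.
  move=> /Jst Jy; have [aw _] := inverse_branchP Jy.
  have d1 := is_derive1_comp (em_der2 hT ala aw) (is_derive_inverse_branch hT ala Jy).
  by have [] := is_deriveZ sg d1.
have cF y : s <= y <= t -> F z @[z --> y] --> F y.
  move=> /dF[d _]; apply: differentiable_continuous; exact/derivable1_diffP.
have ftc : (\int[m]_(y in `[s, t]) (g y)%:E = (F t)%:E - (F s)%:E)%E.
  apply: continuous_FTC2 => //.
  - by apply: derivable_within_continuous => y; rewrite in_itv/=; exact: dg.
  - split.
    + by move=> y; rewrite in_itv/= => /andP[h1 h2]; have [] // := dF y; rewrite !ltW.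
    + by apply: cvg_at_right_filter; apply: cF; rewrite lexx ltW.
    + by apply: cvg_at_left_filter; apply: cF; rewrite lexx ltW.
  - move=> y; rewrite in_itv/= => /andP[h1 h2]; rewrite derive1E.
    by have [] // := dF y; rewrite !ltW.
have gE y : s <= y <= t -> G y = g y.
  by move=> /Jst Jy; rewrite branch_weightE// sgq//; have [] := inverse_branchP Jy.
have e : \int[m]_(y in `[s, t]) G y = F t - F s.
  rewrite (@eq_Rintegral _ _ _ m _ g); first by rewrite /Rintegral ftc.
  by move=> y /[1!inE]; rewrite /= in_itv/= => /gE.
have : 0 <= \int[m]_(y in `[s, t]) G y.
  by apply: Rintegral_ge0 => y _; exact: branch_weight_ge0.
by rewrite e => /ger0_norm <-; rewrite -mulrBr normrM sg1 mul1r distrC.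
Qed.

Let Phi f := \int[m]_(y in X) (G y * f (w y)).

Lemma branch_weight_int x1 x2 : a x1 -> a x2 -> x1 < x2 -> Phi (\1_(`[x1, x2]%classic)) = x2 - x1.
Proof.
move=> a1 a2 lt.
have [s [t [Js Jt st wst hst]]] : exists s t, [/\ J s, J t, s < t, `|w s - w t| = x2 - x1 &
    forall z, a z -> (s <= T z <= t) = (x1 <= z <= x2)].
  have ne : 0 <= x2 - x1 by lra.
  have J1 : J (T x1) by exists x1.
  have J2 : J (T x2) by exists x2.
  have [h|h] := em_sign hT ala.
    have mono z z' : a z -> a z' -> (T z <= T z') = (z <= z').
      move=> az az'; have [l|l|->] := ltgtP z z'; last by rewrite lexx.
        by rewrite ltW// (branch_increasing hT ala).
      by rewrite leNgt (branch_increasing hT ala).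
    exists (T x1), (T x2); split => //; first exact: (branch_increasing hT ala h a1 a2 lt).
      by rewrite !(inverse_branchK hT ala)// distrC ger0_norm.
    by move=> z az; rewrite !mono.
  have mono z z' : a z -> a z' -> (T z' <= T z) = (z <= z').
    move=> az az'; have [l|l|->] := ltgtP z z'; last by rewrite lexx.
      by rewrite ltW// (branch_decreasing hT ala).
    by rewrite leNgt (branch_decreasing hT ala).
  exists (T x2), (T x1); split => //; first exact: (branch_decreasing hT ala h a1 a2 lt).
    by rewrite !(inverse_branchK hT ala)// ger0_norm.
  by move=> z az; rewrite !mono// andbC.
rewrite -wst -(branch_weight_int_segment Js Jt st) /Phi.
rewrite [RHS](_ : _ = \int[m]_(y in X `&` `[s, t]%classic) G y); last first.
  rewrite setIidr// => y; rewrite /= in_itv/= => /(iJ Js Jt); exact: JX.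
rewrite -Rint_indic; apply: eq_Rintegral => y _.
have [Jy|Jy] := pselect (J y); last by rewrite branch_weight0// mulr0 mul0r.
rewrite mulrC; congr (_ * _); have [aw Tw] := inverse_branchP Jy.
by have := hst _ aw; rewrite Tw !indicE !mem_setE !in_itv/= => ->.
Qed.

Let Phi_le f g : bm f -> bm g -> (forall x, a x -> f x <= g x) -> Phi f <= Phi g.
Proof.
move=> bf bg fg; apply: Rint_le => //; [exact: branch_transfer_bm | exact: branch_transfer_bm |].
move=> y _; have [Jy|Jy] := pselect (J y); last by rewrite branch_weight0// !mul0r.
by rewrite ler_wpM2l ?branch_weight_ge0// fg//; have [] := inverse_branchP Jy.
Qed.

Variables (u v : R).
Hypothesis (aE : a = `]u, v[%classic).

(** Exhaustion by the closed intervals from [p1 + e'] to [p2 - e'], to which [branch_weight_int]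
    applies. *)
Lemma branch_weight_int_ge E p1 p2 : measurable E -> u <= p1 -> p1 < p2 -> p2 <= v ->
  (forall x, p1 < x < p2 -> E x) -> p2 - p1 <= Phi (\1_E).
Proof.
move=> mE up1 p12 p2v sE; apply/ler_addgt0Pr => e e0.
pose e' := Num.min (e / 2) ((p2 - p1) / 4).
have e'0 : 0 < e' by rewrite /e' lt_min; apply/andP; split; lra.
have h1 : e' <= e / 2 by rewrite /e' ge_min lexx.
have h2 : e' <= (p2 - p1) / 4 by rewrite /e' ge_min lexx orbT.
have a1 : a (p1 + e') by rewrite aE /= in_itv/=; apply/andP; split; lra.
have a2 : a (p2 - e') by rewrite aE /= in_itv/=; apply/andP; split; lra.
have lt : p1 + e' < p2 - e' by lra.
suff : Phi (\1_(`[p1 + e', p2 - e']%classic)) <= Phi (\1_E).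
  by rewrite (branch_weight_int a1 a2 lt); lra.
apply: Phi_le; [exact: bm_indic | exact: bm_indic |].
move=> x _; rewrite !indicE mem_setE in_itv/=.
case: andP => [[l1 l2]|_] //; rewrite mem_set//; apply: sE; apply/andP; split; lra.
Qed.

(** The image is cut down to a closed interval [[s, t]], where [branch_weight_int_segment] applies;
    the two strips that are cut off contribute at most [lam^-1] times their length. *)
Lemma branch_weight_int_le : Phi (fun=> 1) <= v - u.
Proof.
apply/ler_addgt0Pr => e e0; have [c [d [c0 cd d1 JE]]] := branch_image_itv hT ala.
have l0 := em_lam0 hT.
pose e' := Num.min (e * lam / 2) ((d - c) / 4).
have e'0 : 0 < e' by rewrite /e' lt_min !divr_gt0 ?mulr_gt0 ?subr_gt0.
have h1 : e' <= e * lam / 2 by rewrite /e' ge_min lexx.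
have h2 : e' <= (d - c) / 4 by rewrite /e' ge_min lexx orbT.
set s := c + e'; set t := d - e'.
have Js : J s by rewrite JE /= in_itv/= /s; apply/andP; split; lra.
have Jt : J t by rewrite JE /= in_itv/= /t; apply/andP; split; lra.
have st : s < t by rewrite /s /t; lra.
have mI : measurable (`[s, t]%classic : set (measurableTypeR R)) by exact: measurable_itv.
have mJ : measurable (`]c, d[%classic : set (measurableTypeR R)) by exact: measurable_itv.
have bG : bm G.
  by apply: bm_eq (branch_transfer_bm (bm_cst 1)) => y _; rewrite mulr1.
have bI := bm_indic mI; have bJ := bm_indic mJ.
have b1 : bm (fun y => \1_(`[s, t]%classic) y * G y) by exact: bmM.
have b2 : bm (fun y => \1_(`]c, d[%classic) y - \1_(`[s, t]%classic) y : R) by exact: bmB.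
have indint (p r : R) (D : set (measurableTypeR R)) : measurable D -> D `<=` X ->
    \int[m]_(y in X) \1_D y = fine (m D) :> R.
  move=> mD DX; rewrite -[LHS](_ : \int[m]_(y in X) (\1_D y * 1) = _); last first.
    by apply: eq_Rintegral => y _; rewrite mulr1.
  by rewrite Rint_indic setIidr// Rintegral_cst// mul1r.
have IX : `[s, t]%classic `<=` X.
  by move=> y; rewrite /= in_itv/= => /(iJ Js Jt); exact: JX.
apply: (@le_trans _ _ (\int[m]_(y in X) (\1_(`[s, t]%classic) y * G y +
   lam^-1 * (\1_(`]c, d[%classic) y - \1_(`[s, t]%classic) y)))).
  apply: Rint_le => //.
  - exact: branch_transfer_bm (bm_cst 1).
  - by apply: bmD => //; exact: bmZ.
  move=> y _; rewrite mulr1.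
  have [Jy|Jy] := pselect (J y); last first.
    rewrite branch_weight0// mulr0 add0r mulr_ge0// subr_ge0 !indicE !mem_setE.
    have -> : (y \in `[s, t]) = false.
      by apply/negP; rewrite in_itv/= => h; apply: Jy; exact: iJ h.
    by case: (_ \in _).
  have := Jy; rewrite {1}JE /= => yJ; rewrite !indicE !mem_setE yJ.
  case: (y \in _); first by rewrite mul1r subrr mulr0 addr0.
  by rewrite mul0r add0r subr0 mulr1 (branch_weight_le hT ala).
rewrite RintD//; last exact: bmZ.
rewrite RintZ// RintB// !indint//; last by rewrite -JE.
rewrite Rint_indic setIidr// (branch_weight_int_segment Js Jt st).
have -> : fine (m `]c, d[%classic) = d - c.
  by rewrite lebesgue_measure_itv/= lte_fin cd.
have -> : fine (m `[s, t]%classic) = t - s.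
  by rewrite lebesgue_measure_itv/= lte_fin st.
have [ws _] := inverse_branchP Js; have [wt _] := inverse_branchP Jt.
have : `|w s - w t| <= v - u.
  move: ws wt; rewrite aE /= !in_itv/= => /andP[? ?] /andP[? ?].
  by rewrite ler_norml; apply/andP; split; lra.
have : lam^-1 * (d - c - (t - s)) <= e.
  by rewrite ler_pdivrMl// /s /t; lra.
lra.
Qed.

(** [bm_induction] leaves the constant 1 and the rays. For a ray and its complement
    [branch_weight_int_ge] gives lower bounds that add up to the total [v - u], so both are
    equalities. *)
Lemma branch_change_of_variables f : bm f ->
  \int[m]_(y in X) (G y * f (w y)) = \int[m]_(x in X) (\1_a x * f x).
Proof.
have ma : measurable (a : set (measurableTypeR R)) by exact: open_measurable.
have uv : u < v.
  by have [_ _ [x]] := open_interval_ind (em_itv hT ala); rewrite aE /= in_itv/= => /andP[h1 h2] _; exact: lt_trans h1 h2.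
have ba := bm_indic ma.
have int_a (E : set (measurableTypeR R)) p1 p2 : p1 <= p2 -> measurable E ->
    a `&` E = `]p1, p2[%classic -> \int[m]_(x in X) (\1_a x * \1_E x) = p2 - p1.
  move=> p12 mE aEE; rewrite Rint_indic setIidr//.
  transitivity (\int[m]_(x in a) (\1_E x * 1)).
    by apply: eq_Rintegral => x _; rewrite mulr1.
  have mp : fine (m `]p1, p2[%classic) = p2 - p1.
    rewrite lebesgue_measure_itv/= lte_fin.
    by have [//|p21] := ltP p1 p2; rewrite (@le_anti _ _ p1 p2) ?subrr// p12 p21.
  by rewrite Rint_indic aEE Rintegral_cst// mul1r; exact: mp.
have total : Phi (fun=> 1) = v - u.
  apply/eqP; rewrite eq_le branch_weight_int_le /=.
  have := @branch_weight_int_ge setT u v measurableT (lexx _) uv (lexx _) (fun _ _ => I).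
  congr (_ <= _); apply: eq_Rintegral => y _; by rewrite indicE mem_set.
have compl E : measurable E -> Phi (\1_E) + Phi (\1_(~` E)) = v - u.
  move=> mE; rewrite -total /Phi -RintD//; last 2 first.
  - by apply: branch_transfer_bm; exact: bm_indic.
  - by apply: branch_transfer_bm; apply: bm_indic; exact: measurableC.
  apply: eq_Rintegral => y _; rewrite -mulrDr !indicE in_setC.
  by case: (_ \in _); rewrite ?addr0 ?add0r.
have Phi0 E : measurable E -> 0 <= Phi (\1_E).
  by move=> mE; apply: Rintegral_ge0 => y _; rewrite mulr_ge0 ?branch_weight_ge0.
apply: (@bm_induction R (fun f => Phi f = \int[m]_(x in X) (\1_a x * f x))).
- move=> g1 g2 g12 e; transitivity (Phi g1).
    apply: eq_Rintegral => y _.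
    have [Jy|Jy] := pselect (J y); last by rewrite branch_weight0// !mul0r.
    by rewrite g12//; apply: aX; have [] := inverse_branchP Jy.
  by rewrite e; apply: eq_Rintegral => x /[1!inE] Xx; rewrite g12.
- move=> g1 g2 b1 b2 e1 e2; rewrite /Phi.
  under eq_Rintegral do rewrite mulrDr; under [RHS]eq_Rintegral do rewrite mulrDr.
  rewrite (RintD (branch_transfer_bm b1) (branch_transfer_bm b2))// RintD//; [|exact: bmM|exact: bmM].
  by rewrite -e1 -e2.
- move=> k g bg e; rewrite /Phi.
  under eq_Rintegral do rewrite mulrCA; under [RHS]eq_Rintegral do rewrite mulrCA.
  rewrite (RintZ k (branch_transfer_bm bg))// RintZ//; last exact: bmM.
  by rewrite -e.
- move=> g g' M bg bg' gM gg' e.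
  have c1 : Phi (g n) @[n --> \oo] --> Phi g'.
    apply: (@Rint_dominated _ (fun n y => G y * g n (w y)) _ _ (lam^-1 * M)) => //.
    + by move=> n; exact: branch_transfer_bm.
    + exact: branch_transfer_bm.
    + move=> n y Xy; have M0 : 0 <= M := le_trans (normr_ge0 _) (gM n y Xy).
      rewrite normrM (ger0_norm (branch_weight_ge0 _ _ _ _)).
      have [Jy|Jy] := pselect (J y); last by rewrite branch_weight0// mul0r mulr_ge0.
      rewrite ler_pM ?branch_weight_ge0 ?(branch_weight_le hT ala)// gM//.
      by apply: aX; have [] := inverse_branchP Jy.
    + move=> y Xy; have [Jy|Jy] := pselect (J y); last first.
        by under eq_fun do rewrite branch_weight0// mul0r; rewrite branch_weight0// mul0r; exact: cvg_cst.
      apply: cvgMr; apply: gg'; apply: aX; by have [] := inverse_branchP Jy.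
  have c2 : \int[m]_(x in X) (\1_a x * g n x) @[n --> \oo] --> \int[m]_(x in X) (\1_a x * g' x).
    apply: (@Rint_dominated _ (fun n x => \1_a x * g n x) _ _ M) => //.
    + by move=> n; exact: bmM.
    + exact: bmM.
    + move=> n x Xx; rewrite normrM -[leRHS]mul1r ler_pM ?gM// indicE.
      by case: (_ \in _); rewrite ?normr1 ?normr0.
    + by move=> x Xx; apply: cvgMr; exact: gg'.
  rewrite -(cvg_lim (@Rhausdorff R) c1) -(cvg_lim (@Rhausdorff R) c2).
  by congr (lim _); under eq_fun do rewrite e.
- rewrite total -[LHS](int_a setT u v)//; [|exact: ltW|by rewrite setIT].
  by apply: eq_Rintegral => x _; congr (_ * _); rewrite indicE mem_set.
- move=> p; have mE : measurable (`]p, +oo[%classic : set (measurableTypeR R)) by exact: measurable_itv.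
  have mE' := measurableC mE.
  have [up|pu] := leP u p; last first.
    rewrite (int_a _ u v (ltW uv) mE); last first.
      apply/seteqP; split => x; rewrite aE /= !in_itv/= ?andbT; first by case.
      by move=> /andP[h1 h2]; rewrite h1 h2; split => //; exact: lt_trans h1.
    apply/eqP; rewrite eq_le; apply/andP; split.
      by have := compl _ mE; have := Phi0 _ mE'; lra.
    apply: branch_weight_int_ge => // x /andP[ux _]; rewrite /= in_itv/= andbT.
    exact: lt_trans pu ux.
  have [pv|vp] := ltP p v; last first.
    rewrite (int_a _ v v (lexx _) mE); last first.
      apply/seteqP; split => x; rewrite aE /= !in_itv/= ?andbT.
        by move=> [/andP[_ h1] h2]; move: (lt_le_trans h1 vp) => /(lt_trans h2); rewrite ltxx.
      by move=> /andP[/lt_trans h /h]; rewrite ltxx.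
    have := compl _ mE; have := Phi0 _ mE.
    have : v - u <= Phi (\1_(~` `]p, +oo[%classic)).
      apply: branch_weight_int_ge => // x /andP[_ xv]; rewrite /= in_itv/= andbT.
      by apply/negP; rewrite -leNgt ltW// (lt_le_trans xv).
    lra.
  rewrite (int_a _ p v (ltW pv) mE); last first.
    apply/seteqP; split => x; rewrite aE /= !in_itv/= ?andbT.
      by move=> [/andP[_ h1] h2]; rewrite h1 h2.
    by move=> /andP[h1 h2]; rewrite h1 h2; split => //; rewrite (le_lt_trans up).
  have : v - p <= Phi (\1_(`]p, +oo[%classic)).
    by apply: branch_weight_int_ge => // x /andP[px _]; rewrite /= in_itv/= andbT.
  have : p - u <= Phi (\1_(~` `]p, +oo[%classic)).
    move: up; rewrite le_eqVlt => /predU1P[->|up]; first by rewrite subrr Phi0.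
    apply: branch_weight_int_ge => //; first exact: ltW.
    move=> x /andP[_ xp]; rewrite /= in_itv/= andbT.
    by apply/negP; rewrite -leNgt ltW.
  have := compl _ mE; lra.
Qed.

Lemma branch_change_of_variables_on f B : bm f -> measurable B -> B `<=` X ->
  \int[m]_(y in B) (G y * f (w y)) = \int[m]_(x in [set x | a x /\ B (T x)]) f x.
Proof.
move=> bf mB BX.
have mP : measurable (Xpreimage T 1 B : set (measurableTypeR R)).
  exact: (measurable_Xpreimage1 (em_meas hT) mB).
have bPf : bm (fun x => \1_(Xpreimage T 1 B) x * f x).
  by apply: bmM => //; exact: bm_indic.
have := branch_change_of_variables bPf; rewrite Rint_indic setIidr// Rint_indic.
have -> : a `&` Xpreimage T 1 B = [set x | a x /\ B (T x)].
  by apply/seteqP; split => x [ax]; [case=> _ Bx | move=> Bx; split => //; split => //; exact: aX].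
move=> <-; rewrite -[B in LHS](setIidr BX) -Rint_indic; apply: eq_Rintegral => y _.
have [Jy|Jy] := pselect (J y); last by rewrite branch_weight0// !mul0r mulr0.
have [aw Tw] := inverse_branchP Jy.
rewrite mulrCA; rewrite !indicE (_ : (w y \in Xpreimage T 1 B) = (y \in B))//.
apply/idP/idP; rewrite !inE.
  by move=> [_] /=; rewrite Tw.
by move=> By; split; [exact: aX | rewrite /= Tw].
Qed.

End ChangeOfVariables.

Lemma finite_positive_lower_bound {R : realType} (E : set R) : finite_set E ->
  (forall x, E x -> 0 < x) -> exists2 l : R, 0 < l & forall x, E x -> l <= x.
Proof.
move=> /finite_seqP[s ->] h.
have {h} : forall x, x \in s -> 0 < x by exact: h.
elim: s => [|y s IH] h; first by exists 1.
have [x xs|l l0 hl] := IH; first by apply: h; rewrite inE xs orbT.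
exists (Num.min y l); first by rewrite lt_min l0 h// inE eqxx.
move=> x; rewrite /= inE ge_min => /predU1P[->|/hl ->]; rewrite ?lexx// orbT.
by [].
Qed.

Lemma open_interval_ends {R : realType} (a : set R) : open_interval a ->
  [/\ 0 <= inf a, inf a < sup a, sup a <= 1 & a = `]inf a, sup a[%classic].
Proof.
by move=> [u [v [u0 uv v1 ->]]]; rewrite inf_itv ?sup_itv ?bnd_simp.
Qed.

(** * Enumerating the branches of an expanding map *)

Section Enumeration.
Context {R : realType} (T : R -> R) (al : set (set R)) (lam A : R) (q q1 : R -> R).
Hypothesis hT : expanding_map T al lam A q q1.
Local Notation m := (@lebesgue_measure R).

(** A consequence of condition (F): finitely many positive lengths have a positive minimum. *)
Lemma image_length : exists2 l : R, 0 < l & forall a, al a -> l <= sup (T @` a) - inf (T @` a).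
Proof.
have [||l l0 hl] := @finite_positive_lower_bound R
  [set sup J - inf J | J in [set T @` a | a in al]].
- by apply: finite_image; exact: (em_images hT).
- move=> _ [_ [a ala <-] <-].
  by have [_ h _ _] := open_interval_ends (branch_image_itv hT ala); rewrite subr_gt0.
by exists l => // a ala; apply: hl; exists (T @` a) => //; exists a.
Qed.

(** The points over the first and the third quarter of the image are at a distance of [|q z|] times
    half its length, for some [z] in the branch, and this is at most the width. Distortion replaces
    [z] by any other point at the cost of [expR A]; the half gives the factor 2. *)
Lemma branch_weight_width a y l : al a -> 0 < l -> l <= sup (T @` a) - inf (T @` a) ->
  branch_weight T q a y <= 2 * expR A / l * (sup a - inf a).
Proof.
move=> ala l0 hl; have [u0 uv v1 aE] := open_interval_ends (em_itv hT ala).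
have [c0 cd d1 JE] := open_interval_ends (branch_image_itv hT ala).
have k0 : 0 <= 2 * expR A / l * (sup a - inf a).
  by rewrite mulr_ge0 ?subr_ge0 ?(ltW uv)// divr_ge0 ?(ltW l0)// mulr_ge0// expR_ge0.
rewrite /branch_weight; case: asboolP => // /inverse_branchP[aw _].
move: (inverse_branch T a y) aw => x ax.
set c := inf (T @` a) in c0 cd hl JE; set d := sup (T @` a) in d1 cd hl JE.
have [x1 ax1 e1] : (T @` a) (c + (d - c) / 4).
  by rewrite JE /= in_itv/=; apply/andP; split; lra.
have [x2 ax2 e2] : (T @` a) (d - (d - c) / 4).
  by rewrite JE /= in_itv/=; apply/andP; split; lra.
have [z az e] : exists2 z, a z & `|x1 - x2| = `|q z| * ((d - c) / 2).
  have T12 : `|T x1 - T x2| = (d - c) / 2.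
    by rewrite e1 e2 ler0_norm; lra.
  have [lt|lt|eq12] := ltgtP x1 x2; last by move: e1; rewrite eq12 e2; lra.
    have [z az e] := branch_mean_value hT ala ax1 ax2 lt; exists z => //.
    by rewrite distrC e normrM distrC T12.
  have [z az e] := branch_mean_value hT ala ax2 ax1 lt; exists z => //.
  by rewrite e normrM T12.
have h1 := branch_distortion hT ala ax az.
have h2 : `|x1 - x2| <= sup a - inf a.
  move: ax1 ax2; rewrite {1 2}aE /= !in_itv/= => /andP[? ?] /andP[? ?].
  by rewrite ler_norml; apply/andP; split; lra.
apply: (le_trans h1).
have -> : 2 * expR A / l * (sup a - inf a) = expR A * (2 * (sup a - inf a) / l) by ring.
rewrite ler_wpM2l ?expR_ge0// ler_pdivlMr//.
have : `|q z| * l <= `|q z| * (d - c) by rewrite ler_wpM2l.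
lra.
Qed.

Lemma branch_weight_low a : al a ->
  exists2 k : R, 0 < k & forall y, (T @` a) y -> k <= branch_weight T q a y.
Proof.
move=> ala; have [_ _ [x0 ax0] _] := open_interval_ind (em_itv hT ala).
exists (`|q x0| / expR A).
  by rewrite divr_gt0 ?expR_gt0// normr_gt0 (inverse_derivative_neq0 hT ala ax0).
move=> y Jy; rewrite branch_weightE//; have [aw _] := inverse_branchP Jy.
by rewrite ler_pdivrMr ?expR_gt0// mulrC (branch_distortion hT ala).
Qed.

Theorem expanding_of_map : 2 * (3 + A) <= lam ->
  exists2 s : expanding R, eS s = T & forall i, eu s i < ev s i -> al `]eu s i, ev s i[%classic.
Proof.
move=> lamA; have /countable_injP[num num_inj] := em_count hT.
pose br i : set R := xget set0 [set a | al a /\ num a = i].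
have brP i : (al (br i) /\ num (br i) = i) \/ br i = set0.
  by rewrite /br; case: xgetP => [a _ [? ?]|_]; [left | right].
have brX i x : br i x -> al (br i).
  by case: (brP i) => [[]//|->].
have num_br a : al a -> br (num a) = a.
  move=> ala; rewrite /br; case: xgetP => [b _ [alb e]|/(_ a)[]//].
  by apply: num_inj => //; rewrite inE.
pose u i := inf (br i); pose v i := sup (br i).
pose c i := inf (T @` br i); pose d i := sup (T @` br i).
have brE i : [/\ 0 <= u i, u i <= v i, v i <= 1 & br i = `]u i, v i[%classic].
  case: (brP i) => [[ali _]|e].
    by have [? h ? ?] := open_interval_ends (em_itv hT ali); split => //; exact: ltW.
  by rewrite /u /v e inf0 sup0; split => //; rewrite set_itv_ge// bnd_simp ltxx.
have imE i : [/\ 0 <= c i, c i <= d i, d i <= 1 & T @` br i = `]c i, d i[%classic].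
  case: (brP i) => [[ali _]|e].
    by have [? h ? ?] := open_interval_ends (branch_image_itv hT ali); split => //; exact: ltW.
  by rewrite /c /d e image_set0 inf0 sup0; split => //; rewrite set_itv_ge// bnd_simp ltxx.
have inbr i x : (u i < x < v i) <-> br i x.
  by have [_ _ _ ->] := brE i; rewrite /= in_itv.
have inim i y : (c i < y < d i) <-> (T @` br i) y.
  by have [_ _ _ ->] := imE i; rewrite /= in_itv.
have imX i y : (T @` br i) y -> al (br i) by move=> [x /brX].
have [l l0 hl] := image_length.
have l00 := em_lam0 hT.
pose w i := inverse_branch T (br i); pose G i := branch_weight T q (br i).
have A0 := em_A0 hT.
have bm0 i f : br i = set0 -> forall y, G i y * f (w i y) = 0.
  by move=> e y; rewrite /G branch_weight0 ?mul0r// e image_set0.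
unshelve eexists (@Expanding R T u v c d w G lam A (2 * expR A / l) _ _ _ _ _ _ _ _ _ _ _ _ _ _ _ _ _ _ _ _ _ _ _ _).
- exact: (em_X hT).
- exact: (em_meas hT).
- by move=> i; have [] := brE i.
- move=> i j x /inbr bi /inbr bj.
  have [[ali <-]|e] := brP i; last by rewrite e in bi.
  have [[alj <-]|e] := brP j; last by rewrite e in bj.
  by rewrite (em_disj hT ali alj bi bj).
- rewrite -[RHS](em_cover hT); congr (m (_ `\` _)); apply/seteqP; split => x.
    by move=> [i /inbr bi]; exists (br i) => //; exact: brX bi.
  by move=> [a ala ax]; exists (num a); apply/inbr; rewrite num_br.
- by move=> i; have [] := imE i.
- by move=> i y /inim /inverse_branchP[aw _]; apply/inbr.
- by move=> i y /inim /inverse_branchP[].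
- by move=> i x /inbr bx; apply/inim; exists x.
- move=> i x /inbr bx; exact: (inverse_branchK hT (brX _ _ bx) bx).
- move=> i; have [[ali _]|e] := brP i; last first.
    left => y z cy yz zd; have : c i < y < d i by rewrite cy (lt_trans yz).
    by move=> /inim; rewrite e image_set0.
  have hin y z : c i < y -> y < z -> z < d i -> (T @` br i) y /\ (T @` br i) z.
    by move=> cy yz zd; split; apply/inim; rewrite ?zd ?cy ?(lt_trans cy)// (lt_trans yz).
  by have [h|h] := inverse_branch_mono hT ali; [left|right] => y z cy yz zd;
    have [Jy Jz] := hin y z cy yz zd; exact: h.
- by move=> i y /negP h; apply: branch_weight0 => /inim.
- move=> i y /inim Jy; rewrite /G branch_weightE// normr_gt0.
  by have [aw _] := inverse_branchP Jy; exact: (inverse_derivative_neq0 hT (imX _ _ Jy) aw).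
- by move=> i y /inim Jy; exact: (branch_weight_le hT (imX _ _ Jy) _).
- by move=> i y z /inim Jy /inim Jz; exact: (branch_weight_dist hT (imX _ _ Jy) Jy Jz).
- by move=> i y z /inim Jy /inim Jz; exact: (inverse_branch_contr hT (imX _ _ Jy) Jy Jz).
- move=> i; have [[ali _]|e] := brP i; last first.
    by exists 1 => // y /inim; rewrite e image_set0.
  by have [k k0 hk] := branch_weight_low ali; exists k => // y /inim; exact: hk.
- move=> i y /inim Jy; have ali := imX _ _ Jy.
  by apply: branch_weight_width => //; exact: hl.
- have fin : finite_set ([set T @` a | a in al] `|` [set set0]).
    by rewrite finite_setU; split; [exact: (em_images hT) | exact: finite_set1].
  have /finite_seqP[E1 h1] := finite_image inf fin.
  have /finite_seqP[E2 h2] := finite_image sup fin.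
  have him i : ([set T @` a | a in al] `|` [set set0]) (T @` br i).
    have [[ali _]|->] := brP i; first by left; exists (br i).
    by right; rewrite image_set0.
  exists (E1 ++ E2) => i; rewrite !mem_cat; split.
    have : [set` E1] (c i) by rewrite -h1; exists (T @` br i).
    by move=> /= ->.
  have : [set` E2] (d i) by rewrite -h2; exists (T @` br i).
  by move=> /= ->; rewrite orbT.
- exact: A0.
- by rewrite divr_ge0 ?(ltW l0)// mulr_ge0// expR_ge0.
- exact: lamA.
- move=> i f bf; have [[ali _]|e] := brP i; last first.
    by apply: bm_eq (bm_cst 0) => y _; rewrite bm0.
  exact: (branch_transfer_bm hT ali bf).
- move=> i f B bf mB BX.
  have -> : [set x | u i < x < v i /\ B (T x)] = [set x | br i x /\ B (T x)].
    by apply/seteqP; split => x [/inbr].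
  have [[ali _]|e] := brP i; last first.
    rewrite (_ : [set x | _] = set0) ?Rintegral_set0; last first.
      by apply/seteqP; split => x //; rewrite e => -[].
    by rewrite (@eq_Rintegral _ _ _ m _ (fun=> 0)) ?Rintegral_cst ?mul0r// => y _; rewrite bm0.
  by have [_ _ _ aE] := brE i; exact: (branch_change_of_variables_on hT ali aE bf mB BX).
- by [].
move=> i /= uv; have [_ _ _ <-] := brE i.
have /inbr /brX // : u i < (u i + v i) / 2 < v i by apply/andP; split; lra.
Qed.

End Enumeration.

(** * The mixing coefficient *)

Lemma unit_dist {R : realType} (a b : R) : 0 <= a <= 1 -> 0 <= b <= 1 -> `|a - b| <= 1.
Proof.
by move=> /andP[? ?] /andP[? ?]; rewrite ler_norml; apply/andP; split; lra.
Qed.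

Section Probability.
Context {R : realType} (P : probability (measurableTypeR R) R).
Implicit Types (A B N : set (measurableTypeR R)).
Local Notation pr B := (fine (P B)).
Local Notation X := (@X R).

Lemma pr_le A B : measurable A -> measurable B -> A `<=` B -> pr A <= pr B.
Proof.
move=> mA mB AB; rewrite fine_le ?pr_fin//.
by apply: le_measure => //; rewrite inE.
Qed.

Lemma pr_mod_null A B N : measurable A -> measurable B -> measurable N -> P N = 0%E ->
  (forall x, ~ N x -> A x <-> B x) -> pr A = pr B.
Proof.
move=> mA mB mN N0 AB.
have key C D : measurable C -> measurable D -> (forall x, ~ N x -> C x -> D x) -> pr C <= pr D.
  move=> mC mD CD; apply: (@le_trans _ _ (pr (D `|` N))).
    apply: pr_le => //; first exact: measurableU.
    by move=> x Cx; have [Nx|Nx] := pselect (N x); [right | left; exact: CD].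
  by rewrite le_eqVlt; apply/orP; left; apply/eqP; congr fine; exact: measureU0.
by apply/eqP; rewrite eq_le !key// => x /AB[].
Qed.

Lemma acip_prX (Pac : P `<< mrestr (@lebesgue_measure R) (measurable_itv `[0, 1])) : P X = 1%E.
Proof.
have mX := @measurable_X R.
have : P (~` X) = 0%E.
  apply: (@Pac (~` X)) => //; last exact: measurableC.
  move=> A mA AX; rewrite /mrestr/= (_ : A `&` _ = set0) ?measure0//.
  by apply/seteqP; split => x // [/AX].
have := probability_setC P (measurableC mX).
by rewrite setCK => -> ->; rewrite sube0.
Qed.

End Probability.

(** The terms at multiples of [N.+1] are among the first [n.+1 * N.+1] terms; as all terms are
    nonnegative, the average grows at most by the factor [N.+1]. *)
Lemma cesaro_subsequence {R : realType} (c : nat -> R) (N : nat) :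
  (forall n, 0 <= c n) -> n.+1%:R^-1 * (\sum_(k < n.+1) c k) @[n --> \oo] --> (0 : R) ->
  n.+1%:R^-1 * (\sum_(k < n.+1) c (k * N.+1)%N) @[n --> \oo] --> (0 : R).
Proof.
move=> c0 hc; apply/cvgrPdist_le => e e0.
have e'0 : 0 < e / N.+1%:R by rewrite divr_gt0.
have /cvgrPdist_le /(_ _ e'0) [n0 _ hn0] := hc.
have sub n : \sum_(k < n) c (k * N.+1)%N <= \sum_(k < n * N.+1) c k.
  elim: n => [|n IH]; first by rewrite mul0n !big_ord0.
  rewrite big_ord_recr /= mulSnr big_split_ord /= lerD//.
  by rewrite big_ord_recl /= addn0 lerDl sumr_ge0.
exists n0 => // n /= n0n; set M := (n.+1 * N.+1).-1.
have ME : M.+1 = (n.+1 * N.+1)%N by rewrite /M prednK// muln_gt0.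
have nM : (n <= M)%N by rewrite -ltnS ME leq_pmulr.
have := hn0 M (leq_trans n0n nM); rewrite !sub0r !normrN ME.
rewrite !ger0_norm ?mulr_ge0 ?invr_ge0 ?sumr_ge0// => h.
rewrite ler_pdivrMl ?ltr0n//; apply: le_trans (sub n.+1) _.
move: h; rewrite ler_pdivrMl; last by rewrite ltr0n muln_gt0.
by rewrite natrM -mulrA; congr (_ <= _ * _); rewrite mulrC divfK// pnatr_eq0.
Qed.

Lemma power_unbounded {R : realType} (lam B : R) : 1 < lam -> exists n : nat, B <= lam ^+ n.+1.
Proof.
move=> lam1; pose d := lam - 1; have d0 : 0 < d by rewrite subr_gt0.
have bern n : 1 + n%:R * d <= lam ^+ n.
  elim: n => [|n IH]; first by rewrite mul0r addr0.
  rewrite exprS -natr1; have : lam * (1 + n%:R * d) <= lam * lam ^+ n by rewrite ler_pM2l//; lra.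
  have : 0 <= n%:R * d * d by rewrite !mulr_ge0// ltW.
  have -> : lam = d + 1 by rewrite /d subrK.
  by set t := n%:R; lra.
exists (Num.truncn (`|B| / d)); apply: le_trans (bern _).
have /andP[_ h] := truncn_itv (divr_ge0 (normr_ge0 B) (ltW d0)).
move: h; rewrite ltr_pdivrMr// => h.
by have := ler_norm B; lra.
Qed.

(** * Itineraries of the power and the sigma-algebras of the original partition *)

Section Letters.
Context {R : realType} (T : R -> R) (alpha : set (set R)) (n0 : nat) (s : expanding R).
Local Notation X := (@X R).
Hypotheses (T_X : forall x, X x -> X (T x))
  (T_meas : measurable_fun (X : set (measurableTypeR R))
    (T : measurableTypeR R -> measurableTypeR R))
  (disj : trivIset alpha id)
  (alpha_open : forall a, alpha a -> open_interval a)
  (sT : eS s = iter n0.+1 T)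
  (s_pieces : forall i, eu s i < ev s i -> pieces T alpha n0 `]eu s i, ev s i[%classic).
Implicit Types (x y : R) (A B : set (measurableTypeR R)).

Lemma pieces_letter n c x y j : pieces T alpha n c -> c x -> c y -> (j <= n)%N ->
  exists2 a, alpha a & a (iter j T x) /\ a (iter j T y).
Proof.
elim: n c x y j => [|n IH] c x y j.
  by move=> ac cx cy; rewrite leqn0 => /eqP ->; exists c.
move=> [_ [a ala [b beb ->]]] [ax bx] [ay by_].
case: j => [|j]; first by exists a.
by rewrite ltnS !iterSr; exact: IH beb bx by_.
Qed.

(** Off this set, which is null for [P], the itinerary of rank [q] determines the branches visited,
    in spite of the default code 0. *)
Definition escape q : set (measurableTypeR R) :=
  [set x | X x /\ exists2 i, (i < q)%N & ~ exists j, branch s j (iter i (eS s) x)].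

Lemma branch_letter i x y j : branch s i x -> branch s i y -> (j < n0.+1)%N ->
  exists2 a, alpha a & a (iter j T x) /\ a (iter j T y).
Proof.
move=> bx by_ jn; have uv : eu s i < ev s i by case/andP: bx => /lt_trans h /h.
by apply: (pieces_letter (s_pieces uv)) => //; rewrite /= in_itv.
Qed.

Lemma itinerary_branch q x y i : X x -> X y -> ~ escape q x -> ~ escape q y ->
  itinerary s q x = itinerary s q y -> (i < q)%N ->
  exists j, branch s j (iter i (eS s) x) /\ branch s j (iter i (eS s) y).
Proof.
move=> Xx Xy nx ny.
have good z : X z -> ~ escape q z -> forall i, (i < q)%N -> exists j, branch s j (iter i (eS s) z).
  by move=> Xz nz k kq; apply: contrapT => h; apply: nz; split => //; exists k.
have e k z : nth 0%N (itinerary s q z) k = if (k < q)%N then code s (iter k (eS s) z) else 0%N.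
  elim: q k z {good nx ny} => [|q IH] [|k] z //=; by rewrite IH ltnS -iterSr.
move=> eq iq; have [j hj] := good x Xx nx i iq; have [j' hj'] := good y Xy ny i iq.
have := congr1 (fun l => nth 0%N l i) eq; rewrite !e iq (code_branch hj) (code_branch hj') => jj.
by exists j; rewrite {2}jj.
Qed.

Lemma itinerary_letter q x y l : X x -> X y -> ~ escape q x -> ~ escape q y ->
  itinerary s q x = itinerary s q y -> (l < q * n0.+1)%N ->
  exists2 a, alpha a & a (iter l T x) /\ a (iter l T y).
Proof.
move=> Xx Xy nx ny e lq.
have iq : (l %/ n0.+1 < q)%N by rewrite ltn_divLR.
have [i [bx by_]] := itinerary_branch Xx Xy nx ny e iq.
have := branch_letter bx by_ (ltn_pmod l (ltn0Sn n0)).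
by rewrite sT -!iterM -!iterD addnC -divn_eq.
Qed.

(** The sets that do not separate [x] from [y] form a sigma-algebra on [X]. It contains the
    generators, because the common itinerary prescribes the first [q * n0.+1 >= k] letters. *)
Lemma saturated q k A x y : (k <= q * n0.+1)%N -> <<s X, refined T alpha k >> A ->
  X x -> X y -> ~ escape q x -> ~ escape q y -> itinerary s q x = itinerary s q y ->
  A x -> A y.
Proof.
move=> kq sA Xx Xy nx ny e.
suff : A x <-> A y by case.
apply: (sA [set A | A x <-> A y]); split.
  split => //.
  - by move=> B /= AB; split => -[_ nB]; split => // /AB.
  - by move=> F FH; split => -[i _ Fi]; exists i => //; apply/(FH i).
move=> _ [_ [a ala ->]].
have key z z' : X z' -> (forall l, (l < k)%N -> exists2 b, alpha b & b (iter l T z) /\ b (iter l T z')) ->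
    (X `&` \bigcap_(k0 in `I_k) Xpreimage T k0 (a k0)) z ->
    (X `&` \bigcap_(k0 in `I_k) Xpreimage T k0 (a k0)) z'.
  move=> Xz' hl [Xz hz]; split => // l lk; split => //=.
  have [b alb [bz bz']] := hl l lk; have [_ /= az] := hz l lk.
  by rewrite (disj (ala l lk) alb)//; exists (iter l T z).
split; apply: key => // l lk.
- by apply: (@itinerary_letter q) => //; exact: leq_trans lk kq.
- by apply: (@itinerary_letter q) => //; exact: leq_trans lk kq.
Qed.

Lemma measurable_refined k A : <<s X, refined T alpha k >> A -> measurable A.
Proof.
have mX := @measurable_X R.
move=> sA; apply: (sA [set A | measurable (A : set (measurableTypeR R))]); split.
  split; first exact: measurable0.
  - by move=> B mB; exact: measurableD.
  - by move=> F mF; apply: bigcup_measurable => n _; exact: mF.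
move=> _ [_ [a ala ->]]; apply: measurableI => //.
apply: bigcap_measurableType => l /= lk; apply: measurable_self_preimage => //.
by apply: open_measurable; have [] := open_interval_ind (alpha_open (ala l lk)).
Qed.

Lemma escape_null (P : probability (measurableTypeR R) R) q :
  (forall B, measurable B -> (@lebesgue_measure R) B = 0%E -> P B = 0%E) ->
  (forall B, measurable B -> B `<=` X -> P (Xpreimage T 1 B) = P B) ->
  measurable (escape q) /\ P (escape q) = 0%E.
Proof.
move=> Pac Pinv; have mX := @measurable_X R.
pose U : set (measurableTypeR R) := X `\` [set x | exists i, eu s i < x < ev s i].
have mU : measurable U.
  apply: measurableD => //.
  rewrite (_ : [set x | _] = \bigcup_i branch s i); last first.
    by apply/seteqP; split => x [i]; [exists i | move=> _; exists i].
  by apply: bigcup_measurable => i _; exact: measurable_branch.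
have PU : P U = 0%E by apply: Pac => //; exact: ecover.
elim: q => [|q [IH1 IH2]].
  by rewrite (_ : escape 0%N = set0) ?measure0//; apply/seteqP; split => x // [_ []].
have -> : escape q.+1 = escape q `|` Xpreimage (eS s) q U.
  apply/seteqP; split => x.
    move=> [Xx [i]]; rewrite ltnS leq_eqVlt => /predU1P[->|iq] h.
      by right; split => //; split => //; exact: iter_X.
    by left; split => //; exists i.
  case=> [[Xx [i iq h]]|[Xx [_ h]]]; split => //.
    by exists i => //; rewrite ltnW.
  by exists q.
have mS : measurable (Xpreimage (eS s) q U) by exact: measurable_Xpreimage.
split; first exact: measurableU.
rewrite -IH2; apply: measureU0 => //.
rewrite sT Xpreimage_iter; transitivity (P U); last exact: PU.
by apply: (pr_preimage T_X T_meas Pinv) => // x [].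
Qed.

End Letters.

Section Assembly.
Context {R : realType} (T : R -> R) (alpha : set (set R))
  (P : probability (measurableTypeR R) R).
Local Notation X := (@X R).
Local Notation pr B := (fine (P B)).
Hypotheses (hAFU : is_AFU_map T alpha) (hP : acip T P) (hwm : weakly_mixing T P).
Implicit Types (A B D : set (measurableTypeR R)).

Let T_X : forall x, X x -> X (T x) := PM_self hAFU.
Let T_meas : measurable_fun (X : set (measurableTypeR R))
  (T : measurableTypeR R -> measurableTypeR R) := PM_measurable hAFU.
Let Pinv : forall B, measurable B -> B `<=` X -> P (Xpreimage T 1 B) = P B := proj2 hP.

(** All powers have distortion at most [A'], so any power with [lam ^+ n0.+1 >= 2 * (3 + A')] is
    admissible. *)
Lemma expanding_power : exists (n0 : nat) (s : expanding R), eS s = iter n0.+1 T /\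
  forall i, eu s i < ev s i -> pieces T alpha n0 `]eu s i, ev s i[%classic.
Proof.
have [lam [A [lam1 hT]]] := AFU_expanding_map hAFU.
have A0 := em_A0 hT; have l0 := em_lam0 hT.
pose A' := A * lam / (lam - 1).
have A'0 : 0 <= A' by rewrite divr_ge0 ?mulr_ge0// ?subr_ge0 ltW.
have [n0 hn0] := power_unbounded (2 * (3 + A')) lam1.
have [p [p1 hS]] := expanding_map_iter n0 lam1 hT.
have [|s sT hs] := expanding_of_map hS; last by exists n0, s.
apply: le_trans hn0; rewrite ler_wpM2l// lerD2l -/A' ler_piMr//.
by rewrite gerBl exprn_ge0// invr_ge0 ltW.
Qed.

Lemma power_weakly_mixing n0 A B : measurable A -> A `<=` X -> measurable B -> B `<=` X ->
  n.+1%:R^-1 * (\sum_(k < n.+1)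
    `|pr (A `&` Xpreimage (iter n0.+1 T) k B) - pr A * pr B|) @[n --> \oo] --> (0 : R).
Proof.
move=> mA AX mB BX.
have := @cesaro_subsequence R (fun i => `|pr (A `&` Xpreimage T i B) - pr A * pr B|) n0
  (fun i => normr_ge0 _) (hwm mA AX mB BX).
by under [in X in _ -> X]eq_fun do under eq_bigr do rewrite Xpreimage_iter.
Qed.

Theorem exponential_phi_minus : exists B r : R, [/\ 0 < B, 0 < r, r < 1 &
  forall n : nat, (1 <= n)%N -> (phi_minus T alpha P n <= (B * r ^+ n)%:E)%E].
Proof.
have mX := @measurable_X R.
have [n0 [s [sT hs]]] := expanding_power; pose N := n0.+1.
have Pac := proj1 hP.
have Pm B : measurable B -> (@lebesgue_measure R) B = 0%E -> P B = 0%E by exact: P_null Pac _.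
have Sinv B : measurable B -> B `<=` X -> P (Xpreimage (eS s) 1 B) = P B.
  by move=> mB BX; rewrite sT Xpreimage_iter; exact: (pr_preimage T_X T_meas Pinv).
have [h [Mh [vh h0 hfix hpr]]] := invariant_density Pac Sinv.
have H : is_invariant_density s P h Mh by split.
have wmS A B : measurable A -> A `<=` X -> measurable B -> B `<=` X ->
    n.+1%:R^-1 * (\sum_(k < n.+1) `|pr (A `&` Xpreimage (eS s) k B) - pr A * pr B|)
    @[n --> \oo] --> (0 : R).
  by rewrite sT; exact: power_weakly_mixing.
have [C [r [C0 r0 r1 hC]]] := cylinder_mixing H wmS (acip_prX Pac).
have N0 : 0 < N%:R :> R by rewrite ltr0n.
(* By Bernoulli's inequality [rho ^+ N >= r], so decay by [r] in [N] steps of [T] is decay at rate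
   [rho]. *)
pose rho := 1 - (1 - r) / N%:R.
have x01 : 0 <= (1 - r) / N%:R <= 1.
  rewrite divr_ge0 ?ler_pdivrMr ?(ltW N0)//; last by lra.
  have : 1 <= N%:R :> R by rewrite ler1n.
  by lra.
have rhoN : r <= rho ^+ N.
  apply: le_trans (bernoulli N x01).
  by rewrite [N%:R * _]mulrC divfK ?gt_eqF// opprB addrC subrK.
have rho1 : rho < 1 by rewrite /rho ltrBlDr ltrDl divr_gt0//; lra.
have rho0 : 0 < rho.
  rewrite lt_neqAle; apply/andP; split; last by rewrite subr_ge0; case/andP: x01.
  by apply/eqP => e; move: rhoN; rewrite -e expr0n /=; lra.
have r20 : 0 < r ^+ 2 by rewrite exprn_gt0.
(* [C / r ^+ 2] absorbs the two blocks of length [N] that are lost by rounding, and [r^-1] serves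
   for [n < N]. *)
pose B0 := C / r ^+ 2 + r^-1.
have ir0 : 0 < r^-1 by rewrite invr_gt0.
have Cr0 : 0 < C / r ^+ 2 by rewrite divr_gt0.
exists B0, rho; split => //; first exact: addr_gt0.
move=> n n1; apply: ub_ereal_sup => _ [k [A [D [k1 sA [B [mB BX] DE] [PA PD] ->]]]].
rewrite lee_fin.
have mA : measurable A by exact: (measurable_refined T_X T_meas (AFU_interval hAFU) sA).
have mD : measurable D by rewrite DE; exact: measurable_self_preimage.
have mAD : measurable (A `&` D) by exact: measurableI.
have prD0 : 0 < pr D by rewrite fine_gt0// PD/= ltey_eq pr_fin.
have rhon0 : 0 < rho ^+ n by rewrite exprn_gt0.
(* For [n < N] the trivial bound 1 is enough, as [rho ^+ n >= rho ^+ N >= r]. *)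
have [nN|Nn] := ltnP n N.
  have /andP[a0 a1] := pr_ge0_le1 P mA.
  have q0 : 0 <= pr (A `&` D) / pr D by rewrite divr_ge0 ?(ltW prD0)//; case/andP: (pr_ge0_le1 P mAD).
  have q1 : pr (A `&` D) / pr D <= 1.
    by rewrite ler_pdivrMr// mul1r; apply: pr_le => // x [].
  apply: (@le_trans _ _ 1); first by apply: unit_dist; apply/andP.
  apply: (@le_trans _ _ (r^-1 * rho ^+ n)); last by rewrite ler_wpM2r ?lerDr ?ltW.
  rewrite ler_pdivlMl// mulr1; apply: le_trans rhoN _.
  by apply: ler_wiXn2l; rewrite ?(ltW rho0) ?(ltW rho1)// ltnW.
(* n + k = (p + q) N + t, where q N is the least multiple of N that is >= k *)
pose q := (k.-1 %/ N).+1.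
have kq : (k <= q * N)%N.
  by have := ltn_ceil k.-1 (ltn0Sn n0); rewrite -/N -/q; case: (k) k1.
have qk : (q * N <= k + n0)%N.
  have := leq_trunc_div k.-1 N; rewrite /q mulSn; case: (k) k1 => // k' _ /=.
  by rewrite /N addSn ltnS addnC leq_add2r.
pose p := ((n + k - q * N) %/ N)%N; pose t := ((n + k - q * N) %% N)%N.
have qnk : (q * N <= n + k)%N.
  by apply: leq_trans qk _; rewrite addnC leq_add2r; apply: leq_trans Nn; exact: leqnSn.
have nkE : (n + k)%N = ((p + q) * N + t)%N.
  by rewrite mulnDl addnAC -divn_eq subnK.
(* [q * N] exceeds [k] by less than [N], and [t < N], so at most two blocks are missing. *)
have np : (n <= N * p.+2)%N.
  have tN : (t < N)%N by rewrite ltn_mod.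
  have e : (N * p.+2 + k = p * N + (k + N + N))%N by rewrite mulnC !mulSn; ring.
  rewrite -(leq_add2r k) e nkE mulnDl -addnA leq_add2l; apply: leq_add; last exact: ltnW.
  by apply: leq_trans qk _; rewrite leq_add2l.
(* The last [t] steps are moved into the target set, which leaves a whole number of steps of the
   power. *)
pose E := Xpreimage T t B.
have mE : measurable E by exact: measurable_self_preimage.
have EX : E `<=` X by move=> x [].
have DS : D = Xpreimage (eS s) (p + q) E.
  by rewrite DE sT Xpreimage_iter nkE Xpreimage_add.
have prE : pr E = pr D by rewrite /E DE !(pr_preimage T_X T_meas Pinv).
have [mesc esc0] := escape_null T_X T_meas sT q Pm Pinv.
(* The itineraries of the points of [A] off the null set; by [saturated], [A] agrees up to a null
   set with the union of the corresponding cylinders. *)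
pose W l := exists2 x, [/\ X x, ~ escape s q x & A x] & itinerary s q x = l.
set A' : set (measurableTypeR R) := [set x | X x /\ W (itinerary s q x)].
have mA' : measurable A' by exact: measurable_itinerary.
have AX : A `<=` X.
  move=> x; apply: (sA [set A | A `<=` X]); split; last by move=> _ [_ [a _ ->]] y [].
  by split => // [F _ y []//|F hF y [i _ /hF]].
have AA' x : ~ escape s q x -> A x <-> A' x.
  move=> nx; split; first by move=> Ax; split; [exact: AX | exists x => //; split => //; exact: AX].
  move=> [Xx [y [Xy ny Ay] e]].
  exact: (saturated (PM_disjoint hAFU) sT hs kq sA Xy Xx ny nx e Ay).
have prA : pr A = pr A' by exact: pr_mod_null mesc esc0 AA'.
have prAD : pr (A `&` D) = pr (A' `&` D).
  apply: (pr_mod_null mAD _ mesc esc0); first exact: measurableI.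
  by move=> x /AA' h'; split => -[/h' ? ?]; split.
have := hC q p W E mE EX; rewrite -/A' -DS -prA -prAD prE => hAD.
apply: (@le_trans _ _ (C * r ^+ p)).
  have -> : pr (A `&` D) / pr D - pr A = (pr (A `&` D) - pr A * pr D) / pr D.
    by field; rewrite gt_eqF.
  by rewrite normrM normfV (gtr0_norm prD0) ler_pdivrMr.
apply: (@le_trans _ _ (C / r ^+ 2 * rho ^+ n)); last by rewrite ler_wpM2r ?lerDl ?ltW.
have -> : C * r ^+ p = C / r ^+ 2 * r ^+ p.+2.
  by rewrite -[p.+2]addn2 exprD; field; rewrite gt_eqF.
rewrite ler_wpM2l ?(ltW Cr0)//; apply: (@le_trans _ _ (rho ^+ (N * p.+2))).
  by rewrite exprM lerXn2r// nnegrE ?(ltW r0)// exprn_ge0// ltW.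
by apply: ler_wiXn2l; rewrite ?(ltW rho0) ?(ltW rho1).
Qed.

End Assembly.

Unset Implicit Arguments.

Theorem mainTheorem2 (R : realType) (T : R -> R) (alpha : set (set R))
  (P : probability (measurableTypeR R) R)
  (hAFU : is_AFU_map T alpha)
  (hergodic : lebesgue_ergodic T)
  (hP : acip T P)
  (hwm : weakly_mixing T P) :
  exists B r : R, [/\ 0 < B, 0 < r, r < 1 &
    forall n : nat, (1 <= n)%N ->
      (phi_minus T alpha P n <= (B * r ^+ n)%:E)%E].
Proof. exact: exponential_phi_minus. Qed.
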